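(* Let $(G_i)_{i\in I}$ be a family of discrete groups, each of which is weakly amenable with constant $1$. Then the free product group $*_{i\in I}G_i$ is also weakly amenable with constant $1$.
   Context: For a discrete group $G$, $C^*_\lambda(G)$ is its reduced $C^*$-algebra, generated by the left regular representation $\lambda$ on $\ell_2(G)$. For $f:G\to\mathbb C$, $M_f$ denotes the Herz–Schur multiplier $M_f:C^*_\lambda(G)\to C^*_\lambda(G)$, $M_f(\lambda(g))=f(g)\lambda(g)$. $G$ is weakly amenable if there is a net of finitely supported functions $f_\alpha:G\to\mathbb C$ converging pointwise to the constant function $1$ with $\limsup_\alpha\|M_{f_\alpha}\|_{cb}<\infty$. The Haagerup constant $\Lambda(G)$ is the infimum of these $\limsup$'s over all such nets; ''weakly amenable with constant $1$'' means $\Lambda(G)=1$. *)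

(* Defs.v *)
From HB Require Import structures.
From mathcomp Require Import all_boot all_order all_algebra.
From mathcomp Require Import boolp classical_sets functions cardinality fsbigop.
From mathcomp Require Import reals ereal esum topology normedtype.
From mathcomp Require Import complex.
From mathcomp Require Import ring lra.

Set Implicit Arguments.
Unset Strict Implicit.
Unset Printing Implicit Defensive.

Import Order.TTheory GRing.Theory Num.Theory.
Import numFieldNormedType.Exports.

Local Open Scope quotient_scope.
Local Open Scope classical_set_scope.
Local Open Scope ring_scope.

(* The free product of the [G i] is the monoid of words in the letters (i, g),
   g : G i, modulo the congruence generated by (i, 1) = empty word and
   (i, g)(i, h) = (i, g h).  [{classic _}] only equips the letters with a
   choiceType structure, so that the index type [I] can be an arbitrary type. *)
Section FreeProduct.
Context {I : Type} (G : I -> groupType).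

Definition fp_letter := {classic {i : I & G i}}.
Definition fp_word := seq fp_letter.
Definition letter (i : I) (g : G i) : fp_letter := existT (fun i => G i) i g.

Inductive fp_cong : fp_word -> fp_word -> Prop :=
| fp_refl u : fp_cong u u
| fp_sym u v : fp_cong u v -> fp_cong v u
| fp_trans u v w : fp_cong u v -> fp_cong v w -> fp_cong u w
| fp_cat u u' v v' :
    fp_cong u u' -> fp_cong v v' -> fp_cong (u ++ v) (u' ++ v')
| fp_unit (i : I) : fp_cong [:: letter (1%g : G i)] [::]
| fp_mult (i : I) (g h : G i) :
    fp_cong [:: letter g; letter h] [:: letter (g * h)%g].

Definition fp_eqv (u v : fp_word) : bool := `[< fp_cong u v >].

Fact fp_eqv_refl : reflexive fp_eqv.
Proof. by move=> u; apply/asboolP; exact: fp_refl. Qed.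

Fact fp_eqv_sym : symmetric fp_eqv.
Proof. by move=> u v; apply/asboolP/asboolP; exact: fp_sym. Qed.

Fact fp_eqv_trans : transitive fp_eqv.
Proof.
by move=> v u w /asboolP uv /asboolP vw; apply/asboolP; exact: fp_trans uv vw.
Qed.

Canonical fp_equiv := EquivRel fp_eqv fp_eqv_refl fp_eqv_sym fp_eqv_trans.

Definition freeprod := {eq_quot fp_equiv}.
HB.instance Definition _ := Choice.on freeprod.

Definition fp_class (u : fp_word) : freeprod := \pi_freeprod u.

Lemma fp_classP (u v : fp_word) : fp_class u = fp_class v <-> fp_cong u v.
Proof.
split=> [/eqP|uv]; last by apply/eqP; rewrite piE; apply/asboolP.
by rewrite piE => /asboolP.
Qed.

Lemma fp_classK (x : freeprod) : fp_class (repr x) = x.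
Proof. exact: reprK. Qed.

Definition inv_letter (l : fp_letter) : fp_letter := letter (projT2 l)^-1%g.
Definition inv_word (u : fp_word) : fp_word := rev (map inv_letter u).

Definition fp_one : freeprod := fp_class [::].
Definition fp_mul (x y : freeprod) : freeprod := fp_class (repr x ++ repr y).
Definition fp_inv (x : freeprod) : freeprod := fp_class (inv_word (repr x)).

Lemma fp_mulE (u v : fp_word) :
  fp_mul (fp_class u) (fp_class v) = fp_class (u ++ v).
Proof. by apply/fp_classP/fp_cat; apply/fp_classP; rewrite fp_classK. Qed.

Fact fp_mulA : associative fp_mul.
Proof.
move=> x y z; rewrite -[x]fp_classK -[y]fp_classK -[z]fp_classK.
by rewrite !fp_mulE catA.
Qed.

Fact fp_mul1 : left_id fp_one fp_mul.
Proof. by move=> x; rewrite -[x]fp_classK fp_mulE. Qed.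

Fact fp_mulr1 : right_id fp_one fp_mul.
Proof. by move=> x; rewrite -[x]fp_classK fp_mulE cats0. Qed.

Lemma inv_wordK : involutive inv_word.
Proof.
move=> u; rewrite /inv_word map_rev revK -map_comp -[RHS]map_id.
by apply: eq_map => -[i g]; rewrite /inv_letter /= invgK.
Qed.

Lemma fp_catV (u : fp_word) : fp_cong (inv_word u ++ u) [::].
Proof.
elim: u => [|[i g] u IHu]; first exact: fp_refl.
rewrite /inv_word /= rev_cons cat_rcons.
apply: fp_trans IHu; apply: fp_cat; first exact: fp_refl.
rewrite -[X in fp_cong _ X]cat0s -cat1s -(cat1s _ u) catA.
apply: fp_cat; last exact: fp_refl.
apply: fp_trans (fp_unit i).
by have := fp_mult g^-1 g; rewrite mulVg.
Qed.

Fact fp_mulV : left_inverse fp_one fp_inv fp_mul.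
Proof.
move=> x; rewrite -{2}[x]fp_classK fp_mulE; apply/fp_classP; exact: fp_catV.
Qed.

Fact fp_mulrV : right_inverse fp_one fp_inv fp_mul.
Proof.
move=> x; rewrite -{1}[x]fp_classK fp_mulE; apply/fp_classP.
by rewrite -{1}[repr x]inv_wordK; exact: fp_catV.
Qed.

HB.instance Definition _ := isGroup.Build freeprod
  fp_mulA fp_mul1 fp_mulr1 fp_mulV fp_mulrV.

Definition fp_in (i : I) (g : G i) : freeprod := fp_class [:: letter g].

Lemma fp_inM (i : I) : {morph @fp_in i : g h / (g * h)%g}.
Proof.
move=> g h; rewrite [RHS](fp_mulE [:: letter g] [:: letter h]).
by apply/fp_classP/fp_sym/fp_mult.
Qed.

End FreeProduct.

Lemma freeprod_universal (I : Type) (G : I -> groupType) (H : groupType)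
    (phi : forall i, G i -> H) :
  (forall i, {morph phi i : g h / (g * h)%g}) ->
  exists! psi : freeprod G -> H,
    {morph psi : x y / (x * y)%g} /\
    (forall i (g : G i), psi (fp_in g) = phi i g).
Proof.
move=> phiM.
pose ev (u : fp_word G) : H :=
  foldr (fun l a => (phi (projT1 l) (projT2 l) * a)%g) 1%g u.
have phi1 i : phi i 1%g = 1%g.
  by apply: (mulgI (phi i 1%g)); rewrite -phiM !mulg1.
have evM u v : ev (u ++ v) = (ev u * ev v)%g.
  by elim: u => [|l u IHu] /=; rewrite ?mul1g // IHu mulgA.
have evE u v : fp_cong u v -> ev u = ev v.
  elim=> {u v} // [u v w _ -> _ -> //|u u' v v' _ uu' _ vv'|i|i g h].
  - by rewrite !evM uu' vv'.
  - by rewrite /= phi1 mul1g.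
  - by rewrite /= !mulg1 phiM.
have evK u : ev (repr (fp_class u)) = ev u.
  by apply/evE/fp_classP; rewrite fp_classK.
exists (fun x => ev (repr x)); split; first split.
- by move=> x y; rewrite evK evM.
- by move=> i g; rewrite evK /= mulg1.
move=> psi [psiM psi_in]; apply/funext => x.
rewrite -[in RHS](fp_classK x); elim: (repr x) => [|[i g] u IHu] /=.
  by apply: (mulgI (psi 1%g)); rewrite -psiM !mulg1.
have -> : fp_class (existT _ i g :: u) = (fp_in g * fp_class u)%g.
  exact/esym/(fp_mulE [:: letter g] u).
by rewrite psiM psi_in IHu.
Qed.

Section SquareSummable.
Variables (R : realType) (G : groupType).
Local Notation C := (R[i]^o).

Definition sqsum (x : G -> C) : \bar R :=
  \esum_(g in [set: G]) ((Normc.normc (x g) ^+ 2)%:E).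

Definition square_summable : {pred G -> C} :=
  fun x => `[< (sqsum x < +oo)%E >].

Lemma normc_ge0 (z : R[i]) : 0 <= Normc.normc z :> R.
Proof. by case: z => ? ?; exact: sqrtr_ge0. Qed.

Lemma sqsum_ge0 (x : G -> C) : (0 <= sqsum x)%E.
Proof. by apply: esum_ge0 => g _; rewrite lee_fin sqr_ge0. Qed.

Lemma sqsumZ (a : R[i]) (x : G -> C) :
  (sqsum (a *: x) <= (Normc.normc a ^+ 2)%:E * sqsum x)%E.
Proof.
have a0 : 0 <= Normc.normc a ^+ 2 by rewrite sqr_ge0.
apply: ge_ereal_sup => _ [A [fA _] <-].
under eq_fsbigr do rewrite Normc.normcM exprMn EFinM.
rewrite -ge0_mule_fsumr => [|g]; last by rewrite lee_fin sqr_ge0.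
by apply: lee_wpmul2l; [rewrite lee_fin|apply: ereal_sup_ubound; exists A].
Qed.

Lemma sqsumD (x y : G -> C) :
  (sqsum (x + y)%R <= (sqsum x + sqsum x) + (sqsum y + sqsum y))%E.
Proof.
rewrite /sqsum -!esumD; do ?by move=> g _; rewrite ?adde_ge0 ?lee_fin ?sqr_ge0.
apply: le_esum => g _; rewrite -!EFinD lee_fin.
have nD : Normc.normc ((x + y) g) <= Normc.normc (x g) + Normc.normc (y g).
  exact: le_normcD.
have := normc_ge0 ((x + y) g).
have := normc_ge0 (x g); have := normc_ge0 (y g); move: nD.
move: (Normc.normc (_ g)) (Normc.normc (x g)) (Normc.normc (y g)) => p q r.
move=> pqr r0 q0 p0; have : p ^+ 2 <= (q + r) ^+ 2 by rewrite ler_sqr ?nnegrE// addr_ge0.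
by have := sqr_ge0 (q - r); rewrite !expr2; lra.
Qed.

Fact square_summable_submod : GRing.submod_closed square_summable.
Proof.
split=> [|a x y /asboolP xoo /asboolP yoo]; apply/asboolP.
  rewrite /sqsum esum1 // => g _.
  by rewrite [X in Normc.normc X](_ : _ = 0) // Normc.normc0 expr0n.
apply: (le_lt_trans (sqsumD _ _)).
have axoo : (sqsum (a *: x) < +oo)%E.
  apply: (le_lt_trans (sqsumZ _ _)).
  by rewrite lte_mul_pinfty // ?lee_fin ?sqr_ge0.
by rewrite !lte_add_pinfty.
Qed.

HB.instance Definition _ :=
  GRing.isSubmodClosed.Build R[i] (G -> C) square_summable
    square_summable_submod.

Record l2 : Type := L2 {
  l2_fun :> G -> C;
  l2P : l2_fun \in square_summable }.

HB.instance Definition _ := [isSub for l2_fun].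
HB.instance Definition _ := [Choice of l2 by <:].
HB.instance Definition _ := [SubChoice_isSubLmodule of l2 by <:].

Definition l2norm (x : l2) : R := Num.sqrt (fine (sqsum x)).

Fact square_summable_translate (g : G) (x : l2) :
  (fun h => x (g^-1 * h)%g) \in square_summable.
Proof.
apply/asboolP; have /asboolP := l2P x; congr (_ < _)%E.
rewrite /sqsum (reindex_esum [set: G] [set: G] (fun h => (g^-1 * h)%g)) //=.
split=> //; first by move=> h k _ _; exact: mulgI.
by move=> h _; exists (g * h)%g => //; rewrite mulKg.
Qed.

(* (lambda(g) x)(h) = x(g^-1 h), i.e. lambda(g) delta_h = delta_(g h). *)
Definition lreg (g : G) (x : l2) : l2 := L2 (square_summable_translate g x).

Definition opnorm (T : l2 -> l2) : \bar R :=
  ereal_sup [set (l2norm (T x))%:E | x in [set x | l2norm x <= 1]].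

Definition bounded_operator (T : l2 -> l2) : Prop :=
  linear T /\ (opnorm T < +oo)%E.

(* The operator-norm closure, in the bounded operators on l2(G), of the linear
   span of the lambda(g).  This span is already a unital *-subalgebra, because
   lambda(g) lambda(h) = lambda(g h) and lambda(g)^* = lambda(g^-1), so that its
   closure is the C*-algebra generated by the left regular representation. *)
Definition reduced_Cstar : {pred l2 -> l2} := fun T =>
  `[< bounded_operator T /\
      forall e : R, 0 < e ->
        exists s : seq (R[i] * G),
          (opnorm (T - \sum_(p <- s) p.1 *: lreg p.2)%R < e%:E)%E >].

Lemma opnorm_leP (T : l2 -> l2) (c : R) :
  (opnorm T <= c%:E)%E <-> forall x, l2norm x <= 1 -> l2norm (T x) <= c.
Proof.
split=> [Tc x x1|Tc]; last first.
  by apply: ge_ereal_sup => _ [x /Tc Txc <-]; rewrite lee_fin.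
rewrite -lee_fin; apply: le_trans Tc.
by apply: ereal_sup_ubound; exists x.
Qed.

Lemma l2norm_ge0 (x : l2) : 0 <= l2norm x. Proof. exact: sqrtr_ge0. Qed.

Lemma sqsum_l2norm (x : l2) : sqsum x = (l2norm x ^+ 2)%:E.
Proof.
have x0 := sqsum_ge0 x.
rewrite sqr_sqrtr ?fine_ge0// fineK // ge0_fin_numE //.
by have /asboolP := l2P x.
Qed.

Lemma le_l2norm (x : l2) (g : G) : Normc.normc (x g) <= l2norm x.
Proof.
rewrite -(@ler_sqr R) ?nnegrE ?l2norm_ge0 ?normc_ge0 // -lee_fin -sqsum_l2norm.
apply: ereal_sup_ubound; exists [set g]; last by rewrite fsbig_set1.
by split=> //; exact: finite_set1.
Qed.

Lemma l2norm0 : l2norm 0 = 0.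
Proof.
rewrite /l2norm /sqsum esum1 ?sqrtr0// => g _.
by rewrite [X in Normc.normc X](_ : _ = 0) // Normc.normc0 expr0n.
Qed.

Lemma l2normP (a : R[i]) (x y : l2) :
  l2norm (a *: x + y) <= 2 * (Normc.normc a * l2norm x + l2norm y).
Proof.
have a0 := normc_ge0 a.
have [x0 y0] := (l2norm_ge0 x, l2norm_ge0 y).
have ax0 : 0 <= Normc.normc a * l2norm x by rewrite mulr_ge0.
rewrite -[leRHS]ger0_norm ?mulr_ge0 ?addr_ge0// -sqrtr_sqr ler_sqrt ?sqr_ge0//.
rewrite -lee_fin -[X in (X <= _)%E]/((fine (sqsum (a *: x + y)))%:E).
have -> : (fine (sqsum (a *: x + y)))%:E = sqsum (a *: x + y).
  by rewrite sqsum_l2norm.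
apply: (le_trans (sqsumD (a *: (x : G -> C)) y)).
apply: (@le_trans _ _ ((Normc.normc a ^+ 2 * l2norm x ^+ 2 *+ 2 +
                        l2norm y ^+ 2 *+ 2)%:E)).
  rewrite (sqsum_l2norm y) !mulr2n EFinD !EFinD leeD2r //.
  by rewrite EFinM -sqsum_l2norm leeD // sqsumZ.
by rewrite lee_fin -exprMn; nra.
Qed.

Lemma opnormP (a : R[i]) (T S : l2 -> l2) (c d : R) :
  (opnorm T <= c%:E -> opnorm S <= d%:E ->
   opnorm (a *: T + S)%R <= (2 * (Normc.normc a * c + d))%:E)%E.
Proof.
have a0 := normc_ge0 a.
move=> /opnorm_leP Tc /opnorm_leP Sd; apply/opnorm_leP => x x1.
apply: (le_trans (l2normP a (T x) (S x))); apply: ler_wpM2l; first by [].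
by apply: lerD; [apply: ler_wpM2l a0 _ _ (Tc x x1)|exact: Sd].
Qed.

Lemma opnorm0 : opnorm 0 = 0%E.
Proof.
apply/eqP; rewrite eq_le; apply/andP; split.
  by apply/opnorm_leP => x _; rewrite l2norm0.
by apply: ereal_sup_ubound; exists 0; rewrite /= l2norm0.
Qed.

Lemma opnorm_ge0 (T : l2 -> l2) : (0 <= opnorm T)%E.
Proof.
apply: (@le_trans _ _ (l2norm (T 0))%:E); first by rewrite lee_fin l2norm_ge0.
by apply: ereal_sup_ubound; exists 0; rewrite //= l2norm0.
Qed.

Lemma opnorm_fin (T : l2 -> l2) :
  (opnorm T < +oo)%E -> exists c : R, (opnorm T <= c%:E)%E.
Proof.
by case: (opnorm T) => [c _||] //; [exists c|exists 0; rewrite leNye].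
Qed.

Let half_eps (k e : R) : 0 <= k -> 0 < e ->
  2 * (k * (e / (4 * (k + 1))) + e / (4 * (k + 1))) < e.
Proof.
move=> k0 e0; have k1 : k + 1 != 0 by rewrite gt_eqF // ltr_wpDl.
rewrite [ltLHS](_ : _ = e / 2); first by lra.
by field.
Qed.

Fact reduced_Cstar_submod : GRing.submod_closed reduced_Cstar.
Proof.
split=> [|a T S /asboolP[[Tlin /opnorm_fin[c Tc]] Tapp]
           /asboolP[[Slin /opnorm_fin[d Sd]] Sapp]]; apply/asboolP.
  split=> [|e e0]; last by exists [::]; rewrite big_nil subr0 opnorm0 lte_fin.
  by split=> [k x y|]; rewrite ?opnorm0 ?ltry// [RHS]addr0 scaler0.
split=> [|e e0].
  split=> [k x y|]; last by apply: le_lt_trans (opnormP a Tc Sd) _; rewrite ltry.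
  rewrite /= -[LHS]/(a *: T (k *: x + y) + S (k *: x + y)).
  rewrite Tlin Slin -[(a *: T + S) x]/(a *: T x + S x).
  rewrite -[(a *: T + S) y]/(a *: T y + S y) !scalerDr !scalerA.
  by rewrite (mulrC a k) addrACA.
have a0 := normc_ge0 a.
have k0 : 0 < 4 * (Normc.normc a + 1) by lra.
have d0 : 0 < e / (4 * (Normc.normc a + 1)) by rewrite divr_gt0.
have [s /ltW Ts] := Tapp _ d0; have [t /ltW St] := Sapp _ d0.
exists ([seq (a * p.1, p.2) | p <- s] ++ t); rewrite big_cat big_map /=.
have -> : \sum_(p <- s) (a * p.1) *: lreg p.2 =
          a *: \sum_(p <- s) p.1 *: lreg p.2.
  by rewrite scaler_sumr; apply: eq_bigr => p _; rewrite scalerA.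
rewrite opprD addrACA -scalerBr.
apply: le_lt_trans (opnormP a Ts St) _; rewrite lte_fin.
exact: half_eps.
Qed.

HB.instance Definition _ :=
  GRing.isSubmodClosed.Build R[i] (l2 -> l2) reduced_Cstar
    reduced_Cstar_submod.

Record Cstar : Type := MkCstar {
  Cstar_op :> l2 -> l2;
  CstarP : Cstar_op \in reduced_Cstar }.

HB.instance Definition _ := [isSub for Cstar_op].
HB.instance Definition _ := [Choice of Cstar by <:].
HB.instance Definition _ := [SubChoice_isSubLmodule of Cstar by <:].

Fact lreg_linear (g : G) : linear (lreg g).
Proof. by move=> a x y; apply/val_inj/funext. Qed.

Lemma l2norm_lreg (g : G) (x : l2) : l2norm (lreg g x) = l2norm x.
Proof.
congr (Num.sqrt (fine _)).
rewrite /sqsum [RHS](reindex_esum [set: G] [set: G] (fun h => (g^-1 * h)%g)) //.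
split=> //; first by move=> h k _ _; exact: mulgI.
by move=> h _; exists (g * h)%g => //; rewrite mulKg.
Qed.

Fact lreg_in_Cstar (g : G) : lreg g \in reduced_Cstar.
Proof.
apply/asboolP; split.
  split; first exact: lreg_linear.
  apply: (@le_lt_trans _ _ 1%:E); last by rewrite ltry.
  by apply/opnorm_leP => x; rewrite l2norm_lreg.
move=> e e0; exists [:: (1, g)].
by rewrite big_seq1 /= scale1r subrr opnorm0 lte_fin.
Qed.

Definition lambda (g : G) : Cstar := MkCstar (lreg_in_Cstar g).

(* The norm of M_n(C*_lambda(G)), i.e. the operator norm on l2(G)^n. *)
Definition l2n_norm (n : nat) (x : 'I_n -> l2) : R :=
  Num.sqrt (\sum_(i < n) l2norm (x i) ^+ 2).

Definition mxact (n : nat) (T : 'M[Cstar]_n) (x : 'I_n -> l2) : 'I_n -> l2 :=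
  fun i => \sum_(j < n) T i j (x j).

Definition mxopnorm (n : nat) (T : 'M[Cstar]_n) : \bar R :=
  ereal_sup [set (l2n_norm (mxact T x))%:E | x in
               [set x : 'I_n -> l2 | l2n_norm x <= 1]].

(* sup_n ||id_(M_n) (x) M||; the value is +oo if M is not completely bounded. *)
Definition cb_norm (M : Cstar -> Cstar) : \bar R :=
  ereal_sup [set z | exists (n : nat) (T : 'M[Cstar]_n),
                       (mxopnorm T <= 1)%E /\ z = mxopnorm (map_mx M T)].

Definition bounded_map (M : Cstar -> Cstar) : Prop :=
  exists c : R, forall T : Cstar, (opnorm (M T) <= c%:E * opnorm T)%E.

(* [is_multiplier f M] says that M is the Herz-Schur multiplier M_f.  It is
   unique by [is_multiplier_unique], the span of the lambda g being dense, and
   it exists by [is_multiplier_exists] if f is finitely supported. *)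
Definition is_multiplier (f : G -> C) (M : {linear Cstar -> Cstar}) : Prop :=
  bounded_map M /\ forall g : G, M (lambda g) = f g *: lambda g.

Lemma opnorm_eq0 (T : Cstar) : (opnorm T <= 0)%E -> T = 0.
Proof.
move=> /opnorm_leP T0; have /asboolP[[Tlin _] _] := CstarP T.
apply/val_inj/funext => x; apply/val_inj/funext => g /=.
have TZ k : (T : l2 -> l2) (k *: x) = k *: T x.
  have T00 : (T : l2 -> l2) 0 = 0.
    by have := Tlin (-1) 0 0; rewrite scaler0 addr0 scaleN1r addNr.
  by have := Tlin k x 0; rewrite T00 !addr0.
have n0 : 0 <= 2 * l2norm x + 1 by rewrite addr_ge0 ?mulr_ge0 ?l2norm_ge0.
have p0 : 2 * l2norm x + 1 != 0 by rewrite gt_eqF // ltr_wpDl ?mulr_ge0 ?l2norm_ge0.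
pose k : R[i] := ((2 * l2norm x + 1)^-1)%:C%C.
have k0 : k != 0 by rewrite /k fmorph_eq0 invr_eq0.
have nk : Normc.normc k = (2 * l2norm x + 1)^-1.
  by rewrite /k /= expr0n /= addr0 sqrtr_sqr ger0_norm // invr_ge0.
have kx1 : l2norm (k *: x) <= 1.
  rewrite -[k *: x]addr0; apply: le_trans (l2normP k x 0) _.
  rewrite l2norm0 addr0 nk mulrCA ler_pdivrMl ?lt_neqAle 1?eq_sym ?p0 //.
  by rewrite mulr1 lerDl.
have := T0 _ kx1; rewrite TZ => Tkx.
have : l2norm (k *: T x) = 0 by apply/eqP; rewrite eq_le Tkx l2norm_ge0.
move=> Tkx0; have := le_l2norm (k *: T x) g; rewrite Tkx0 => le0.
have /Normc.eq0_normc/eqP : Normc.normc ((k *: T x : l2) g) = 0.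
  by apply/eqP; rewrite eq_le le0 normc_ge0.
by rewrite -[(k *: T x : l2) g]/(k * T x g) mulf_eq0 (negbTE k0) => /eqP.
Qed.

Lemma is_multiplier_unique (f : G -> C) (M N : {linear Cstar -> Cstar}) :
  is_multiplier f M -> is_multiplier f N -> M =1 N.
Proof.
move=> [[c Mc] Mf] [[d Nd] Nf] T; apply/subr0_eq/opnorm_eq0.
have LE (e : R) : 0 < e ->
    (opnorm ((M T - N T)%R : Cstar) <= (2 * (`|d| * e + `|c| * e))%:E)%E.
  move=> e0; have /asboolP[_ /(_ _ e0)[s /ltW Ts]] := CstarP T.
  pose S : Cstar := \sum_(p <- s) p.1 *: lambda p.2.
  have SE : (S : l2 -> l2) = \sum_(p <- s) p.1 *: lreg p.2.
    by rewrite -[LHS]/(val S) raddf_sum.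
  have MNS : M S = N S.
    by rewrite !linear_sum; apply: eq_bigr => p _; rewrite !linearZ Mf Nf.
  rewrite [X in opnorm (Cstar_op X)](_ : _ =
      (-1) *: N (T - S) + M (T - S) :> Cstar); last first.
    by rewrite scaleN1r (linearB N) (linearB M) MNS opprB [RHS]addrC addrA subrK.
  have TSe : (opnorm ((T - S)%R : Cstar) <= e%:E)%E.
    by rewrite -[(T - S : Cstar) : l2 -> l2]/(val (T - S)) raddfB /= SE.
  have D k (L : Cstar -> Cstar) :
      (forall U, (opnorm (L U) <= k%:E * opnorm U)%E) ->
      (opnorm (L (T - S)%R) <= (`|k| * e)%:E)%E.
    move=> Lk; apply: le_trans (Lk _) _; rewrite EFinM.
    apply: (@le_trans _ _ (`|k|%:E * opnorm ((T - S)%R : Cstar))%E).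
      by apply: lee_wpmul2r; rewrite ?opnorm_ge0// lee_fin ler_norm.
    by apply: lee_wpmul2l.
  have := opnormP (-1) (D _ _ Nd) (D _ _ Mc).
  by rewrite normcN Normc.normc1 mul1r.
apply/lee_addgt0Pr => e e0; rewrite add0e.
have p0 : 0 < 2 * (`|d| + `|c| + 1).
  by rewrite mulr_gt0 // ltr_wpDl // addr_ge0.
have := LE (e / (2 * (`|d| + `|c| + 1))) (divr_gt0 e0 p0).
move=> /le_trans; apply; rewrite lee_fin -mulrDl !mulrA.
by rewrite ler_pdivrMr // (mulrC _ e) ler_wpM2l ?(ltW e0) // ler_wpM2l // lerDl.
Qed.

Lemma sqsum_delta (g : G) : sqsum (fun h => (h == g)%:R) = 1%E.
Proof.
have <- : \esum_(h in [set g]) (1%E : \bar R) = 1%E by rewrite esum_set1.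
rewrite /sqsum [RHS]esum_mkcond.
apply: eq_esum => h _; have [->|hg] := eqVneq h g.
  by rewrite mem_set // [X in Normc.normc X](_ : _ = 1) // Normc.normc1 expr1n.
rewrite memNset => [|/eqP]; last by rewrite (negbTE hg).
by rewrite [X in Normc.normc X](_ : _ = 0) // Normc.normc0 expr0n.
Qed.

Fact square_summable_delta (g : G) :
  (fun h => (h == g)%:R) \in square_summable.
Proof. by apply/asboolP; rewrite sqsum_delta ltry. Qed.

Definition delta (g : G) : l2 := L2 (square_summable_delta g).

Lemma l2norm_delta (g : G) : l2norm (delta g) = 1.
Proof. by rewrite /l2norm sqsum_delta sqrtr1. Qed.

Lemma is_multiplier_exists (f : G -> C) :
  finite_set [set g | f g != 0] -> exists M, is_multiplier f M.
Proof.
move=> ffin.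
have [A Auniq memA] : exists2 A : seq G, uniq A & forall g, f g != 0 -> g \in A.
  have [s sE] := (finite_seqP _).1 ffin.
  exists (undup s); first exact: undup_uniq.
  move=> g fg; rewrite mem_undup.
  by have : [set g | f g != 0] g by []; rewrite sE.
pose F (B : seq G) (T : Cstar) : Cstar :=
  \sum_(g <- B) (f g * T (delta 1%g) g) *: lambda g.
have Flin B : linear (F B).
  move=> a T S; rewrite /F scaler_sumr -big_split; apply: eq_bigr => g _.
  rewrite [RHS](_ : _ = a *: ((f g * T (delta 1%g) g) *: lambda g) +
                        (f g * S (delta 1%g) g) *: lambda g) //.
  rewrite scalerA -scalerDl; congr (_ *: _).
  rewrite [X in f g * X](_ : _ = a * T (delta 1%g) g + S (delta 1%g) g) //.
  by rewrite mulrDr mulrCA.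
pose ML := GRing.isLinear.Build _ _ _ _ (F A) (Flin A).
pose M : {linear Cstar -> Cstar} := HB.pack_for {linear Cstar -> Cstar} (F A) ML.
exists M; split; last first.
  move=> h; rewrite -[LHS]/(F A (lambda h)) /F.
  have E g : lambda h (delta 1%g) g = (g == h)%:R.
    by rewrite -[g == h](inj_eq (mulgI h^-1%g)) mulVg.
  under eq_bigr do rewrite E.
  have [hA|hA] := boolP (h \in A).
    rewrite (bigD1_seq h) //= eqxx mulr1 big1 ?addr0 // => g gh.
    by rewrite (negbTE gh) mulr0 scale0r.
  have -> : f h = 0 by apply/eqP; apply: contraNT hA; exact: memA.
  rewrite scale0r big1_seq // => g /andP[_ gA].
  by case: eqP hA gA => [->/negbTE->//|_ _ _]; rewrite mulr0 scale0r.
suff [c c0 Fc] : exists2 c : R, 0 <= c &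
    forall T, (opnorm (F A T) <= c%:E * opnorm T)%E by exists c.
elim: A {Auniq memA ML M} => [|g B [c c0 IHc]].
  by exists 0 => // T; rewrite /F big_nil mul0e opnorm0.
exists (2 * (Normc.normc (f g) + c)).
  by rewrite mulr_ge0 ?addr_ge0 ?normc_ge0.
move=> T; rewrite /F big_cons -/(F B T).
have /asboolP[[_ Too] _] := CstarP T.
have tE : opnorm T = (fine (opnorm T))%:E.
  by rewrite fineK // ge0_fin_numE ?opnorm_ge0.
have := IHc T; rewrite tE -EFinM => Bc.
have l1 : (opnorm (lambda g) <= 1%:E)%E.
  by apply/opnorm_leP => x; rewrite l2norm_lreg.
apply: le_trans (opnormP (f g * T (delta 1%g) g) l1 Bc) _.
rewrite -EFinM lee_fin mulr1 -mulrA ler_wpM2l // mulrDl lerD //.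
rewrite Normc.normcM ler_wpM2l ?normc_ge0 //.
apply: le_trans (le_l2norm _ _) _.
have Tt : (opnorm T <= (fine (opnorm T))%:E)%E by rewrite -tE.
by apply: (opnorm_leP _ _).1 Tt _ _; rewrite l2norm_delta.
Qed.

End SquareSummable.

Section Nets.
Variables (A : Type) (le : A -> A -> Prop).

Definition directed : Prop :=
  [/\ inhabited A,
      forall a, le a a,
      forall a b c, le a b -> le b c -> le a c &
      forall a b, exists c, le a c /\ le b c].

Definition tails : set_system A :=
  [set V | exists a, [set b | le a b] `<=` V].

Definition net_limsup (R : realType) (u : A -> \bar R) : \bar R :=
  ereal_inf [set ereal_sup [set u b | b in [set b | le a b]] | a in [set: A]].

End Nets.

Section WeakAmenability.
Variables (R : realType) (G : groupType).
Local Notation C := (R[i]^o).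

Definition approximating_net (A : Type) (le : A -> A -> Prop)
    (f : A -> G -> C) : Prop :=
  [/\ directed le,
      forall a, finite_set [set g | f a g != 0] &
      forall g, f a g @[a --> tails le] --> (1 : C)].

(* The values limsup_a ||M_(f_a)||_cb < +oo; the infimum of the empty set is
   +oo, so that the Haagerup constant of a group that is not weakly amenable
   is +oo. *)
Definition wa_bounds : set (\bar R) :=
  [set L | exists (A : Type) (le : A -> A -> Prop) (f : A -> G -> C)
                  (M : A -> {linear Cstar R G -> Cstar R G}),
      [/\ approximating_net le f,
          forall a, is_multiplier (f a) (M a),
          L = net_limsup le (fun a => cb_norm (M a)) &
          (L < +oo)%E]].

Definition weakly_amenable : Prop := wa_bounds !=set0.

Definition haagerup_constant : \bar R := ereal_inf wa_bounds.

End WeakAmenability.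

Definition weakly_amenable_with_constant_1 (R : realType) (G : groupType) :
  Prop := haagerup_constant R G = 1%E.

(* Main.v *)
(* A multiplier of completely bounded norm c amounts to a factorization
   f(g^-1 h) = <xi_g, eta_h> with |xi|, |eta| <= c^(1/2) on every finite subset
   of the group. If f_i is such a function on G_i with c close to 1 and f_i(1)
   close to 1, then eta is close to xi, so that f_i(g^-1 h) is close to the
   positive definite kernel u_i(g, h) = <xi_g, xi_h>. The free product of
   positive definite kernels is again positive definite, hence contractive. On
   pairs of words at distance m the product kernel has Schur norm O(m); after
   damping it by r^m with r < 1, it can therefore be truncated at distance N at
   a small cost, and at distance at most N the u_i can be replaced by the f_i at
   a small cost. This leaves the finitely supported function that sends a
   reduced word g_1 ... g_m, m <= N, to r^m f_(i_1)(g_1) ... f_(i_m)(g_m). *)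
From HB Require Import structures.
Require Import Defs.
From mathcomp Require Import all_boot all_order all_algebra.
From mathcomp Require Import boolp classical_sets functions cardinality fsbigop.
From mathcomp Require Import reals ereal esum topology normedtype sequences.
From mathcomp Require Import complex.
From mathcomp Require Import ring lra zify.

Set Implicit Arguments.
Unset Strict Implicit.
Unset Printing Implicit Defensive.

Import Order.TTheory GRing.Theory Num.Theory.
Import numFieldNormedType.Exports.
Local Open Scope ring_scope.
Local Arguments conjc : simpl never.

(** * Schur bounded kernels *)

Section SchurBounded.
Context {R : realType}.
Local Notation C := R[i].

(** Contractivity of the f_i is not what survives a free product; positive definiteness is: Gram
    vectors of letters, projected orthogonally to the vector of the unit, are stacked along a word
    as orthogonal summands whose squared norms telescope to 1. However, u_i(g, h) need not depend on
    g^-1 h alone, so the comparison takes place between kernels on pairs of reduced words, and only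
    the kernel built from the f_i descends to a function on the group. The factorization of f_i
    comes from convex separation: the norm of a multiplier bounds Schur multiplication of
    contractive matrices, which is dual to lying in a cone generated by rank-one kernels. It is
    obtained on finite sets and up to any e > 0, and dividing f_i by a constant slightly above 1
    absorbs this e. The damping is r = rho^2 per letter: one factor rho pays for the cut at length N
    through rho^N, the other makes the sum over word lengths converge. The parameters are fixed in
    the order rho, N, precision d, f_i, since each depends on the previous ones. *)

Definition nsq (z : C) : R := complex.Re z ^+ 2 + complex.Im z ^+ 2.

Lemma nsq_ge0 z : 0 <= nsq z.
Proof. by rewrite addr_ge0 ?sqr_ge0. Qed.

Lemma nsq0 : nsq 0 = 0.
Proof. by rewrite /nsq /= expr0n addr0. Qed.

Lemma nsq1 : nsq 1 = 1.
Proof. by rewrite /nsq /= expr1n expr0n addr0. Qed.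

Lemma nsqM z w : nsq (z * w) = nsq z * nsq w.
Proof. by case: z => a b; case: w => c d; rewrite /nsq /=; ring. Qed.

Lemma nsqN z : nsq (- z) = nsq z.
Proof. by case: z => a b; rewrite /nsq /=; ring. Qed.

Lemma nsqJ z : nsq (conjc z) = nsq z.
Proof. by case: z => a b; rewrite /nsq /= sqrrN. Qed.

Lemma nsqR (x : R) : nsq x%:C%C = x ^+ 2.
Proof. by rewrite /nsq /= expr0n addr0. Qed.

Lemma mulcJ z : z * conjc z = (nsq z)%:C%C.
Proof.
case: z => a b; rewrite /nsq /=; apply/eqP; rewrite eq_complex /=.
by apply/andP; split; apply/eqP; ring.
Qed.

Lemma ReD (z w : C) : complex.Re (z + w) = complex.Re z + complex.Re w.
Proof. by case: z w => ? ? []. Qed.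

Lemma ImD (z w : C) : complex.Im (z + w) = complex.Im z + complex.Im w.
Proof. by case: z w => ? ? []. Qed.

Lemma nsqB (z w : C) : nsq (z - w) =
  nsq z + nsq w - 2 * complex.Re (w * conjc z).
Proof. by case: z => a b; case: w => c d; rewrite /nsq /conjc /=; ring. Qed.

Lemma Re_sum (J : Type) (r : seq J) (P : pred J) (F : J -> C) :
  complex.Re (\sum_(j <- r | P j) F j) = \sum_(j <- r | P j) complex.Re (F j).
Proof. by apply: (big_morph _ _ (erefl _)) => -[a b] [c d]. Qed.

Lemma Im_sum (J : Type) (r : seq J) (P : pred J) (F : J -> C) :
  complex.Im (\sum_(j <- r | P j) F j) = \sum_(j <- r | P j) complex.Im (F j).
Proof. by apply: (big_morph _ _ (erefl _)) => -[a b] [c d]. Qed.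

Lemma ReM_conjc (z w : C) : complex.Re (conjc z * w) =
  complex.Re z * complex.Re w + complex.Im z * complex.Im w.
Proof. by case: z => a b; case: w => c d; rewrite /conjc /=; ring. Qed.

(* K x y is an inner product <xi_x, eta_y>, written in coordinates, with
   |xi_x|^2 <= a x and |eta_y|^2 <= b y: a Schur multiplier on D of
   completely bounded norm at most (sup a * sup b)^(1/2). *)
Definition schur_bounded (X : Type) (D : X -> Prop) (K : X -> X -> C)
    (a b : X -> R) : Prop :=
  exists s : seq ((X -> C) * (X -> C)),
    [/\ forall x y, D x -> D y -> K x y = \sum_(p <- s) p.1 x * conjc (p.2 y),
        forall x, D x -> \sum_(p <- s) nsq (p.1 x) <= a x &
        forall y, D y -> \sum_(p <- s) nsq (p.2 y) <= b y].

Section Closure.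
Variables (X : Type) (D : X -> Prop).
Implicit Types (K : X -> X -> C) (a b : X -> R).

Lemma schur_boundedW (D' : X -> Prop) K K' a a' b b' :
  (forall x, D' x -> D x) ->
  (forall x y, D' x -> D' y -> K' x y = K x y) ->
  (forall x, D' x -> a x <= a' x) -> (forall x, D' x -> b x <= b' x) ->
  schur_bounded D K a b -> schur_bounded D' K' a' b'.
Proof.
move=> DD KK aa bb [s [Ks sa sb]]; exists s; split.
- by move=> x y Dx Dy; rewrite KK // Ks //; exact: DD.
- by move=> x Dx; apply: le_trans (aa _ Dx); exact/sa/DD.
- by move=> x Dx; apply: le_trans (bb _ Dx); exact/sb/DD.
Qed.

Lemma schur_bounded_eq K K' a b : (forall x y, D x -> D y -> K' x y = K x y) ->
  schur_bounded D K a b -> schur_bounded D K' a b.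
Proof. by move=> KK; apply: schur_boundedW. Qed.

Lemma schur_bounded0 : schur_bounded D (fun _ _ => 0) (fun=> 0) (fun=> 0).
Proof. by exists [::]; split=> *; rewrite big_nil. Qed.

Lemma schur_bounded1 : schur_bounded D (fun _ _ => 1) (fun=> 1) (fun=> 1).
Proof.
exists [:: (fun=> 1, fun=> 1)].
by split=> *; rewrite big_seq1 /= ?nsq1 // mul1r rmorph1.
Qed.

Lemma schur_boundedD K K' a a' b b' :
  schur_bounded D K a b -> schur_bounded D K' a' b' ->
  schur_bounded D (fun x y => K x y + K' x y) (fun x => a x + a' x)
    (fun x => b x + b' x).
Proof.
move=> [s [Ks sa sb]] [s' [Ks' sa' sb']]; exists (s ++ s'); split=> *.
- by rewrite big_cat Ks ?Ks'.
- by rewrite big_cat lerD ?sa ?sa'.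
- by rewrite big_cat lerD ?sb ?sb'.
Qed.

Lemma schur_bounded_sum (J : Type) (r : seq J) (K : J -> X -> X -> C)
    (a b : J -> X -> R) :
  (forall j, schur_bounded D (K j) (a j) (b j)) ->
  schur_bounded D (fun x y => \sum_(j <- r) K j x y)
    (fun x => \sum_(j <- r) a j x) (fun x => \sum_(j <- r) b j x).
Proof.
move=> H; elim: r => [|j r IHr].
  by apply: schur_boundedW schur_bounded0 => // *; rewrite big_nil.
by apply: schur_boundedW (schur_boundedD (H j) IHr) => // *; rewrite big_cons.
Qed.

Lemma schur_boundedM (phi psi : X -> C) K a b :
  schur_bounded D K a b ->
  schur_bounded D (fun x y => phi x * K x y * psi y)
    (fun x => nsq (phi x) * a x) (fun x => nsq (psi x) * b x).
Proof.
move=> [s [Ks sa sb]].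
exists [seq ((fun x => phi x * p.1 x), (fun y => conjc (psi y) * p.2 y)) | p <- s].
split=> [x y Dx Dy|x Dx|y Dy]; rewrite big_map.
- rewrite Ks // mulr_sumr mulr_suml; apply: eq_bigr => p _ /=.
  by rewrite rmorphM /= conjcK; ring.
- under eq_bigr do rewrite nsqM; rewrite -mulr_sumr ler_wpM2l ?nsq_ge0 //.
  exact: sa.
- under eq_bigr do rewrite nsqM nsqJ; rewrite -mulr_sumr.
  by rewrite ler_wpM2l ?nsq_ge0 // sb.
Qed.

Lemma schur_bounded_pull (Y : Type) (E : Y -> Prop) (h : Y -> X) K a b :
  (forall y, E y -> D (h y)) -> schur_bounded D K a b ->
  schur_bounded E (fun x y => K (h x) (h y)) (a \o h) (b \o h).
Proof.
move=> Eh [s [Ks sa sb]]; exists [seq (p.1 \o h, p.2 \o h) | p <- s].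
split=> [x y Ex Ey|x Ex|x Ex]; rewrite big_map /=; do ?[exact: sa (Eh _ _)].
- by rewrite Ks //; exact: Eh.
- exact/sb/Eh.
Qed.

Lemma big_label (V : nmodType) (Y : eqType) (ls : seq Y) (o : option Y) (v : V) :
  uniq ls -> (forall l, o = Some l -> l \in ls) ->
  \sum_(l <- ls) (if o == Some l then v else 0) = if o then v else 0.
Proof.
case: o => [m|] uls ols /=; last by rewrite big1.
rewrite (bigD1_seq m) ?ols //= eqxx big1 ?addr0 // => l lm.
by case: eqP => // -[ml]; rewrite ml eqxx in lm.
Qed.

(* The classes of lab carry orthogonal copies of the vectors. *)
Lemma schur_bounded_label (Y : eqType) (ls : seq Y) (lab : X -> option Y) K a b :
  (forall x y, D x -> lab x = Some y -> y \in ls) ->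
  schur_bounded D K a b ->
  schur_bounded D (fun x y => if lab x && (lab x == lab y) then K x y else 0)
    (fun x => if lab x then a x else 0) (fun x => if lab x then b x else 0).
Proof.
move=> Dls [s [Ks sa sb]].
have Dls' x : D x -> forall l, lab x = Some l -> l \in undup ls.
  by move=> Dx l xl; rewrite mem_undup (Dls x).
pose cut l (f : X -> C) := fun x => if lab x == Some l then f x else 0.
exists [seq (cut l p.1, cut l p.2) | l <- undup ls, p <- s].
have cutsum (q : ((X -> C) * (X -> C)) -> X -> C) x : D x ->
    \sum_(l <- undup ls) \sum_(p <- s) nsq (cut l (q p) x) =
    if lab x then \sum_(p <- s) nsq (q p x) else 0.
  move=> Dx; rewrite -[RHS](@big_label _ _ (undup ls)) ?undup_uniq //; last exact: Dls'.
  apply: eq_bigr => l _; rewrite /cut; case: ifP => // _.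
  by rewrite big1 // => p _; rewrite nsq0.
split=> [x y Dx Dy|x Dx|y Dy]; rewrite big_allpairs_dep /=.
- transitivity (\sum_(l <- undup ls) if lab x == Some l then
      (if lab x == lab y then K x y else 0) else 0).
    rewrite big_label ?undup_uniq //; last exact: Dls'.
    by case: (lab x).
  apply: eq_bigr => l _; rewrite /cut; case: eqP => [->|_]; last first.
    by rewrite big1 // => p _; rewrite mul0r.
  rewrite eq_sym; case: ifP => _; first exact: Ks.
  by rewrite big1 // => p _; rewrite conjc0 mulr0.
- by rewrite (cutsum fst) //; case: (lab x) => //= _; exact: sa.
- by rewrite (cutsum snd) //; case: (lab y) => //= _; exact: sb.
Qed.

Lemma schur_bounded_diag (Y : eqType) (ls : seq Y) (h : X -> Y) (d : X -> C) :
  (forall x, D x -> h x \in ls) ->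
  schur_bounded D (fun x y => if h x == h y then d x else 0)
    (fun x => nsq (d x)) (fun=> 1).
Proof.
move=> Dls; have lsP x y : D x -> Some (h x) = Some y -> y \in ls.
  by move=> Dx [<-]; exact: Dls.
have H := schur_boundedM d (fun=> 1) schur_bounded1.
apply: schur_boundedW (schur_bounded_label lsP H) => //= x *.
- by rewrite !mulr1.
- by rewrite mulr1.
- by rewrite nsq1 mulr1.
Qed.

Lemma schur_bounded_rescale K (a b s : R) : 0 < s ->
  schur_bounded D K (fun=> a) (fun=> b) ->
  schur_bounded D K (fun=> s * a) (fun=> s^-1 * b).
Proof.
move=> s0 HK; pose t : C := (Num.sqrt s)%:C%C.
have t0 : t != 0 by rewrite fmorph_eq0 sqrtr_eq0 -ltNge.
have tE : nsq t = s by rewrite nsqR sqr_sqrtr // ltW.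
have tVE : nsq t^-1 = s^-1.
  by apply: (mulfI (lt0r_neq0 s0)); rewrite -{1}tE -nsqM !mulfV ?nsq1 // gt_eqF.
apply: schur_boundedW (schur_boundedM (fun=> t) (fun=> t^-1) HK) => // x *.
- by rewrite mulrAC mulfV // mul1r.
- by rewrite tE.
- by rewrite tVE.
Qed.

(** Only the product of the two bounds matters: rescaling by [e / a] turns them into [e] and
    [a * b / e]. *)
Lemma schur_bounded_balance K (a b e : R) : 0 < a -> 0 < e -> a * b <= e ^+ 2 ->
  schur_bounded D K (fun=> a) (fun=> b) -> schur_bounded D K (fun=> e) (fun=> e).
Proof.
move=> a0 e0 abe /(schur_bounded_rescale (divr_gt0 e0 a0)).
apply: schur_boundedW => // x _; first by rewrite divfK // gt_eqF.
by rewrite invf_div mulrAC ler_pdivrMr // -expr2.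
Qed.

Lemma normc_sqr (z : C) : Normc.normc z ^+ 2 = nsq z.
Proof. by case: z => u v /=; rewrite sqr_sqrtr // addr_ge0 ?sqr_ge0. Qed.

(** Expansion of |w - conj(v) u|^2 >= 0. This form of the Cauchy-Schwarz inequality is summed term
    by term, without square roots. *)
Lemma two_Re_le (u v w : C) :
  2 * complex.Re (conjc u * (v * w)) <= nsq v * nsq u + nsq w.
Proof.
have := nsq_ge0 (w - conjc v * u); case: u v w => [a a'] [b b'] [d d'].
rewrite /nsq /conjc /=; lra.
Qed.

Lemma schur_bounded_normc K a b (c : R) x y : D x -> D y -> a x <= c -> b y <= c ->
  schur_bounded D K a b -> Normc.normc (K x y) <= c.
Proof.
move=> Dx Dy ac bc [s [Ks sa sb]].
have [z0|z0] := eqVneq (K x y) 0.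
  rewrite z0 Normc.normc0; apply: le_trans ac; apply: le_trans (sa _ Dx).
  by rewrite sumr_ge0 // => p _; exact: nsq_ge0.
have n0 : 0 < Normc.normc (K x y).
  rewrite lt_neqAle normc_ge0 andbT eq_sym; apply: contra z0 => /eqP.
  by move/Normc.eq0_normc => ->.
(* The phase of [K x y]: conj(u) times [K x y] is the modulus, and [two_Re_le] bounds each term of
   its real part. *)
pose u : C := K x y * (Normc.normc (K x y))^-1%:C%C.
have nu : nsq u = 1.
  by rewrite nsqM nsqR -normc_sqr exprVn mulfV // expf_neq0 // gt_eqF.
have zE : Normc.normc (K x y) = complex.Re (conjc u * K x y).
  rewrite /u rmorphM /= conjc_real mulrAC [conjc _ * _]mulrC mulcJ -rmorphM /=.
  by rewrite -normc_sqr expr2 mulfK // gt_eqF.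
have : 2 * Normc.normc (K x y) <= c + c.
  rewrite zE Ks // mulr_sumr Re_sum mulr_sumr.
  apply: le_trans (lerD (le_trans (sa _ Dx) ac) (le_trans (sb _ Dy) bc)).
  rewrite -big_split /=; apply: ler_sum => p _; apply: le_trans (two_Re_le _ _ _) _.
  by rewrite nu mulr1 nsqJ.
lra.
Qed.

End Closure.
End SchurBounded.

(** * Factorizing Schur multipliers *)

Section NearMinimiser.
Context {R : realType} {V : lmodType R} (ip : V -> V -> R).
Hypotheses (ipC : forall u v, ip u v = ip v u)
  (ipD : forall u v w, ip (u + v) w = ip u w + ip v w)
  (ipZ : forall t u v, ip (t *: u) v = t * ip u v)
  (ip_ge0 : forall u, 0 <= ip u u).
Variables (Co : V -> Prop) (k : V).
Hypotheses (Co0 : Co 0) (CoD : forall u v, Co u -> Co v -> Co (u + v))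
  (CoZ : forall t u, 0 <= t -> Co u -> Co (t *: u)).

Let ipDr u v w : ip w (u + v) = ip w u + ip w v.
Proof. by rewrite !(ipC w) ipD. Qed.
Let ipZr t u v : ip v (t *: u) = t * ip v u.
Proof. by rewrite !(ipC v) ipZ. Qed.
Let ipN u v : ip (- u) v = - ip u v.
Proof. by rewrite -scaleN1r ipZ mulN1r. Qed.
Let ipNr u v : ip v (- u) = - ip v u.
Proof. by rewrite !(ipC v) ipN. Qed.

(* First order conditions at a point of the cone whose squared distance to k
   is within eta^2 of the infimum, so that the cone need not be closed. *)
Lemma cone_near_minimiser (eta : R) : 0 < eta -> eta <= 1 ->
  exists2 A, Co A &
    (forall B rho, Co B -> 0 < rho -> ip B B <= rho ^+ 2 ->
       ip (k - A) B <= eta * rho) /\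
    ip (k - A) (k - A) <= ip (k - A) k + eta * (2 * ip k k + 2).
Proof.
move=> eta0 eta1.
pose Phi A := ip (k - A) (k - A).
have Phi0 A : 0 <= Phi A by exact: ip_ge0.
pose S : set R := (Phi @` Co)%classic.
have Slb : lbound S 0 by move=> _ [A _ <-].
have Sinf : has_inf S by split; [exists (Phi 0); exists 0|exists 0].
have eta2 : 0 < eta ^+ 2 by rewrite exprn_gt0.
have [_ [A CoA <-] Am] := inf_adherent eta2 Sinf.
have PhiA B : Co B -> Phi A <= Phi B + eta ^+ 2.
  move=> CoB; apply: ltW; apply: lt_le_trans Am _; rewrite lerD2r.
  by apply: ge_inf; [exists 0|exists B].
have expand (r B : V) t : ip (r - t *: B) (r - t *: B) =
    ip r r - 2 * t * ip r B + t ^+ 2 * ip B B.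
  rewrite ipD !ipDr !ipN !ipNr !ipZ !ipZr (ipC B r); ring.
exists A => //; split=> [B rho CoB rho0 Brho|].
  (* Moving from A by [eta / rho] in the direction B costs a quadratic term of at most eta^2, the
     same size as the slack in the infimum. *)
  have t0 : 0 <= eta / rho by rewrite divr_ge0 // ltW.
  have := PhiA _ (CoD CoA (CoZ t0 CoB)).
  rewrite /Phi opprD addrA expand => H.
  have {}H : 2 * (eta / rho) * ip (k - A) B <= eta ^+ 2 + (eta / rho) ^+ 2 * rho ^+ 2.
    have : (eta / rho) ^+ 2 * ip B B <= (eta / rho) ^+ 2 * rho ^+ 2.
      by rewrite ler_wpM2l // sqr_ge0.
    lra.
  rewrite expr_div_n divfK ?gt_eqF ?exprn_gt0 // in H.
  rewrite -(ler_pM2l (x := 2 * (eta / rho))) ?mulr_gt0 ?invr_gt0 //.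
  apply: le_trans H _; rewrite le_eqVlt; apply/orP; left; apply/eqP.
  by field; rewrite gt_eqF.
have rr : ip (k - A) (k - A) <= ip k k + 1.
  have := PhiA 0 Co0; rewrite /Phi subr0 => /le_trans; apply.
  by rewrite lerD2l expr_le1 // ltW.
have AA : ip A A <= 4 * ip k k + 2.
  have := ip_ge0 ((k - A) + k).
  have -> : ip A A = ip (k - (k - A)) (k - (k - A)) by rewrite subKr.
  move: (k - A) rr => r; rewrite !ipD !ipDr !ipN !ipNr (ipC k r); lra.
(* Shrinking A by [1 - eta] stays in the cone and bounds [ip (k - A) A] from below by a multiple of
   - eta; at an exact minimiser this product is 0. *)
have := PhiA _ (CoZ (t := 1 - eta) _ CoA); rewrite subr_ge0 => /(_ eta1).
rewrite /Phi scalerBl scale1r opprB [k + (_ + _)]addrCA -[eta *: A]opprK -scaleNr.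
rewrite [- _ + (_ + _)]addrC expand.
have -> : ip (k - A) A = ip (k - A) k - ip (k - A) (k - A).
  by rewrite -ipNr -ipDr subKr.
move=> H.
have {}H : 2 * eta * (ip (k - A) (k - A) - ip (k - A) k) <=
    eta * (eta * (ip A A + 1)) by lra.
have {H} : 2 * (ip (k - A) (k - A) - ip (k - A) k) <= eta * (ip A A + 1).
  by rewrite -(ler_pM2l eta0) mulrA (mulrC eta 2).
have : eta * (ip A A + 1) <= eta * (4 * ip k k + 3).
  by rewrite ler_pM2l //; lra.
lra.
Qed.
End NearMinimiser.

(** * Factorization by separation from the cone of rank-one kernels *)

Section SchurDuality.
Context {R : realType}.
Local Notation C := R[i].
Variable n : nat.
Local Notation ReC := complex.Re.
Local Notation ImC := complex.Im.

(** Operator norm at most 1 for the matrix a, not its Schur norm: by homogeneity in v and w, the sum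
    on the right is as good as twice the product of the norms. *)
Definition schur_contraction (a : 'I_n -> 'I_n -> C) : Prop :=
  forall v w : 'I_n -> C,
    2 * ReC (\sum_i \sum_j a i j * (v i * conjc (w j))) <=
    \sum_i nsq (v i) + \sum_j nsq (w j).

(** Self-adjoint matrices of size 2n of which only the off-diagonal block (real and imaginary parts)
    and the diagonal entries are kept. [ip] is the trace inner product, whence its factor 2, and
    [rank1 p] is what is kept of the rank-one positive matrix of the vector (p.1, p.2). Sums of
    these are the images of the positive semidefinite matrices, that is, of the factorizations. *)
Let V := ('M[R]_n * 'M[R]_n * ('rV[R]_n * 'rV[R]_n))%type.

Let ip (u v : V) : R :=
  2 * (\sum_i \sum_j (u.1.1 i j * v.1.1 i j + u.1.2 i j * v.1.2 i j)) +
  (\sum_i u.2.1 0 i * v.2.1 0 i + \sum_j u.2.2 0 j * v.2.2 0 j).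

Let rank1 (p : ('I_n -> C) * ('I_n -> C)) : V :=
  ((\matrix_(i, j) ReC (p.1 i * conjc (p.2 j)),
    \matrix_(i, j) ImC (p.1 i * conjc (p.2 j))),
   (\row_i nsq (p.1 i), \row_j nsq (p.2 j))).

Let ipC u v : ip u v = ip v u.
Proof.
rewrite /ip; congr (2 * _ + (_ + _)); apply: eq_bigr => i _;
  rewrite ?(mulrC (u.2.1 0 i)) ?(mulrC (u.2.2 0 i)) //.
by apply: eq_bigr => j _; rewrite mulrC (mulrC (u.1.2 i j)).
Qed.

Let ipD u v w : ip (u + v) w = ip u w + ip v w.
Proof.
rewrite /ip addrACA -mulrDr; congr (2 * _ + _).
  rewrite -big_split; apply: eq_bigr => i _; rewrite -big_split.
  by apply: eq_bigr => j _; rewrite !mxE /=; ring.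
rewrite addrACA.
by congr (_ + _); rewrite -big_split; apply: eq_bigr => i _; rewrite !mxE mulrDl.
Qed.

Let ipZ t u v : ip (t *: u) v = t * ip u v.
Proof.
rewrite /ip mulrDr mulrCA; congr (2 * _ + _).
  rewrite mulr_sumr; apply: eq_bigr => i _; rewrite mulr_sumr.
  by apply: eq_bigr => j _; rewrite !mxE /=; ring.
rewrite mulrDr !mulr_sumr.
by congr (_ + _); apply: eq_bigr => i _; rewrite !mxE mulrA.
Qed.

Let ip_ge0 u : 0 <= ip u u.
Proof.
rewrite /ip addr_ge0 ?mulr_ge0 ?addr_ge0 ?sumr_ge0 //.
- move=> i _; rewrite sumr_ge0 // => j _.
  by rewrite addr_ge0 // -expr2 sqr_ge0.
- by move=> i _; rewrite -expr2 sqr_ge0.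
- by move=> i _; rewrite -expr2 sqr_ge0.
Qed.

Let le_sum_sqr (x : 'I_n -> R) : (forall i, 0 <= x i) ->
  \sum_i x i * x i <= (\sum_i x i) ^+ 2.
Proof.
move=> x0; rewrite expr2 mulr_suml; apply: ler_sum => i _.
rewrite ler_wpM2l // (bigD1 i) //= lerDl sumr_ge0 //.
Qed.

Let rank1_bound v w :
  ip (rank1 (v, w)) (rank1 (v, w)) <= (\sum_i nsq (v i) + \sum_j nsq (w j)) ^+ 2.
Proof.
have -> : ip (rank1 (v, w)) (rank1 (v, w)) =
    2 * ((\sum_i nsq (v i)) * (\sum_j nsq (w j))) +
    (\sum_i nsq (v i) * nsq (v i) + \sum_j nsq (w j) * nsq (w j)).
  rewrite /ip /=; congr (2 * _ + (_ + _)).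
  - rewrite mulr_suml; apply: eq_bigr => i _; rewrite mulr_sumr.
    by apply: eq_bigr => j _; rewrite !mxE -!expr2 -[LHS]/(nsq _) nsqM nsqJ.
  - by apply: eq_bigr => i _; rewrite !mxE.
  - by apply: eq_bigr => i _; rewrite !mxE.
have := le_sum_sqr (fun i => nsq_ge0 (v i)).
have := le_sum_sqr (fun i => nsq_ge0 (w i)).
rewrite sqrrD; lra.
Qed.

(** Let r = k - A be the residual at a near minimiser A in the cone of sums of [rank1]. The
    functional [ip r] is almost nonpositive on the cone, so the conjugate of the off-diagonal part E
    of r, divided by roots of shifted diagonal entries, is a contraction. Testing the hypothesis on
    it makes [ip r k], and with it [ip r r], small. Then A gives a factorization with bounds c +
    e/2, and E one with bounds e/2. *)
Lemma schur_contraction_factor (K : 'I_n -> 'I_n -> C) (c : R) : 0 <= c ->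
  (forall a x y, schur_contraction a ->
     2 * ReC (\sum_i \sum_j (x i * y j)%:C%C * K i j * a i j) <=
     c * (\sum_i x i ^+ 2 + \sum_j y j ^+ 2)) ->
  forall e : R, 0 < e ->
    schur_bounded (fun=> True) K (fun=> c + e) (fun=> c + e).
Proof.
move=> c0 HK e e0.
pose Co (A : V) := exists s, A = \sum_(p <- s) rank1 p.
have Co0 : Co 0 by exists [::]; rewrite big_nil.
have CoD u v : Co u -> Co v -> Co (u + v).
  by move=> [s ->] [s' ->]; exists (s ++ s'); rewrite big_cat.
have CoZ t u : 0 <= t -> Co u -> Co (t *: u).
  move=> t0 [s ->].
  exists [seq ((fun i => (Num.sqrt t)%:C%C * p.1 i),
               (fun i => (Num.sqrt t)%:C%C * p.2 i)) | p <- s].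
  rewrite scaler_sumr big_map; apply: eq_bigr => p _.
  have tt : Num.sqrt t * Num.sqrt t = t by rewrite -expr2 sqr_sqrtr.
  congr (_, _, (_, _)); apply/matrixP => i j; rewrite !mxE /=.
  - rewrite rmorphM /=; case: (p.1 i) (p.2 j) => ? ? [? ?] /=.
    by rewrite /conjc /= -[in LHS]tt; ring.
  - rewrite rmorphM /=; case: (p.1 i) (p.2 j) => ? ? [? ?] /=.
    by rewrite /conjc /= -[in LHS]tt; ring.
  - by rewrite nsqM nsqR expr2 tt.
  - by rewrite nsqM nsqR expr2 tt.
pose k : V := ((\matrix_(i, j) ReC (K i j), \matrix_(i, j) ImC (K i j)),
               (const_mx c, const_mx c)).
(* The first summand comes from the bound [rk] on [ip r k], the others from the radial condition of
   [cone_near_minimiser]. *)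
pose M := 4 * n%:R * c + (2 * ip k k + 2).
have M0 : 0 < M.
  by rewrite ltr_wpDl ?mulr_ge0 // ltr_wpDl // mulr_ge0.
pose eta := Num.min 1 ((e / 2) ^+ 2 / M).
have eta0 : 0 < eta by rewrite lt_min ltr01 divr_gt0 // exprn_gt0 // divr_gt0.
have eta1 : eta <= 1 by rewrite ge_min lexx.
have etaM : eta * M <= (e / 2) ^+ 2.
  by rewrite -ler_pdivlMr // ge_min lexx orbT.
have [A [s As] [H1 H2]] :=
  cone_near_minimiser ipC ipD ipZ ip_ge0 k Co0 CoD CoZ eta0 eta1.
set r := k - A in H1 H2.
pose E i j : C := Complex (r.1.1 i j) (r.1.2 i j).
have prj (f : V -> R) : (forall u v, f (u - v) = f u - f v) ->
    f r = f k - \sum_(p <- s) f (rank1 p).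
  move=> fB; rewrite /r As fB; congr (_ - _).
  have f0 : f 0 = 0 by rewrite -[0 in LHS]subr0 fB subrr.
  by apply: big_morph => // u v; have := fB (u + v) v; rewrite addrK => ->;
    rewrite subrK.
have EE i j : K i j = \sum_(p <- s) p.1 i * conjc (p.2 j) + E i j.
  apply/eqP; rewrite eq_complex; apply/andP; split; apply/eqP.
    rewrite ReD Re_sum [ReC (E i j)]/=.
    rewrite (prj (fun u => u.1.1 i j)) => [|u v]; last by rewrite !mxE.
    by rewrite !mxE; under [X in _ - X]eq_bigr do rewrite mxE; rewrite addrC subrK.
  rewrite ImD Im_sum [ImC (E i j)]/=.
  rewrite (prj (fun u => u.1.2 i j)) => [|u v]; last by rewrite !mxE.
  by rewrite !mxE; under [X in _ - X]eq_bigr do rewrite mxE; rewrite addrC subrK.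
have e1E i : r.2.1 0 i = c - \sum_(p <- s) nsq (p.1 i).
  rewrite (prj (fun u => u.2.1 0 i)) => [|u v]; last by rewrite !mxE.
  by rewrite !mxE; under [X in _ - X]eq_bigr do rewrite mxE.
have e2E i : r.2.2 0 i = c - \sum_(p <- s) nsq (p.2 i).
  rewrite (prj (fun u => u.2.2 0 i)) => [|u v]; last by rewrite !mxE.
  by rewrite !mxE; under [X in _ - X]eq_bigr do rewrite mxE.
clear prj; clearbody r.
have ip_rank1 v w : ip r (rank1 (v, w)) =
    2 * ReC (\sum_i \sum_j conjc (E i j) * (v i * conjc (w j))) +
    (\sum_i r.2.1 0 i * nsq (v i) + \sum_j r.2.2 0 j * nsq (w j)).
  rewrite /ip Re_sum; congr (2 * _ + (_ + _)); apply: eq_bigr => i _.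
  - rewrite Re_sum; apply: eq_bigr => j _; rewrite ReM_conjc.
    by congr (_ * _ + _ * _); rewrite mxE.
  - by congr (_ * _); rewrite mxE.
  - by congr (_ * _); rewrite mxE.
have {}H1 v w : ip r (rank1 (v, w)) <=
    eta * (\sum_i nsq (v i) + \sum_j nsq (w j)).
  have sv : 0 <= \sum_i nsq (v i) by rewrite sumr_ge0 // => *; exact: nsq_ge0.
  have sw : 0 <= \sum_i nsq (w i) by rewrite sumr_ge0 // => *; exact: nsq_ge0.
  apply/ler_addgt0Pr => d d0.
  apply: le_trans (H1 _ (\sum_i nsq (v i) + \sum_j nsq (w j) + d) _ _ _) _.
  - by exists [:: (v, w)]; rewrite big_seq1.
  - by rewrite ltr_wpDl // addr_ge0.
  - apply: le_trans (rank1_bound v w) _.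
    by rewrite ler_sqr ?nnegrE ?addr_ge0 ?lerDl // ltW.
  - by rewrite mulrDr lerD2l ler_piMl // ltW.
have delta_sum (F : 'I_n -> R) (i : 'I_n) : \sum_j F j * nsq ((j == i)%:R : C) = F i.
  rewrite (bigD1 i) //= eqxx nsq1 mulr1 big1 ?addr0 // => j /negbTE ->.
  by rewrite nsq0 mulr0.
have delta_sum1 (i : 'I_n) : \sum_j nsq ((j == i)%:R : C) = 1.
  by rewrite -(delta_sum (fun=> 1) i); apply: eq_bigr => j _; rewrite mul1r.
have Z0 : \sum_(j < n) nsq (0 : C) = 0 by rewrite big1 // => j _; rewrite nsq0.
have Z (F : 'I_n -> R) : \sum_j F j * nsq (0 : C) = 0.
  by rewrite big1 // => j _; rewrite nsq0 mulr0.
have r1 i : r.2.1 0 i <= eta.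
  have := H1 (fun j => (j == i)%:R) (fun=> 0).
  rewrite ip_rank1 delta_sum Z Z0 delta_sum1 big1 => [|j _]; last first.
    by rewrite big1 // => l _; rewrite conjc0 !mulr0.
  by rewrite [complex.Re 0]/= mulr0 add0r !addr0 mulr1.
have r2 i : r.2.2 0 i <= eta.
  have := H1 (fun=> 0) (fun j => (j == i)%:R).
  rewrite ip_rank1 delta_sum Z Z0 delta_sum1 big1 => [|j _]; last first.
    by rewrite big1 // => l _; rewrite mul0r !mulr0.
  by rewrite [complex.Re 0]/= mulr0 !add0r mulr1.
(* Shifting by 2 eta instead of eta makes the diagonal strictly positive, so that one can divide by
   its roots. *)
pose d i := 2 * eta - r.2.1 0 i; pose d' i := 2 * eta - r.2.2 0 i.
have d0 i : 0 < d i by have := r1 i; rewrite /d; lra.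
have d'0 i : 0 < d' i by have := r2 i; rewrite /d'; lra.
pose q i := Num.sqrt (d i); pose q' i := Num.sqrt (d' i).
have q0 i : 0 < q i by rewrite sqrtr_gt0.
have q'0 i : 0 < q' i by rewrite sqrtr_gt0.
have qq i : q i ^+ 2 = d i by rewrite sqr_sqrtr // ltW.
have q'q i : q' i ^+ 2 = d' i by rewrite sqr_sqrtr // ltW.
pose a i j : C := conjc (E i j) * ((q i)^-1 * (q' j)^-1)%:C%C.
have a_contr : schur_contraction a.
  move=> v w.
  have := H1 (fun i => v i * (q i)^-1%:C%C) (fun i => w i * (q' i)^-1%:C%C).
  rewrite ip_rank1.
  have -> : \sum_i \sum_j conjc (E i j) *
      (v i * (q i)^-1%:C%C * conjc (w j * (q' j)^-1%:C%C)) =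
      \sum_i \sum_j a i j * (v i * conjc (w j)).
    apply: eq_bigr => i _; apply: eq_bigr => j _.
    by rewrite /a rmorphM /= conjc_real rmorphM /=; ring.
  have nv i : nsq (v i * (q i)^-1%:C%C) = nsq (v i) / d i.
    by rewrite nsqM nsqR exprVn qq.
  have nw i : nsq (w i * (q' i)^-1%:C%C) = nsq (w i) / d' i.
    by rewrite nsqM nsqR exprVn q'q.
  rewrite (eq_bigr _ (fun i _ => nv i)) (eq_bigr _ (fun i _ => nw i)).
  rewrite (eq_bigr _ (fun i _ => congr1 ( *%R (r.2.1 0 i)) (nv i))).
  rewrite (eq_bigr _ (fun i _ => congr1 ( *%R (r.2.2 0 i)) (nw i))).
  have S1 : \sum_i nsq (v i) >=
      2 * eta * (\sum_i nsq (v i) / d i) - \sum_i r.2.1 0 i * (nsq (v i) / d i).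
    rewrite mulr_sumr -sumrB; apply: ler_sum => i _; rewrite -mulrBl -/(d i).
    by rewrite mulrCA mulfV ?mulr1 // gt_eqF.
  have S2 : \sum_i nsq (w i) >=
      2 * eta * (\sum_i nsq (w i) / d' i) - \sum_i r.2.2 0 i * (nsq (w i) / d' i).
    rewrite mulr_sumr -sumrB; apply: ler_sum => i _; rewrite -mulrBl -/(d' i).
    by rewrite mulrCA mulfV ?mulr1 // gt_eqF.
  have P1 : 0 <= eta * (\sum_i nsq (v i) / d i).
    rewrite mulr_ge0 ?sumr_ge0 ?(ltW eta0) // => i _.
    by rewrite divr_ge0 ?nsq_ge0 // ltW.
  have P2 : 0 <= eta * (\sum_i nsq (w i) / d' i).
    rewrite mulr_ge0 ?sumr_ge0 ?(ltW eta0) // => i _.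
    by rewrite divr_ge0 ?nsq_ge0 // ltW.
  lra.
(* The weights q and q' undo the normalisation of a. The diagonal entries of r cancel between the
   right-hand side of [HK] and [ip r k]; only the 2n shifts by 2 eta remain. *)
have rk : ip r k <= 4 * n%:R * c * eta.
  have := HK a q q' a_contr.
  have -> : \sum_i \sum_j (q i * q' j)%:C%C * K i j * a i j =
      \sum_i \sum_j conjc (E i j) * K i j.
    apply: eq_bigr => i _; apply: eq_bigr => j _; rewrite /a.
    rewrite [RHS](_ : _ = (q i * q' j * ((q i)^-1 * (q' j)^-1))%:C%C *
      (conjc (E i j) * K i j)); first by rewrite !rmorphM /=; ring.
    by rewrite mulrACA !mulfV ?gt_eqF // mulr1 mul1r.
  rewrite (eq_bigr _ (fun i _ => qq i)) (eq_bigr _ (fun i _ => q'q i)).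
  rewrite !sumrB !big_const_ord !iter_addr_0.
  have -> : ip r k = 2 * ReC (\sum_i \sum_j conjc (E i j) * K i j) +
      c * (\sum_i r.2.1 0 i + \sum_j r.2.2 0 j).
    rewrite /ip Re_sum [c * (_ + _)]mulrDr.
    congr (2 * _ + (_ + _)); rewrite ?mulr_sumr; apply: eq_bigr => i _.
    - rewrite Re_sum; apply: eq_bigr => j _; rewrite ReM_conjc.
      by congr (_ * _ + _ * _); rewrite mxE.
    - by rewrite mulrC; congr (_ * _); rewrite mxE.
    - by rewrite mulrC; congr (_ * _); rewrite mxE.
  rewrite -(mulr_natr (2 * eta) n); lra.
have rr : ip r r <= (e / 2) ^+ 2 by apply: le_trans etaM; rewrite /M; lra.
have e20 : 0 < e / 2 by rewrite divr_gt0.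
have sq0 (x : R) : 0 <= x * x by rewrite -expr2 sqr_ge0.
have rrE : ip r r = 2 * (\sum_i \sum_j nsq (E i j)) +
    (\sum_i r.2.1 0 i * r.2.1 0 i + \sum_j r.2.2 0 j * r.2.2 0 j).
  by rewrite /ip; congr (2 * _ + _); apply: eq_bigr => i _; apply: eq_bigr => j _;
    rewrite /nsq /= !expr2.
have E0 : 0 <= \sum_i \sum_j nsq (E i j).
  by rewrite !sumr_ge0 // => i _; rewrite sumr_ge0 // => j _; exact: nsq_ge0.
have R0 (f : 'I_n -> R) i : f i * f i <= \sum_j f j * f j.
  by rewrite (bigD1 i) //= lerDl sumr_ge0.
have R00 (f : 'I_n -> R) : 0 <= \sum_j f j * f j by rewrite sumr_ge0.
have nE j : \sum_i nsq (E i j) <= (e / 2) ^+ 2.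
  have : \sum_i nsq (E i j) <= \sum_i \sum_j nsq (E i j).
    rewrite exchange_big [leRHS](bigD1 j) //= lerDl sumr_ge0 // => l _.
    by rewrite sumr_ge0 // => i _; exact: nsq_ge0.
  have := R00 (fun i => r.2.1 0 i); have := R00 (fun i => r.2.2 0 i).
  move: rr; rewrite rrE /=; lra.
have abs_le (x : R) : x * x <= (e / 2) ^+ 2 -> - (e / 2) <= x.
  by move=> xx; rewrite leNgt; apply/negP => xe; nra.
have r1e i : - (e / 2) <= r.2.1 0 i.
  apply: abs_le; have := R0 (fun i => r.2.1 0 i) i.
  have := R00 (fun i => r.2.2 0 i); move: rr; rewrite rrE /=; lra.
have r2e i : - (e / 2) <= r.2.2 0 i.
  apply: abs_le; have := R0 (fun i => r.2.2 0 i) i.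
  have := R00 (fun i => r.2.1 0 i); move: rr; rewrite rrE /=; lra.
(* A kernel whose columns have small l2 norm factors through the standard basis; [sg] splits the
   bound evenly between the two sides. *)
have BE : schur_bounded (fun=> True) E (fun=> e / 2) (fun=> e / 2).
  pose sg := (Num.sqrt (e / 2))%:C%C.
  have sgE : nsq sg = e / 2 by rewrite nsqR sqr_sqrtr // ltW.
  have sg0 : sg != 0 by rewrite fmorph_eq0 gt_eqF // sqrtr_gt0.
  exists [seq ((fun i => (i == l)%:R * sg), (fun j => conjc (E l j) / sg)) |
           l <- enum 'I_n].
  split=> [i j _ _|i _|j _]; rewrite big_map big_enum /=.
  - rewrite (bigD1 i) //= big1 => [|l li]; last first.
      by rewrite eq_sym (negbTE li) !mul0r.
    rewrite eqxx mul1r addr0 rmorphM /= conjcK fmorphV /= conjc_real.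
    by rewrite mulrCA mulfV // mulr1.
  - rewrite (bigD1 i) //= big1 => [|l li]; last first.
      by rewrite eq_sym (negbTE li) mul0r nsq0.
    by rewrite eqxx mul1r addr0 sgE.
  - have nV l : nsq (conjc (E l j) / sg) = nsq (E l j) / (e / 2).
      rewrite nsqM nsqJ; congr (_ * _); apply: (mulfI (lt0r_neq0 e20)).
      by rewrite -{1}sgE -nsqM !mulfV ?nsq1 // gt_eqF.
    by rewrite (eq_bigr _ (fun l _ => nV l)) -mulr_suml ler_pdivrMr.
have BS : schur_bounded (fun=> True)
    (fun i j => \sum_(p <- s) p.1 i * conjc (p.2 j))
    (fun=> c + e / 2) (fun=> c + e / 2).
  exists s; split=> // i _.
    by have := r1e i; rewrite e1E; lra.
  by have := r2e i; rewrite e2E; lra.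
apply: schur_boundedW (schur_boundedD BS BE) => // i *; lra.
Qed.
End SchurDuality.

(** * Multipliers of the reduced C*-algebra *)

Section Operators.
Context {R : realType} {G : groupType}.
Local Notation C := (R[i]).
Local Notation l2 := (l2 R G).
Local Notation Cstar := (Cstar R G).
Implicit Types (x y : l2) (T U : Cstar) (g h : G).

Lemma l2_sumE (J : Type) (r : seq J) (P : pred J) (x : J -> l2) g :
  (\sum_(j <- r | P j) x j) g = \sum_(j <- r | P j) x j g.
Proof. exact: (big_morph (fun x : l2 => x g)). Qed.

Lemma Cstar_sumE (J : Type) (r : seq J) (P : pred J) (T : J -> Cstar) x :
  (\sum_(j <- r | P j) T j) x = \sum_(j <- r | P j) T j x.
Proof. exact: (big_morph (fun T : Cstar => T x)). Qed.

Lemma Cstar_linear T : linear T.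
Proof. by have /asboolP[[]] := CstarP T. Qed.

Lemma Cstar0 T : T 0 = 0.
Proof. by have := Cstar_linear T (-1) 0 0; rewrite scaler0 addr0 scaleN1r addNr. Qed.

Lemma CstarZ T a x : T (a *: x) = a *: T x.
Proof. by have := Cstar_linear T a x 0; rewrite Cstar0 !addr0. Qed.

Lemma CstarD T x y : T (x + y) = T x + T y.
Proof. by have := Cstar_linear T 1 x y; rewrite !scale1r. Qed.

Lemma Cstar_sum T (J : Type) (r : seq J) (P : pred J) (x : J -> l2) :
  T (\sum_(j <- r | P j) x j) = \sum_(j <- r | P j) T (x j).
Proof. exact: (big_morph _ (CstarD T) (Cstar0 T)). Qed.

Lemma esum_le_seq (a : G -> R) (c : R) :
  (forall B : seq G, uniq B -> \sum_(g <- B) a g <= c) ->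
  (\esum_(g in [set: G]) (a g)%:E <= c%:E)%E.
Proof.
move=> H; apply: ge_ereal_sup => _ [A [fA _] <-].
by rewrite fsbig_finite // sumEFin lee_fin; apply/H/finmap.fset_uniq.
Qed.

Lemma l2_seq_le x (B : seq G) : uniq B -> \sum_(g <- B) nsq (x g) <= l2norm x ^+ 2.
Proof.
move=> uB; rewrite -lee_fin -sqsum_l2norm -sumEFin; apply: ereal_sup_ubound.
exists [set` B]%classic; first by split=> //; exact: finite_seq.
by rewrite -fsbig_seq //; apply: eq_bigr => g _; rewrite normc_sqr.
Qed.

Lemma l2n_normE n (z : 'I_n -> l2) : l2n_norm z ^+ 2 = \sum_i l2norm (z i) ^+ 2.
Proof. by rewrite sqr_sqrtr // sumr_ge0 // => i _; rewrite sqr_ge0. Qed.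

Lemma l2n_norm_ge0 n (z : 'I_n -> l2) : 0 <= l2n_norm z.
Proof. exact: sqrtr_ge0. Qed.

Lemma l2n_norm_le n (z : 'I_n -> l2) c :
  (forall B : seq G, uniq B -> \sum_(g <- B) \sum_i nsq (z i g) <= c) ->
  l2n_norm z ^+ 2 <= c.
Proof.
move=> H; rewrite l2n_normE -lee_fin -sumEFin.
under eq_bigr do rewrite -sqsum_l2norm.
rewrite /sqsum -esum_sum; last by move=> *; rewrite lee_fin sqr_ge0.
under eq_esum do rewrite sumEFin.
apply: esum_le_seq => B uB; apply: le_trans (H B uB).
by apply: ler_sum => g _; apply: ler_sum => i _; rewrite normc_sqr.
Qed.

Lemma l2n_seq_le n (z : 'I_n -> l2) (B : seq G) : uniq B ->
  \sum_(g <- B) \sum_i nsq (z i g) <= l2n_norm z ^+ 2.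
Proof.
by move=> uB; rewrite l2n_normE exchange_big ler_sum // => i _; exact: l2_seq_le.
Qed.

Lemma l2n_norm_finite n (z : 'I_n -> l2) (F : seq G) : uniq F ->
  (forall i g, g \notin F -> z i g = 0) ->
  l2n_norm z ^+ 2 <= \sum_(g <- F) \sum_i nsq (z i g).
Proof.
move=> uF zF; apply: l2n_norm_le => B uB.
rewrite (bigID (mem F)) /= [X in _ + X]big1 ?addr0 => [|g gF]; last first.
  by rewrite big1 // => i _; rewrite zF // nsq0.
rewrite -big_filter.
have P : perm_eq [seq g <- B | g \in F] [seq g <- F | g \in B].
  apply: uniq_perm; rewrite ?filter_uniq // => g.
  by rewrite !mem_filter andbC.
rewrite (perm_big _ P) big_filter [leRHS](bigID (mem B)) /= lerDl.
by rewrite sumr_ge0 // => g _; rewrite sumr_ge0 // => i _; exact: nsq_ge0.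
Qed.

Lemma l2n_normZ n (a : R) (z : 'I_n -> l2) : 0 <= a ->
  l2n_norm (fun i => a%:C%C *: z i) <= a * l2n_norm z.
Proof.
move=> a0; rewrite -[leRHS]ger0_norm ?mulr_ge0 ?l2n_norm_ge0 // -sqrtr_sqr.
rewrite -[leLHS]ger0_norm ?l2n_norm_ge0 // -sqrtr_sqr ler_sqrt ?sqr_ge0 //.
apply: l2n_norm_le => B uB; rewrite exprMn.
apply: le_trans (ler_wpM2l (sqr_ge0 a) (l2n_seq_le z uB)).
rewrite mulr_sumr; apply: ler_sum => g _; rewrite mulr_sumr; apply: ler_sum => i _.
by rewrite -[X in nsq X]/(a%:C%C * z i g) nsqM nsqR.
Qed.

Lemma mxactZ n (T : 'M[Cstar]_n) a (z : 'I_n -> l2) :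
  mxact T (fun i => a *: z i) = fun i => a *: mxact T z i.
Proof.
apply/funext => i; rewrite /mxact scaler_sumr.
by apply: eq_bigr => j _; rewrite CstarZ.
Qed.

Lemma mxopnorm_leP n (T : 'M[Cstar]_n) (c : R) : 0 <= c ->
  (mxopnorm T <= c%:E)%E <-> forall z, l2n_norm (mxact T z) <= c * l2n_norm z.
Proof.
move=> c0; split=> [Tc z|Tc]; last first.
  apply: ge_ereal_sup => _ [z /= z1 <-]; rewrite lee_fin.
  by apply: le_trans (Tc z) _; rewrite ler_piMr.
apply/ler_addgt0Pr => e e0.
(* The additional [e / (c + 1)] keeps N positive when z has norm 0, and costs at most e in the
   end. *)
pose N := l2n_norm z + e / (c + 1).
have N0 : 0 < N by rewrite ltr_wpDl ?l2n_norm_ge0 // divr_gt0 // ltr_wpDl.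
pose z' i := (N^-1)%:C%C *: z i.
have zE : z = fun i => N%:C%C *: z' i.
  apply/funext => i; rewrite /z' scalerA -rmorphM mulfV ?gt_eqF //.
  by rewrite rmorph1 scale1r.
have z'1 : l2n_norm z' <= 1.
  apply: le_trans (l2n_normZ _ _) _; first by rewrite invr_ge0 ltW.
  rewrite ler_pdivrMl // mulr1 lerDl divr_ge0 ?addr_ge0 // ltW //.
have : l2n_norm (mxact T z') <= c.
  rewrite -lee_fin; apply: le_trans Tc; apply: ereal_sup_ubound.
  by exists z'.
move=> Tz'; have -> : mxact T z = fun i => N%:C%C *: mxact T z' i by rewrite -mxactZ
    -zE.
apply: le_trans (l2n_normZ _ (ltW N0)) _.
apply: le_trans (ler_wpM2l (ltW N0) Tz') _.
rewrite mulrC mulrDr lerD2l mulrA ler_pdivrMr ?ltr_wpDl //.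
by rewrite mulrC ler_pM2l // lerDl.
Qed.


Lemma lreg_delta g h : lreg g (delta R h) = delta R (g * h)%g :> l2.
Proof.
apply/val_inj/funext => k;
  rewrite -[LHS]/((g^-1 * k == h)%g)%:R -[RHS]/(k == g * h)%g%:R.
by rewrite -(inj_eq (mulgI g) (g^-1 * k)%g) mulVKg.
Qed.

Lemma lregM g h x : lreg g (lreg h x) = lreg (g * h)%g x.
Proof.
by apply/val_inj/funext => k; rewrite -[LHS]/(x (h^-1 * (g^-1 * k))%g) mulgA -invgM.
Qed.

Lemma l2normZ_le (a : C) x : l2norm (a *: x) ^+ 2 <= nsq a * l2norm x ^+ 2.
Proof.
rewrite -lee_fin -sqsum_l2norm EFinM -sqsum_l2norm -normc_sqr.
exact: sqsumZ.
Qed.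

(** The matrix T with entries a_ij lambda(s_i^-1 s_j) is the scalar matrix a conjugated by the
    diagonal unitary of the lambda(s_i), hence a contraction. Its image under the multiplier has
    norm at most c and acts on the vectors delta(s_j^-1) as the Schur product of a with f(s_i^-1
    s_j). *)
Lemma multiplier_schur_contraction (f : G -> C) (M : {linear Cstar -> Cstar}) (c : R)
    n (s : 'I_n -> G) :
  0 < c -> is_multiplier f M -> (cb_norm M <= c%:E)%E ->
  forall a (x y : 'I_n -> R), schur_contraction a ->
    2 * complex.Re (\sum_i \sum_j (x i * y j)%:C%C * f ((s i)^-1 * s j)%g * a i j) <=
    c * (\sum_i x i ^+ 2 + \sum_j y j ^+ 2).
Proof.
move=> c0 [_ Mf] Mc a x y aC.
have a_norm (v : 'I_n -> C) :
    \sum_i nsq (\sum_j a i j * v j) <= \sum_j nsq (v j).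
  pose w i := \sum_j a i j * v j.
  have := aC (fun i => conjc (w i)) (fun j => conjc (v j)).
  have -> : \sum_i \sum_j a i j * (conjc (w i) * conjc (conjc (v j))) =
      (\sum_i nsq (w i))%:C%C.
    rewrite rmorph_sum; apply: eq_bigr => i _ /=; rewrite -mulcJ mulr_suml.
    by apply: eq_bigr => j _; rewrite conjcK mulrCA mulrC.
  rewrite (eq_bigr _ (fun i _ => nsqJ (w i))) (eq_bigr _ (fun i _ => nsqJ (v i))) /=.
  lra.
pose T : 'M[Cstar]_n := \matrix_(i, j) (a i j *: lambda R ((s i)^-1 * s j)%g).
have T1 : (mxopnorm T <= 1)%E.
  apply/(mxopnorm_leP _ ler01) => z; rewrite mul1r.
  pose u j := lreg (s j) (z j).
  have TE i : lreg (s i) (mxact T z i) = \sum_j a i j *: u j.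
    rewrite /mxact -[LHS]/(lambda R (s i) _) Cstar_sum; apply: eq_bigr => j _.
    rewrite mxE -[X in lambda R (s i) X]/(a i j *: lreg _ (z j)) CstarZ.
    by rewrite -[lambda R (s i) _]/(lreg (s i) _) lregM mulVKg.
  rewrite -ler_sqr ?nnegrE ?l2n_norm_ge0 //.
  have -> : l2n_norm (mxact T z) ^+ 2 = l2n_norm (fun i => \sum_j a i j *: u j) ^+ 2.
    rewrite !l2n_normE; apply: eq_bigr => i _.
    by rewrite -TE l2norm_lreg.
  have -> : l2n_norm z ^+ 2 = l2n_norm u ^+ 2.
    by rewrite !l2n_normE; apply: eq_bigr => i _; rewrite l2norm_lreg.
  apply: l2n_norm_le => B uB; apply: le_trans (l2n_seq_le u uB).
  apply: ler_sum => g _; apply: le_trans (a_norm (fun j => u j g)).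
  by apply: ler_sum => i _; rewrite l2_sumE.
pose T' := map_mx M T.
have T'c : (mxopnorm T' <= c%:E)%E.
  by apply: le_trans Mc; apply: ereal_sup_ubound; exists n, T.
pose K i j := f ((s i)^-1 * s j)%g.
pose w i : C := \sum_j K i j * a i j * (y j)%:C%C.
have wc : \sum_i nsq (w i) <= c ^+ 2 * \sum_j y j ^+ 2.
  pose z j := (y j)%:C%C *: delta R (s j)^-1%g.
  have T'E i : mxact T' z i = w i *: delta R (s i)^-1%g.
    rewrite /mxact scaler_suml; apply: eq_bigr => j _.
    rewrite !mxE linearZ /= Mf -[LHS]/(a i j *: (K i j *: lreg _ (z j))).
    rewrite -[lreg _ _]/(lambda R _ _) CstarZ -[lambda R _ _]/(lreg _ _) lreg_delta.
    by rewrite mulgK !scalerA (mulrC (a i j)).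
  have := (mxopnorm_leP _ (ltW c0)).1 T'c z.
  rewrite -ler_sqr ?nnegrE ?mulr_ge0 ?l2n_norm_ge0 ?(ltW c0) // exprMn.
  rewrite !l2n_normE => H; apply: le_trans (le_trans H _); last first.
    apply: ler_wpM2l; first exact: sqr_ge0.
    apply: ler_sum => j _; apply: le_trans (l2normZ_le _ _) _.
    by rewrite l2norm_delta expr1n mulr1 nsqR.
  apply: ler_sum => i _; rewrite T'E.
  have := l2_seq_le (w i *: delta R (s i)^-1%g) (isT : uniq [:: (s i)^-1%g]).
  rewrite big_seq1 -[X in nsq X]/(w i * ((s i)^-1 == (s i)^-1)%g%:R).
  by rewrite eqxx mulr1.
have -> : \sum_i \sum_j (x i * y j)%:C%C * K i j * a i j =
    \sum_i conjc (x i)%:C%C * w i.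
  apply: eq_bigr => i _; rewrite mulr_sumr; apply: eq_bigr => j _.
  by rewrite conjc_real rmorphM /=; ring.
rewrite Re_sum mulr_sumr.
(* The weights c and 1/c are balanced, since [wc] bounds the squares of w by c^2 times those of
   y. *)
apply: (@le_trans _ _ (\sum_i (c * x i ^+ 2 + c^-1 * nsq (w i)))).
  apply: ler_sum => i _; rewrite ReM_conjc /= mul0r addr0 /nsq.
  set p := complex.Re (w i); set q := complex.Im (w i).
  have : 0 <= c^-1 * ((c * x i - p) ^+ 2 + q ^+ 2).
    by rewrite mulr_ge0 ?invr_ge0 ?addr_ge0 ?sqr_ge0 // ltW.
  rewrite (_ : c^-1 * _ = c * x i ^+ 2 + c^-1 * (p ^+ 2 + q ^+ 2) - 2 * (x i * p)).
    by rewrite subr_ge0.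
  by field; rewrite gt_eqF.
rewrite big_split /= -!mulr_sumr mulrDr lerD2l ler_pdivrMl // mulrA -expr2 //.
Qed.

Lemma multiplier_schur_bounded (f : G -> C) (M : {linear Cstar -> Cstar}) (c e : R)
    (D : seq G) : 0 < c -> 0 < e -> is_multiplier f M -> (cb_norm M <= c%:E)%E ->
  schur_bounded (fun g => g \in D) (fun g h => f (g^-1 * h)%g)
    (fun=> c + e) (fun=> c + e).
Proof.
move=> c0 e0 fM Mc; case: D => [|g0 D].
  by exists [::]; split=> // *; rewrite big_nil ltW // addr_gt0.
pose s (i : 'I_(size D).+1) := nth g0 (g0 :: D) i.
have H := schur_contraction_factor (ltW c0)
  (multiplier_schur_contraction s c0 fM Mc) e0.
apply: schur_bounded_eq (schur_bounded_pull (E := fun g => g \in g0 :: D)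
  (h := fun g => inord (index g (g0 :: D))) _ H) => // g h gD hD.
have sE k : k \in g0 :: D -> s (inord (index k (g0 :: D))) = k.
  by move=> kD; rewrite /s inordK ?nth_index //; rewrite -index_mem in kD.
by rewrite /= !sE.
Qed.

(** * Complete boundedness from a factorization of the symbol *)

Lemma opnorm_le_Cstar T (c : R) x : (opnorm T <= c%:E)%E -> 0 <= c ->
  l2norm x <= 1 -> forall g, nsq (T x g) <= c ^+ 2.
Proof.
move=> /opnorm_leP Tc c0 x1 g.
rewrite -normc_sqr ler_sqr ?nnegrE ?normc_ge0 //.
by apply: le_trans (le_l2norm _ _) (Tc _ x1).
Qed.

Lemma Cstar_approx T (e : R) : 0 < e -> exists s : seq (C * G),
  (opnorm (T - \sum_(p <- s) p.1 *: lambda R p.2 : Cstar)%R <= e%:E)%E.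
Proof.
move=> e0; have /asboolP[_ /(_ _ e0)[s /ltW Ts]] := CstarP T.
exists s; suff E : Cstar_op (\sum_(p <- s) p.1 *: lambda R p.2) =
    \sum_(p <- s) p.1 *: lreg p.2 :> (l2 -> l2) by rewrite -E in Ts.
by elim: s {Ts} => [|p s IHs]; rewrite ?big_nil // !big_cons -IHs.
Qed.

(** Operators of the algebra commute with right translations: this is clear on the span of the
    lambda(g), and both sides are continuous in T for the operator norm. *)
Lemma Cstar_delta T g h : T (delta R h) g = T (delta R 1%g) (g * h^-1)%g.
Proof.
apply/eqP; rewrite -subr_eq0; apply/eqP/Normc.eq0_normc/eqP.
rewrite eq_le normc_ge0 andbT; apply/ler_addgt0Pr => e e0; rewrite add0r.
have e20 : 0 < e / 2 by rewrite divr_gt0.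
have [s Ts] := Cstar_approx T e20.
set S : Cstar := \sum_(p <- s) _ in Ts.
have SE : S (delta R h) g = S (delta R 1%g) (g * h^-1)%g.
  rewrite !Cstar_sumE !l2_sumE; apply: eq_bigr => p _.
  rewrite -[LHS]/(p.1 * lreg _ _ _) -[RHS]/(p.1 * lreg _ _ _) !lreg_delta mulg1.
  rewrite -[X in p.1 * X]/(g == _)%g%:R -[X in _ = p.1 * X]/((g * h^-1)%g == _)%g%:R.
  by rewrite -(inj_eq (mulIg h) (g * h^-1)%g) mulgVK.
have bnd k l : Normc.normc ((T - S) (delta R k) l) <= e / 2.
  rewrite -ler_sqr ?nnegrE ?normc_ge0 ?(ltW e20) // normc_sqr.
  by apply: (opnorm_le_Cstar Ts (ltW e20)); rewrite l2norm_delta.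
have -> : T (delta R h) g - T (delta R 1%g) (g * h^-1)%g =
   (T - S) (delta R h) g - (T - S) (delta R 1%g) (g * h^-1)%g.
  rewrite -[(T - S) _ _]/(T (delta R h) g - S (delta R h) g).
  rewrite -[(T - S) _ (_ * _)%g]/(T (delta R 1%g) (g * h^-1)%g - S (delta R 1%g) (g *
      h^-1)%g).
  by rewrite SE; ring.
apply: le_trans (le_normcD _ _) _; rewrite normcN.
by have := bnd h g; have := bnd 1%g (g * h^-1)%g; lra.
Qed.

(** The right-hand side is linear and bounded in T and has the prescribed values on the lambda(g),
    so uniqueness of the multiplier applies. *)
Lemma multiplier_finite (f : G -> C) (M : {linear Cstar -> Cstar}) (A : seq G) T :
  uniq A -> (forall g, f g != 0 -> g \in A) -> is_multiplier f M ->
  M T = \sum_(g <- A) (f g * T (delta R 1%g) g) *: lambda R g.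
Proof.
move=> uA fA fM.
pose F (T : Cstar) : Cstar := \sum_(g <- A) (f g * T (delta R 1%g) g) *: lambda R g.
have Flin : linear F.
  move=> a U V; rewrite /F scaler_sumr -big_split; apply: eq_bigr => g _.
  rewrite /= scalerA -scalerDl; congr (_ *: _).
  rewrite [X in f g * X](_ : _ = a * U (delta R 1%g) g + V (delta R 1%g) g) //.
  by rewrite mulrDr mulrCA.
pose FL := GRing.isLinear.Build _ _ _ _ F Flin.
pose N : {linear Cstar -> Cstar} := HB.pack_for {linear Cstar -> Cstar} F FL.
apply: (is_multiplier_unique fM (N := N)); split; last first.
  move=> h; rewrite -[LHS]/(F (lambda R h)) /F.
  have E g : lambda R h (delta R 1%g) g = (g == h)%:R.
    by rewrite -[lambda R h _]/(lreg h _) lreg_delta mulg1.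
  under eq_bigr do rewrite E.
  have [hA|hA] := boolP (h \in A).
    rewrite (bigD1_seq h) //= eqxx mulr1 big1 ?addr0 // => g gh.
    by rewrite (negbTE gh) mulr0 scale0r.
  have -> : f h = 0 by apply/eqP; apply: contraNT hA; exact: fA.
  rewrite scale0r big1_seq // => g /andP[_ gA].
  by case: eqP hA gA => [->/negbTE->//|_ _ _]; rewrite mulr0 scale0r.
suff [c Fc] : exists c : R, forall U (t : R) x, 0 <= t -> (opnorm U <= t%:E)%E ->
    l2norm x <= 1 -> l2norm (F U x) <= c * t.
  exists c => U; have /asboolP[[_ Uoo] _] := CstarP U.
  have tE : opnorm U = (fine (opnorm U))%:E.
    by rewrite fineK // ge0_fin_numE ?opnorm_ge0.
  rewrite tE -EFinM; apply/opnorm_leP => x; apply: Fc; last by rewrite -tE.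
  by rewrite -lee_fin -tE opnorm_ge0.
rewrite /F; elim: A {uA fA F Flin FL N} => [|g A [c IHc]].
  by exists 0 => U t x t0 Ut x1; rewrite big_nil l2norm0 mul0r.
exists (2 * (Normc.normc (f g) + c)) => U t x t0 Ut x1.
have S1 := IHc U t x t0 Ut x1.
have ug : Normc.normc (f g * U (delta R 1%g) g) <= Normc.normc (f g) * t.
  rewrite Normc.normcM; apply: ler_wpM2l; first exact: normc_ge0.
  rewrite -ler_sqr ?nnegrE ?normc_ge0 // normc_sqr.
  by apply: (opnorm_le_Cstar Ut t0); rewrite l2norm_delta.
rewrite big_cons; set a := f g * _ in ug *; set S := \sum_(g <- A) _ in S1 *.
rewrite [Cstar_op _ x](_ : _ = a *: lreg g x + S x) //.
have := l2normP a (lreg g x) (S x); rewrite l2norm_lreg.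
have := ler_pM (normc_ge0 a) (l2norm_ge0 x) ug x1.
move: S1; move: (l2norm _) (l2norm _) (l2norm _) => p q p'; lra.
Qed.


Lemma big_uniq_sub (J : eqType) (V : nmodType) (r F : seq J) (H : J -> V) :
  uniq r -> uniq F -> {subset r <= F} ->
  (forall k, k \in F -> k \notin r -> H k = 0) ->
  \sum_(k <- r) H k = \sum_(k <- F) H k.
Proof.
move=> ur uF rF H0; rewrite [RHS](bigID (mem r)) /= [X in _ + X]big_seq_cond.
rewrite [X in _ + X]big1 ?addr0 => [|k /andP[hF hr]]; last exact: H0.
rewrite -[in RHS]big_filter; apply: perm_big; apply: uniq_perm;
  rewrite ?filter_uniq // => k.
by rewrite mem_filter /=; case: (boolP (k \in r)) => // /rF ->.
Qed.

(** The matrix coefficient of M T at (g, h) is f(g h^-1) times that of T. A factorization of f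
    therefore writes M T as the sum over p of (diagonal p.1) T (diagonal conj p.2), evaluated at
    inverses. The bound 1 on the left makes this sum a row contraction, and the bound c^2 on the
    right controls the vectors [b p] to which T is applied. *)
Lemma schur_bounded_multiplier (f : G -> C) (M : {linear Cstar -> Cstar})
    (A : seq G) (c : R) :
  0 <= c -> uniq A -> (forall g, f g != 0 -> g \in A) -> is_multiplier f M ->
  (forall D : seq G, schur_bounded (fun g => g \in D)
     (fun g h => f (g^-1 * h)%g) (fun=> 1) (fun=> c ^+ 2)) ->
  (cb_norm M <= c%:E)%E.
Proof.
move=> c0 uA fA fM HD; apply: ge_ereal_sup => _ [n [T [T1 ->]]].
apply/(mxopnorm_leP _ c0) => z.
rewrite -ler_sqr ?nnegrE ?mulr_ge0 ?l2n_norm_ge0 // exprMn.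
apply: l2n_norm_le => B uB; set y := mxact _ z.
(* The points h at which the input can influence the values of the output on B, as f(g h^-1)
   vanishes unless g h^-1 lies in A. *)
pose F := undup [seq (k^-1 * g)%g | k <- A, g <- B].
have uF : uniq F by exact: undup_uniq.
pose t i j g := T i j (delta R 1%g) g.
have yE i g : g \in B ->
    y i g = \sum_j \sum_(h <- F) f (g * h^-1)%g * t i j (g * h^-1)%g * z j h.
  move=> gB; rewrite /y /mxact l2_sumE; apply: eq_bigr => j _.
  rewrite mxE (multiplier_finite _ uA fA fM) Cstar_sumE l2_sumE.
  transitivity (\sum_(h <- [seq (k^-1 * g)%g | k <- A])
      f (g * h^-1)%g * t i j (g * h^-1)%g * z j h).
    rewrite big_map; apply: eq_bigr => k _.
    by rewrite invgM invgK mulVKg.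
  apply: big_uniq_sub => //.
  - by rewrite map_inj_uniq // => k l /mulIg /invg_inj.
  - by move=> _ /mapP[k kA ->]; rewrite mem_undup; apply/allpairsP; exists (k, g).
  - move=> h _ hA; suff -> : f (g * h^-1)%g = 0 by rewrite !mul0r.
    apply/eqP; apply: contraNT hA => /fA hA; apply/mapP; exists (g * h^-1)%g => //.
    by rewrite invgM invgK mulgVK.
have [s [Ks sa sb]] := HD [seq g^-1%g | g <- B ++ F].
have BD g : g \in B -> g^-1%g \in [seq g^-1%g | g <- B ++ F].
  by move=> gB; rewrite map_f // mem_cat gB.
have FD g : g \in F -> g^-1%g \in [seq g^-1%g | g <- B ++ F].
  by move=> gF; rewrite map_f // mem_cat gF orbT.
pose b (p : (G -> C) * (G -> C)) j : l2 :=
  \sum_(h <- F) (conjc (p.2 h^-1%g) * z j h) *: delta R h.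
have TbE p i g : mxact T (b p) i g =
    \sum_j \sum_(h <- F) conjc (p.2 h^-1%g) * z j h * t i j (g * h^-1)%g.
  rewrite /mxact l2_sumE; apply: eq_bigr => j _; rewrite Cstar_sum l2_sumE.
  by apply: eq_bigr => h _; rewrite CstarZ -[LHS]/(_ * T i j (delta R h) g) Cstar_delta.
have bE p j h : b p j h = if h \in F then conjc (p.2 h^-1%g) * z j h else 0.
  rewrite l2_sumE; case: ifP => hF.
    rewrite (bigD1_seq h) //= big1 => [|k kh]; last first.
      rewrite -[LHS]/(_ * (h == k)%:R) eq_sym (negbTE kh) mulr0 //.
    by rewrite addr0 -[LHS]/(_ * (h == h)%:R) eqxx mulr1.
  rewrite big1_seq // => k /andP[_ kF]; rewrite -[LHS]/(_ * (h == k)%:R).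
  by case: eqP hF kF => [->->|_ _ _] //; rewrite mulr0.
have yT i g : g \in B -> y i g = \sum_(p <- s) p.1 g^-1%g * mxact T (b p) i g.
  move=> gB; rewrite yE //; under [RHS]eq_bigr do rewrite TbE mulr_sumr.
  rewrite [RHS]exchange_big; apply: eq_bigr => j _ /=.
  under [RHS]eq_bigr do rewrite mulr_sumr.
  rewrite [RHS]exchange_big; apply: eq_big_seq => h hF /=.
  have := Ks _ _ (BD _ gB) (FD _ hF); rewrite invgK => ->.
  by rewrite !mulr_suml; apply: eq_bigr => p _; ring.
(* Cauchy-Schwarz over p, in the form 2 |y|^2 <= |y|^2 + (sum over p), which uses that the squares
   of the p.1 sum to at most 1. *)
have key i g : g \in B -> nsq (y i g) <= \sum_(p <- s) nsq (mxact T (b p) i g).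
  move=> gB.
  have yy : nsq (y i g) = \sum_(p <- s)
      complex.Re (conjc (y i g) * (p.1 g^-1%g * mxact T (b p) i g)).
    by rewrite -Re_sum -mulr_sumr -yT // mulrC mulcJ.
  have : 2 * nsq (y i g) <=
      \sum_(p <- s) (nsq (p.1 g^-1%g) * nsq (y i g) + nsq (mxact T (b p) i g)).
    by rewrite {1}yy mulr_sumr; apply: ler_sum => p _; exact: two_Re_le.
  rewrite big_split /= -mulr_suml.
  have := ler_wpM2r (nsq_ge0 (y i g)) (sa _ (BD _ gB)); lra.
apply: (@le_trans _ _ (\sum_(p <- s) \sum_(g <- B) \sum_i nsq (mxact T (b p) i g))).
  rewrite [leRHS]exchange_big /= big_seq [leRHS]big_seq; apply: ler_sum => g gB.
  by rewrite [leRHS]exchange_big; apply: ler_sum => i _; exact: key.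
apply: (@le_trans _ _ (\sum_(p <- s) \sum_(h <- F) \sum_j nsq (b p j h))).
  apply: ler_sum => p _; apply: le_trans (l2n_seq_le _ uB) _.
  apply: le_trans (l2n_norm_finite uF _); last first.
    by move=> j h hF; rewrite bE (negbTE hF).
  rewrite ler_sqr ?nnegrE ?l2n_norm_ge0 //.
  by have := (mxopnorm_leP T ler01).1 T1 (b p); rewrite mul1r.
rewrite exchange_big /=.
apply: le_trans (ler_wpM2l (sqr_ge0 c) (l2n_seq_le z uF)).
rewrite mulr_sumr big_seq [leRHS]big_seq; apply: ler_sum => h hF.
rewrite exchange_big mulr_sumr; apply: ler_sum => j _ /=.
under eq_bigr do rewrite bE hF nsqM nsqJ.
by rewrite -mulr_suml ler_wpM2r ?nsq_ge0 // sb ?FD.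
Qed.
End Operators.

(** * Kernels on words *)

Section WordKernels.
Context {R : realType} {Lt T : eqType} (letter_type : Lt -> T) (L : seq Lt).
Local Notation C := R[i].
Implicit Types (w v : seq Lt) (K : seq Lt -> seq Lt -> C) (k : Lt -> Lt -> C).

Definition word_over w : Prop := all (mem L) w.

Lemma word_over_behead w : word_over w -> word_over (behead w).
Proof. by case: w => // l w /= /andP[]. Qed.

Definition lift_kernel K w v : C :=
  if ohead w && (ohead w == ohead v) then K (behead w) (behead v) else 0.

(* The sum of K over the pairs obtained by deleting a common prefix of length
   at most n. *)
Fixpoint lift_kernels n K : seq Lt -> seq Lt -> C :=
  if n is n'.+1 then fun w v => K w v + lift_kernel (lift_kernels n' K) w v else K.

Definition heads k w v : C :=
  if w is l :: _ then if v is m :: _ then k l m else 0 else 0.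

Definition hty w : option T := omap letter_type (ohead w).

Definition wprod (t : Lt -> C) w : C := \prod_(l <- w) t l.

Definition kerA k (t t' : Lt -> C) w v : C :=
  wprod t (behead w) * heads k w v * wprod t' (behead v).

Definition kerB (t t' : Lt -> C) w v : C :=
  if hty w && (hty w == hty v) then 0 else wprod t w * wprod t' v.

(* The part of the kernel F(w^-1 v) living on pairs of words without common
   first letter: if the first letters have the same type they merge, and w^-1 v
   has length |w| + |v| - 1; otherwise w^-1 v is reduced as it stands. *)
Definition diverge (om : nat -> C) k (t t' : Lt -> C) w v : C :=
  om (size (behead w) + size (behead v)).+1 * kerA k t t' w v +
  om (size w + size v)%N * kerB t t' w v.

Definition size_part p q K w v : C :=
  (size w == p)%:R * K w v * (size v == q)%:R.

Lemma lift_kernelsD n K K' w v :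
  lift_kernels n (fun w v => K w v + K' w v) w v = lift_kernels n K w v + lift_kernels
      n K' w v.
Proof.
elim: n w v => //= n IHn w v; rewrite /lift_kernel IHn.
by case: ifP => _; rewrite addrACA ?addr0.
Qed.

Lemma lift_kernels_sum n (J : Type) (r : seq J) (K : J -> seq Lt -> seq Lt -> C) w v :
  lift_kernels n (fun w v => \sum_(j <- r) K j w v) w v =
  \sum_(j <- r) lift_kernels n (K j) w v.
Proof.
elim: n w v => //= n IHn w v; rewrite big_split /= /lift_kernel; congr (_ + _).
by case: ifP => _; rewrite ?IHn // big1.
Qed.

Lemma eq_lift_kernels n N K K' w v : (size w <= N)%N -> (size v <= N)%N ->
  (forall w v, (size w <= N)%N -> (size v <= N)%N -> K w v = K' w v) ->
  lift_kernels n K w v = lift_kernels n K' w v.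
Proof.
move=> wN vN KK; elim: n w v wN vN => /= [|n IHn] w v wN vN; first exact: KK.
rewrite KK // /lift_kernel IHn // size_behead; lia.
Qed.

Lemma schur_bounded_lift_kernel K a b : schur_bounded word_over K a b ->
  schur_bounded word_over (lift_kernel K)
    (fun w => if ohead w then a (behead w) else 0)
    (fun w => if ohead w then b (behead w) else 0).
Proof.
move=> HK; have H := schur_bounded_pull word_over_behead HK.
apply: (schur_bounded_label (ls := L) _ H) => -[|l w] // m /= /andP[lL _] [<-] //.
Qed.

Lemma schur_bounded_heads k a b : schur_bounded (fun l => l \in L) k a b ->
  schur_bounded word_over (heads k)
    (fun w => if w is l :: _ then a l else 0)
    (fun w => if w is l :: _ then b l else 0).
Proof.
pose ext (f : Lt -> C) w := if w is l :: _ then f l else 0.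
move=> [s [Ks sa sb]]; exists [seq (ext p.1, ext p.2) | p <- s].
split=> [[|l w] [|m v]|[|l w]|[|m v]]; rewrite big_map /=.
- by rewrite big1 // => *; rewrite mul0r.
- by rewrite big1 // => *; rewrite mul0r.
- by rewrite big1 // => *; rewrite conjc0 mulr0.
- by move=> /andP[lL _] /andP[mL _]; exact: Ks.
- by rewrite big1 // => *; rewrite nsq0.
- by move=> /andP[lL _]; exact: sa.
- by rewrite big1 // => *; rewrite nsq0.
- by move=> /andP[lL _]; exact: sb.
Qed.

(** A word reaches length p at only one level of prefix deletion, so the squared norms coming from
    different levels never add up, and the bound c does not grow with n. *)
Lemma schur_bounded_lift_kernels_part n p q K (c : R) : 0 <= c ->
  schur_bounded word_over (size_part p q K) (fun=> c) (fun=> c) ->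
  schur_bounded word_over (lift_kernels n (size_part p q K)) (fun=> c) (fun=> c).
Proof.
move=> c0 HK.
have boolR (b : bool) : nsq (b%:R : C) = b%:R by case: b; rewrite ?nsq1 ?nsq0.
have {}HK : schur_bounded word_over (size_part p q K)
    (fun w => (size w == p)%:R * c) (fun v => (size v == q)%:R * c).
  apply: schur_boundedW (schur_boundedM (fun w => (size w == p)%:R)
    (fun v => (size v == q)%:R) HK) => // [w v _ _|w _|v _]; rewrite ?boolR //.
  by rewrite /size_part; do 2!case: eqP => _; rewrite ?(mul1r, mulr1, mul0r, mulr0).
(* The induction carries the indicators [p <= size w] and [q <= size v]: the unlifted part sees the
   exact lengths, the lifts only longer words. *)
suff : schur_bounded word_over (lift_kernels n (size_part p q K))
    (fun w => (p <= size w)%:R * c) (fun v => (q <= size v)%:R * c).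
  by apply: schur_boundedW => // w _; rewrite ler_piMl // ; case: (_ <= _)%N.
have le_step (m : nat) (w : seq Lt) : (size w == m)%:R * c +
    (if ohead w then (m <= size (behead w))%:R * c else 0) <= (m <= size w)%:R * c.
  case: w => [|l w] /=; rewrite ?addr0 -?mulrDl ler_wpM2r // -?natrD ler_nat; lia.
elim: n => [|n IHn] /=.
  apply: schur_boundedW HK => // w _; rewrite ler_wpM2r // ler_nat; lia.
exact: schur_boundedW (schur_boundedD HK (schur_bounded_lift_kernel IHn)).
Qed.

Lemma schur_bounded_lift_kernels n N K (c : nat -> nat -> R) :
  (forall p q, 0 <= c p q) ->
  (forall p q, schur_bounded word_over (size_part p q K) (fun=> c p q) (fun=> c p q)) ->
  schur_bounded (fun w => word_over w /\ (size w <= N)%N) (lift_kernels n K)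
    (fun=> \sum_(p < N.+1) \sum_(q < N.+1) c p q)
    (fun=> \sum_(p < N.+1) \sum_(q < N.+1) c p q).
Proof.
move=> c0 HK.
have H (p q : 'I_N.+1) := @schur_bounded_lift_kernels_part n p q K _ (c0 p q) (HK p q).
have {}H := schur_bounded_sum (enum 'I_N.+1)
  (fun p => schur_bounded_sum (enum 'I_N.+1) (H p)).
apply: schur_boundedW H => [w [] //|w v [_ wN] [_ vN]|w _|w _];
  do ?by rewrite big_enum; under eq_bigr do rewrite big_enum.
rewrite big_enum; under eq_bigr do rewrite big_enum.
under eq_bigr do rewrite -lift_kernels_sum; rewrite -lift_kernels_sum.
apply: (@eq_lift_kernels _ N) => // {w v wN vN} w v wN vN.
rewrite (bigD1 (inord (size w))) //= (bigD1 (inord (size v))) //= /size_part.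
rewrite !inordK // !eqxx mul1r mulr1 !big1 ?addr0 // => [p /eqP pw|q /eqP qv].
  rewrite big1 // => q _; case: eqP => [wp|]; rewrite ?mul0r //.
  by case: pw; apply/val_inj; rewrite /= inordK.
case: eqP => [vq|]; rewrite ?mulr0 //.
by case: qv; apply/val_inj; rewrite /= inordK.
Qed.

Lemma nsq_le (z : C) (x : R) : Normc.normc z <= x -> nsq z <= x ^+ 2.
Proof.
move=> zx; have x0 := le_trans (normc_ge0 z) zx.
by rewrite -normc_sqr ler_sqr ?nnegrE ?normc_ge0.
Qed.

Lemma normc_wprod_le (t : Lt -> C) (r : R) w : 0 <= r ->
  (forall l, l \in L -> Normc.normc (t l) <= r) -> word_over w ->
  Normc.normc (wprod t w) <= r ^+ size w.
Proof.
move=> r0 tr; elim: w => [|l w IHw]; first by rewrite /wprod big_nil Normc.normc1.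
move=> /andP[lL wL]; rewrite /wprod big_cons Normc.normcM exprS.
by rewrite ler_pM ?normc_ge0 ?tr ?IHw.
Qed.

Lemma normc_wprod_diff (t t' : Lt -> C) (d : R) w :
  (forall l, l \in L -> Normc.normc (t l) <= 1) ->
  (forall l, l \in L -> Normc.normc (t' l) <= 1) ->
  (forall l, l \in L -> Normc.normc (t l - t' l) <= d) -> word_over w ->
  Normc.normc (wprod t w - wprod t' w) <= (size w)%:R * d.
Proof.
move=> t1 t'1 tt'; elim: w => [|l w IHw].
  by rewrite /wprod !big_nil subrr Normc.normc0 mul0r.
move=> /andP[lL wL]; rewrite /wprod !big_cons.
have -> : t l * \prod_(j <- w) t j - t' l * \prod_(j <- w) t' j =
    (t l - t' l) * wprod t w + t' l * (wprod t w - wprod t' w).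
  by rewrite /wprod; ring.
apply: le_trans (le_normcD _ _) _; rewrite !Normc.normcM /= -natr1 mulrDl mul1r addrC.
apply: lerD; rewrite -[leRHS]mul1r; last rewrite mulrC.
  by apply: ler_pM; rewrite ?normc_ge0 ?t'1 ?IHw.
apply: ler_pM; rewrite ?normc_ge0 ?tt' //.
by rewrite -(expr1n _ (size w)) normc_wprod_le.
Qed.

Lemma wprodJ (t : Lt -> C) w : wprod (conjc \o t) w = conjc (wprod t w).
Proof. by rewrite /wprod rmorph_prod. Qed.

(** On letters of one type this is u(l, m) - u(l, 1) conj(u(m, 1)) for a kernel u with value 1 on
    the diagonal and [t l] = u(l, 1). In the intended use k vanishes on the diagonal, and the
    summand [(l == m)%:R] restores it. *)
Definition defect k (t : Lt -> C) l m : C :=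
  if letter_type l == letter_type m then k l m + (l == m)%:R - t l * conjc (t m) else 0.

(** The kernel is the rank-one kernel of [wprod t] plus [V], and [V] peels off one letter at a time:
    the term [A] for the first letters plus the lift of [V]. For a word l w the squared norms
    |t(w)|^2 (1 - |t(l)|^2) and 1 - |t(w)|^2 add up to 1 - |t(l w)|^2, so the total is exactly 1. *)
Lemma schur_bounded_unital n k (t : Lt -> C) :
  (forall l, l \in L -> Normc.normc (t l) <= 1) ->
  (forall l m, letter_type l != letter_type m -> k l m = 0) ->
  schur_bounded (fun l => l \in L) (defect k t)
    (fun l => 1 - nsq (t l)) (fun l => 1 - nsq (t l)) ->
  schur_bounded (fun w => word_over w /\ (size w <= n)%N)
    (lift_kernels n (diverge (fun=> 1) k t (conjc \o t))) (fun=> 1) (fun=> 1).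
Proof.
move=> t1 kty Hd.
pose A w v := wprod t (behead w) * heads (defect k t) w v * conjc (wprod t (behead v)).
pose fix V m : seq Lt -> seq Lt -> C :=
  if m is m'.+1 then fun w v => A w v + lift_kernel (V m') w v else fun _ _ => 0.
have LV m w v : (size w <= m)%N -> (size v <= m)%N ->
    lift_kernels m (diverge (fun=> 1) k t (conjc \o t)) w v =
    wprod t w * conjc (wprod t v) + V m w v.
  elim: m w v => [|m IHm] w v.
    case: w v => [|//] [|//] _ _.
    by rewrite /= /diverge /kerA /kerB /= !wprodJ mulr0 !mul0r mulr0 add0r mul1r addr0.
  have W0 : wprod t [::] = 1 by rewrite /wprod big_nil.
  case: w v => [|l w] [|p v] /=; rewrite ?ltnS => wm vm;
    rewrite /lift_kernel /= /diverge /A /kerA /kerB /= ?wprodJ ?mulr0 ?mul0r ?mulr0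
        ?addr0 ?add0r ?mul1r //.
  rewrite !(inj_eq Some_inj).
  have W u x : wprod t (x :: u) = t x * wprod t u by rewrite /wprod big_cons.
  have b1 : true%:R = 1 :> C by []. have b0 : false%:R = 0 :> C by [].
  rewrite /defect !W rmorphM /=; have [->|lp] := eqVneq l p.
    by rewrite eqxx b1 IHm //; ring.
  by case: eqP => [_|/eqP/kty ->]; rewrite ?b0; ring.
have HV m : schur_bounded word_over (V m) (fun w => 1 - nsq (wprod t w))
    (fun w => 1 - nsq (wprod t w)).
  have t1' w : word_over w -> 0 <= 1 - nsq (wprod t w).
    move=> wL; have := nsq_le (normc_wprod_le ler01 t1 wL).
    by rewrite !expr1n subr_ge0.
  elim: m => [|m IHm] /=.
    apply: schur_boundedW (schur_bounded0 word_over) => // w wL; exact: t1'.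
  have HA := schur_boundedM (fun w => wprod t (behead w))
    (fun w => conjc (wprod t (behead w))) (schur_bounded_heads Hd).
  have le_step w : word_over w -> nsq (wprod t (behead w)) *
      (if w is l :: _ then 1 - nsq (t l) else 0) +
      (if ohead w then 1 - nsq (wprod t (behead w)) else 0) <= 1 - nsq (wprod t w).
    case: w => [wL|l w _] /=; first by rewrite mulr0 addr0 t1'.
    by rewrite [wprod t (l :: w)]/wprod big_cons nsqM -/(wprod t w) le_eqVlt;
      apply/orP; left; apply/eqP; ring.
  apply: schur_boundedW (schur_boundedD HA (schur_bounded_lift_kernel IHm)) => // w wL.
  by rewrite nsqJ; exact: le_step.
have H1 := schur_boundedM (wprod t) (conjc \o wprod t) (schur_bounded1 word_over).
apply: schur_boundedW (schur_boundedD H1 (HV n)) => [w [] //|w v [_ wn] [_ vn]|w _|w _].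
- by rewrite LV // mulr1.
- by rewrite mulr1 addrC subrK.
- by rewrite mulr1 nsqJ addrC subrK.
Qed.

Definition heads_apart w v : C := if hty w && (hty w == hty v) then 0 else 1.

Lemma schur_bounded_heads_cst k (c : R) : 0 <= c ->
  schur_bounded (fun l => l \in L) k (fun=> c) (fun=> c) ->
  schur_bounded word_over (heads k) (fun=> c) (fun=> c).
Proof.
by move=> c0 /schur_bounded_heads; apply: schur_boundedW => // -[|l w].
Qed.

(** The constant kernel 1 costs 1, and subtracting the indicator of equal types of the first letters
    costs 1 more. *)
Lemma schur_bounded_heads_apart : schur_bounded word_over heads_apart (fun=> 2) (fun=>
    2).
Proof.
have H := schur_boundedM (fun=> -1 : C) (fun=> 1) (schur_bounded1 word_over).
have {}H := schur_boundedD (schur_bounded1 word_over)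
  (schur_bounded_label (ls := map letter_type L) (lab := hty) _ H).
apply: schur_boundedW (H _) => // [w v _ _|w _|w _|].
- by rewrite /heads_apart; case: ifP => _; rewrite ?addr0 // !mulr1 subrr.
- by rewrite nsqN nsq1 mulr1; case: ifP; lra.
- by rewrite nsq1 mulr1; case: ifP; lra.
- by move=> [|l w] // y /= /andP[lL _] [<-]; exact: map_f.
Qed.

(** The weight phi affects only the left vectors and psi only the right ones; the resulting bounds
    x^2 c and y^2 c are balanced to their geometric mean. *)
Lemma schur_bounded_part p q K (phi psi : seq Lt -> C) (c x y : R) :
  0 < c -> 0 < x -> 0 < y ->
  schur_bounded word_over K (fun=> c) (fun=> c) ->
  (forall w, word_over w -> size w = p -> Normc.normc (phi w) <= x) ->
  (forall w, word_over w -> size w = q -> Normc.normc (psi w) <= y) ->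
  schur_bounded word_over (size_part p q (fun w v => phi w * K w v * psi v))
    (fun=> c * (x * y)) (fun=> c * (x * y)).
Proof.
move=> c0 x0 y0 HK phix psiy.
apply: (@schur_bounded_balance _ _ _ _ (x ^+ 2 * c) (y ^+ 2 * c)).
- by rewrite mulr_gt0 ?exprn_gt0.
- by rewrite !mulr_gt0.
- by rewrite le_eqVlt; apply/orP; left; apply/eqP; ring.
apply: schur_boundedW (schur_boundedM (fun w => (size w == p)%:R * phi w)
   (fun w => (size w == q)%:R * psi w) HK) => // [w v _ _|w wL|w wL].
- by rewrite /size_part; ring.
- apply: ler_wpM2r; first exact: ltW.
  case: eqP => wp; last by rewrite mul0r nsq0 sqr_ge0.
  by rewrite mul1r nsq_le ?phix.
- apply: ler_wpM2r; first exact: ltW.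
  case: eqP => wp; last by rewrite mul0r nsq0 sqr_ge0.
  by rewrite mul1r nsq_le ?psiy.
Qed.

Lemma schur_bounded_scale (z : C) K (D : seq Lt -> Prop) (c : R) : 0 <= c ->
  Normc.normc z <= 1 -> schur_bounded D K (fun=> c) (fun=> c) ->
  schur_bounded D (fun w v => z * K w v) (fun=> c) (fun=> c).
Proof.
move=> c0 z1 /(schur_boundedM (fun=> z) (fun=> 1)).
apply: schur_boundedW => // [w v _ _|w _|w _]; first by rewrite mulr1.
  by rewrite ler_piMl // (le_trans (nsq_le z1)) ?expr1n.
by rewrite nsq1 mul1r.
Qed.

Lemma schur_bounded_zero K (D : seq Lt -> Prop) (c : R) : 0 <= c ->
  (forall w v, K w v = 0) -> schur_bounded D K (fun=> c) (fun=> c).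
Proof. by move=> c0 K0; apply: schur_boundedW (schur_bounded0 D). Qed.

(** For fixed lengths the cut-off [om] is a scalar. This is the reason for splitting kernels by the
    lengths of both words. *)
Lemma size_part_diverge om k (t t' : Lt -> C) p q w v :
  size_part p q (diverge om k t t') w v =
  om (p.-1 + q.-1).+1 * size_part p q (kerA k t t') w v +
  om (p + q)%N * size_part p q (fun w v => wprod t w * heads_apart w v * wprod t' v) w
      v.
Proof.
rewrite /size_part /diverge; case: (size w =P p) => [<-|_];
  last by rewrite !mul0r !mulr0 addr0.
case: (size v =P q) => [<-|_]; last by rewrite !mulr0 addr0.
rewrite !size_behead /kerB /heads_apart; case: ifP => _; ring.
Qed.

(** The lengths 0 and 1 both contribute 1, whence the summand 1 next to the geometric series. *)
Lemma geom_sum_le (rho : R) n : 0 < rho -> rho < 1 ->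
  \sum_(p < n) rho ^+ p.-1 <= 1 + (1 - rho)^-1.
Proof.
move=> r0 r1; have r10 : 0 < 1 - rho by rewrite subr_gt0.
case: n => [|n]; first by rewrite big_ord0 addr_ge0 // invr_ge0 ltW.
rewrite big_ord_recl expr0 lerD2l (eq_bigr (fun i : 'I_n => rho ^+ i)) //.
rewrite -[leRHS]mul1r ler_pdivlMr //.
have -> : (\sum_(i < n) rho ^+ i) * (1 - rho) = 1 - rho ^+ n.
  by rewrite -(opprB (rho ^+ n)) subrX1; ring.
by rewrite gerBl exprn_ge0 // ltW.
Qed.

(** Each letter counted by the weights brings rho^2. Beyond length N one factor rho per letter
    yields rho^N, and the other is summed over both lengths. The 4 is 2 for [kerA], from k, plus 2
    for [kerB], from [heads_apart]. *)
Lemma schur_bounded_tail n M N om k (t t' : Lt -> C) (rho : R) :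
  0 < rho -> rho < 1 ->
  (forall m, Normc.normc (om m) <= 1) -> (forall m, (m <= N)%N -> om m = 0) ->
  schur_bounded (fun l => l \in L) k (fun=> 2) (fun=> 2) ->
  (forall l, l \in L -> Normc.normc (t l) <= rho ^+ 2) ->
  (forall l, l \in L -> Normc.normc (t' l) <= rho ^+ 2) ->
  schur_bounded (fun w => word_over w /\ (size w <= M)%N)
    (lift_kernels n (diverge om k t t'))
    (fun=> 4 * rho ^+ N * (1 + (1 - rho)^-1) ^+ 2)
    (fun=> 4 * rho ^+ N * (1 + (1 - rho)^-1) ^+ 2).
Proof.
move=> r0 r1 om1 omN Hk tr t'r.
have r0' := ltW r0; have r1' := ltW r1.
pose c p q : R := 4 * rho ^+ N * (rho ^+ p.-1 * rho ^+ q.-1).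
have c0 p q : 0 <= c p q by rewrite !mulr_ge0 ?exprn_ge0.
suff H p q : schur_bounded word_over (size_part p q (diverge om k t t'))
    (fun=> c p q) (fun=> c p q).
  have SS : \sum_(p < M.+1) \sum_(q < M.+1) c p q <=
      4 * rho ^+ N * (1 + (1 - rho)^-1) ^+ 2.
    rewrite (eq_bigr (fun p : 'I_M.+1 => 4 * rho ^+ N * rho ^+ p.-1 *
      (\sum_(q < M.+1) rho ^+ q.-1))) => [|p _]; last first.
      by rewrite mulr_sumr; apply: eq_bigr => q _; rewrite /c mulrA.
    rewrite -mulr_suml -mulr_sumr -mulrA ler_wpM2l ?mulr_ge0 ?exprn_ge0 //.
    rewrite expr2; apply: ler_pM; rewrite ?geom_sum_le //;
      by rewrite sumr_ge0 // => p _; rewrite exprn_ge0.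
  by apply: schur_boundedW (schur_bounded_lift_kernels n M c0 H).
pose e := 2 * (rho ^+ N * (rho ^+ p.-1 * rho ^+ q.-1)).
have e0 : 0 <= e by rewrite !mulr_ge0 ?exprn_ge0.
have wt (u : Lt -> C) w : (forall l, l \in L -> Normc.normc (u l) <= rho ^+ 2) ->
    word_over w -> Normc.normc (wprod u w) <= (rho ^+ size w) ^+ 2.
  move=> ur wL; rewrite -exprM mulnC exprM; apply: normc_wprod_le => //.
  exact: sqr_ge0.
have rm (a b : nat) : (a <= b)%N -> rho ^+ b <= rho ^+ a.
  by move=> ab; apply: ler_wiXn2l.
have HA : schur_bounded word_over
    (fun w v => om (p.-1 + q.-1).+1 * size_part p q (kerA k t t') w v)
    (fun=> e) (fun=> e).
  (* The first letters carry no weight in [kerA], so the available exponent is p.-1 + q.-1; it is at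
     least N exactly when the merged length exceeds N. *)
  have [Nm|Nm] := leqP (p.-1 + q.-1).+1 N.
    by apply: schur_bounded_zero => // w v; rewrite omN // mul0r.
  apply: schur_bounded_scale => //.
  apply: schur_boundedW (@schur_bounded_part p q (heads k)
    (fun w => wprod t (behead w)) (fun w => wprod t' (behead w)) 2
    ((rho ^+ p.-1) ^+ 2) ((rho ^+ q.-1) ^+ 2) _ _ _ _ _ _) => //.
  - move=> w _; rewrite /e ler_pM2l // -exprMn expr2 ler_wpM2r ?mulr_ge0 ?exprn_ge0 //.
    by rewrite -exprD rm.
  - move=> w _; rewrite /e ler_pM2l // -exprMn expr2 ler_wpM2r ?mulr_ge0 ?exprn_ge0 //.
    by rewrite -exprD rm.
  - by rewrite !exprn_gt0.
  - by rewrite !exprn_gt0.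
  - exact: schur_bounded_heads_cst.
  - move=> w wL <-; rewrite -size_behead; apply: wt => //; exact: word_over_behead.
  - move=> w wL <-; rewrite -size_behead; apply: wt => //; exact: word_over_behead.
have HB : schur_bounded word_over (fun w v => om (p + q)%N *
    size_part p q (fun w v => wprod t w * heads_apart w v * wprod t' v) w v)
    (fun=> e) (fun=> e).
  have [Nm|Nm] := leqP (p + q) N.
    by apply: schur_bounded_zero => // w v; rewrite omN // mul0r.
  apply: schur_bounded_scale => //.
  have le : 2 * ((rho ^+ p) ^+ 2 * (rho ^+ q) ^+ 2) <= e.
    rewrite /e ler_pM2l // -exprMn expr2 -!exprD.
    by apply: rm; lia.
  apply: schur_boundedW (@schur_bounded_part p q heads_apart (wprod t) (wprod t') 2
    ((rho ^+ p) ^+ 2) ((rho ^+ q) ^+ 2) _ _ _ _ _ _) => //.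
  - by rewrite !exprn_gt0.
  - by rewrite !exprn_gt0.
  - exact: schur_bounded_heads_apart.
  - by move=> w wL <-; apply: wt.
  - by move=> w wL <-; apply: wt.
apply: schur_boundedW (schur_boundedD HA HB) => // [w v _ _|w _|w _].
- by rewrite size_part_diverge.
- by rewrite /e /c; lra.
- by rewrite /e /c; lra.
Qed.

(** The differences telescope: three terms for [kerA] (left weight, kernel, right weight) and two
    for [kerB], each at most 2x with x = (N+1) d, which explains the 10. The cut-off leaves only
    lengths up to N+1, hence at most (N+2)^2 pairs of lengths. *)
Lemma schur_bounded_diff n M N om k1 k2 (t1 t1' t2 t2' : Lt -> C) (d : R) :
  0 < d -> (forall m, Normc.normc (om m) <= 1) ->
  (forall m, (N < m)%N -> om m = 0) ->
  schur_bounded (fun l => l \in L) k1 (fun=> 2) (fun=> 2) ->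
  schur_bounded (fun l => l \in L) k2 (fun=> 2) (fun=> 2) ->
  schur_bounded (fun l => l \in L) (fun l m => k1 l m - k2 l m)
    (fun=> 2 * d) (fun=> 2 * d) ->
  (forall l, l \in L -> [/\ Normc.normc (t1 l) <= 1, Normc.normc (t1' l) <= 1,
    Normc.normc (t2 l) <= 1 & Normc.normc (t2' l) <= 1]) ->
  (forall l, l \in L -> Normc.normc (t1 l - t2 l) <= d /\
    Normc.normc (t1' l - t2' l) <= d) ->
  schur_bounded (fun w => word_over w /\ (size w <= M)%N)
    (lift_kernels n (fun w v => diverge om k1 t1 t1' w v - diverge om k2 t2 t2' w v))
    (fun=> N.+2%:R ^+ 2 * (10 * N.+1%:R * d))
    (fun=> N.+2%:R ^+ 2 * (10 * N.+1%:R * d)).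
Proof.
move=> d0 om1 omN Hk1 Hk2 Hk tb tt.
pose x := N.+1%:R * d.
have dx : d <= x by rewrite ler_peMl ?ler1n // ltW.
have x0 : 0 < x by rewrite mulr_gt0.
pose th := 10 * N.+1%:R * d.
have th0 : 0 < th by rewrite /th -mulrA mulr_gt0.
pose c p q : R := ((p <= N.+1)%N && (q <= N.+1)%N)%:R * th.
have c0 p q : 0 <= c p q by rewrite mulr_ge0 // ltW.
pose dif w v := diverge om k1 t1 t1' w v - diverge om k2 t2 t2' w v.
suff H p q : schur_bounded word_over (size_part p q dif) (fun=> c p q) (fun=> c p q).
  have S1 : \sum_(p < M.+1) (p <= N.+1)%N%:R <= N.+2%:R :> R.
    rewrite -natr_sum ler_nat;
      have : (\sum_(p < M.+1) (p <= N.+1)%N <= minn M.+1 N.+2)%N.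
      elim: M.+1 => [|m IHm]; first by rewrite big_ord0.
      rewrite big_ord_recr /=; move: (\sum_(_ < _) _)%N IHm => s.
      by case: (leqP m N.+1) => /=; lia.
    by move/leq_trans; apply; exact: geq_minr.
  have SS : \sum_(p < M.+1) \sum_(q < M.+1) c p q <=
      N.+2%:R ^+ 2 * (10 * N.+1%:R * d).
    rewrite (eq_bigr (fun p : 'I_M.+1 => (p <= N.+1)%N%:R *
      (\sum_(q < M.+1) (q <= N.+1)%N%:R) * th)) => [|p _]; last first.
      by rewrite mulr_sumr mulr_suml; apply: eq_bigr => q _; rewrite /c -mulnb natrM.
    rewrite -mulr_suml -mulr_suml; apply: ler_wpM2r; first exact: ltW.
    by rewrite expr2; apply: ler_pM => //; rewrite sumr_ge0.
  by apply: schur_boundedW (schur_bounded_lift_kernels n M c0 H).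
have [pqN|pqN] := boolP ((p <= N.+1) && (q <= N.+1))%N; last first.
  apply: schur_bounded_zero => // w v.
  have -> : size_part p q dif w v = size_part p q (diverge om k1 t1 t1') w v -
      size_part p q (diverge om k2 t2 t2') w v by rewrite /size_part /dif; ring.
  rewrite !size_part_diverge !omN ?mul0r ?subrr //; lia.
have wt (u u' : Lt -> C) w : (forall l, l \in L -> [/\ Normc.normc (u l) <= 1,
      Normc.normc (u' l) <= 1 & Normc.normc (u l - u' l) <= d]) -> word_over w ->
    Normc.normc (wprod u w) <= 1 /\
    Normc.normc (wprod u w - wprod u' w) <= (size w)%:R * d.
  move=> H wL; split.
    by rewrite -(expr1n _ (size w)) normc_wprod_le // => l /H[].
  by apply: normc_wprod_diff => // l /H[].
have {}wt w : word_over w -> (size w <= N.+1)%N ->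
    [/\ Normc.normc (wprod t1' w) <= 1, Normc.normc (wprod t2 w) <= 1,
        Normc.normc (wprod t1 w - wprod t2 w) <= x &
        Normc.normc (wprod t1' w - wprod t2' w) <= x].
  move=> wL wN; have sx : (size w)%:R * d <= x by rewrite ler_wpM2r ?ler_nat // ltW.
  have [|_ /le_trans/(_ sx) H1] := wt t1 t2 w _ wL.
    by move=> l lL; case: (tb l lL) (tt l lL) => ? ? ? ? [? ?]; split.
  have [|H2 /le_trans/(_ sx) H3] := wt t1' t2' w _ wL.
    by move=> l lL; case: (tb l lL) (tt l lL) => ? ? ? ? [? ?]; split.
  have [|H4 _] := wt t2 t2 w _ wL => //.
  by move=> l lL; case: (tb l lL) => ? ? ? ?; split=> //;
    rewrite subrr Normc.normc0 ltW.
have wtb w : word_over w -> (size w <= N.+1)%N ->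
    [/\ Normc.normc (wprod t1' (behead w)) <= 1, Normc.normc (wprod t2 (behead w)) <= 1,
        Normc.normc (wprod t1 (behead w) - wprod t2 (behead w)) <= x &
        Normc.normc (wprod t1' (behead w) - wprod t2' (behead w)) <= x].
  by move=> wL wN; apply: wt; [exact: word_over_behead|rewrite size_behead; lia].
have /andP[pN qN] := pqN.
have B1 := @schur_bounded_part p q heads_apart (fun w => wprod t1 w - wprod t2 w)
  (wprod t1') 2 x 1 (ltr0Sn R 1) x0 ltr01 schur_bounded_heads_apart.
have B2 := @schur_bounded_part p q heads_apart (wprod t2) 
  (fun w => wprod t1' w - wprod t2' w) 2 1 x (ltr0Sn R 1) ltr01 x0
      schur_bounded_heads_apart.
have A1 := @schur_bounded_part p q (heads k1)
  (fun w => wprod t1 (behead w) - wprod t2 (behead w))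
  (fun w => wprod t1' (behead w)) 2 x 1 (ltr0Sn R 1) x0 ltr01
  (schur_bounded_heads_cst (ler0n _ _) Hk1).
have A2 := @schur_bounded_part p q (heads (fun l m => k1 l m - k2 l m))
  (fun w => wprod t2 (behead w)) (fun w => wprod t1' (behead w)) (2 * d) 1 1
  (mulr_gt0 (ltr0Sn R 1) d0) ltr01 ltr01 (schur_bounded_heads_cst (mulr_ge0 (ler0n _
      _) (ltW d0)) Hk).
have A3 := @schur_bounded_part p q (heads k2)
  (fun w => wprod t2 (behead w))
  (fun w => wprod t1' (behead w) - wprod t2' (behead w)) 2 1 x (ltr0Sn R 1) ltr01 x0
  (schur_bounded_heads_cst (ler0n _ _) Hk2).
have HA : schur_bounded word_over
    (fun w v => size_part p q (kerA k1 t1 t1') w v - size_part p q (kerA k2 t2 t2') w v)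
    (fun=> 6 * x) (fun=> 6 * x).
  apply: schur_boundedW (schur_boundedD (schur_boundedD (A1 _ _) (A2 _ _)) (A3 _ _))
      => //.
  - move=> w v _ _; rewrite /size_part /kerA.
    have -> : heads (fun l m => k1 l m - k2 l m) w v = heads k1 w v - heads k2 w v.
      by case: w v => [|? ?] [|? ?] /=; rewrite ?subrr.
    ring.
  - by move=> w _; lra.
  - by move=> w _; lra.
  - by move=> w wL wp; case: (wtb w wL) => //; rewrite wp.
  - by move=> w wL wp; case: (wtb w wL) => //; rewrite wp.
  - by move=> w wL wp; case: (wtb w wL) => //; rewrite wp.
  - by move=> w wL wp; case: (wtb w wL) => //; rewrite wp.
  - by move=> w wL wp; case: (wtb w wL) => //; rewrite wp.
  - by move=> w wL wp; case: (wtb w wL) => //; rewrite wp.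
have HB : schur_bounded word_over (fun w v =>
      size_part p q (fun w v => wprod t1 w * heads_apart w v * wprod t1' v) w v -
      size_part p q (fun w v => wprod t2 w * heads_apart w v * wprod t2' v) w v)
    (fun=> 4 * x) (fun=> 4 * x).
  apply: schur_boundedW (schur_boundedD (B1 _ _) (B2 _ _)) => //.
  - by move=> w v _ _; rewrite /size_part; ring.
  - by move=> w _; lra.
  - by move=> w _; lra.
  - by move=> w wL wp; case: (wt w wL) => //; rewrite wp.
  - by move=> w wL wp; case: (wt w wL) => //; rewrite wp.
  - by move=> w wL wp; case: (wt w wL) => //; rewrite wp.
  - by move=> w wL wp; case: (wt w wL) => //; rewrite wp.
have x60 : 0 <= 6 * x by rewrite mulr_ge0 // ltW.
have x40 : 0 <= 4 * x by rewrite mulr_ge0 // ltW.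
apply: schur_boundedW (schur_boundedD
  (schur_bounded_scale x60 (om1 (p.-1 + q.-1).+1) HA)
  (schur_bounded_scale x40 (om1 (p + q)%N) HB)) => // [w v _ _|w _|w _].
- have -> : size_part p q dif w v = size_part p q (diverge om k1 t1 t1') w v -
      size_part p q (diverge om k2 t2 t2') w v by rewrite /size_part /dif; ring.
  by rewrite !size_part_diverge; ring.
- by rewrite /c pqN mul1r /th /x; lra.
- by rewrite /c pqN mul1r /th /x; lra.
Qed.

(** The summands stand for the positive definite kernel, its tail beyond length N, and the
    replacement of k2 by k1 up to length N. *)
Definition truncation_bound N (rho d : R) : R :=
  1 + 4 * rho ^+ N * (1 + (1 - rho)^-1) ^+ 2 + N.+2%:R ^+ 2 * (10 * N.+1%:R * d).

(* Truncating the kernel of F at length N changes the positive definite kernel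
   of the free product of the k2 by its tail and by a small perturbation. *)
Lemma schur_bounded_words n N k1 k2 (t1 t1' t2 : Lt -> C) (rho d : R) :
  0 < rho -> rho < 1 -> 0 < d ->
  schur_bounded (fun l => l \in L) k1 (fun=> 2) (fun=> 2) ->
  schur_bounded (fun l => l \in L) k2 (fun=> 2) (fun=> 2) ->
  schur_bounded (fun l => l \in L) (fun l m => k1 l m - k2 l m)
    (fun=> 2 * d) (fun=> 2 * d) ->
  (forall l m, letter_type l != letter_type m -> k2 l m = 0) ->
  schur_bounded (fun l => l \in L) (defect k2 t2)
    (fun l => 1 - nsq (t2 l)) (fun l => 1 - nsq (t2 l)) ->
  (forall l, l \in L -> [/\ Normc.normc (t1 l) <= rho ^+ 2,
    Normc.normc (t1' l) <= rho ^+ 2 & Normc.normc (t2 l) <= rho ^+ 2]) ->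
  (forall l, l \in L -> Normc.normc (t1 l - t2 l) <= d /\
    Normc.normc (t1' l - conjc (t2 l)) <= d) ->
  schur_bounded (fun w => word_over w /\ (size w <= n)%N)
    (lift_kernels n (diverge (fun m => (m <= N)%N%:R) k1 t1 t1'))
    (fun=> truncation_bound N rho d) (fun=> truncation_bound N rho d).
Proof.
move=> r0 r1 d0 Hk1 Hk2 Hk kty Hd tr tt.
have r21 : rho ^+ 2 <= 1 by rewrite expr_le1 // ltW.
have normJ (z : C) : Normc.normc (conjc z) = Normc.normc z.
  by case: z => a b /=; rewrite /conjc /= sqrrN.
have HU := @schur_bounded_unital n k2 t2 _ kty Hd.
have HT := @schur_bounded_tail n n N (fun m => - (N < m)%N%:R) k2 t2 (conjc \o t2) rho
  r0 r1 _ _ Hk2.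
have HD := @schur_bounded_diff n n N (fun m => (m <= N)%N%:R) k1 k2 t1 t1' t2
  (conjc \o t2) d d0 _ _ Hk1 Hk2 Hk.
apply: schur_boundedW (schur_boundedD (schur_boundedD (HU _) (HT _ _ _ _)) (HD _ _ _
    _)) => //.
- move=> w v [_ wn] [_ vn]; rewrite -!lift_kernelsD;
    apply: (@eq_lift_kernels _ n) => // {w v wn vn} w v _ _.
  rewrite /diverge; have E m : (m <= N)%N%:R = 1 - (N < m)%N%:R :> C.
    by rewrite ltnNge; case: (m <= N)%N; rewrite ?subr0 ?subrr.
  rewrite !E; ring.
- by move=> l /tr[_ _]; move/le_trans; apply.
- by move=> m; rewrite normcN; case: (_ < _)%N; rewrite ?Normc.normc0 ?Normc.normc1.
- by move=> m; rewrite leqNgt => /negbTE ->; rewrite oppr0.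
- by move=> l /tr[].
- by move=> l /tr[]; rewrite /= normJ.
- by move=> m; case: (_ <= _)%N; rewrite ?Normc.normc0 ?Normc.normc1.
- by move=> m; rewrite ltnNge => /negbTE ->.
- by move=> l /tr[a1 a2 a3]; split; rewrite /= ?normJ; apply: le_trans r21.
Qed.
End WordKernels.

(** * Normal forms in the free product *)

Section NormalForm.
Context {I : Type} (G : I -> groupType).
Local Notation Lt := (fp_letter G).
Implicit Types (i : I) (l m : Lt) (u v w : fp_word G).

Definition letter_type l : {classic I} := projT1 l.

(* The component of l in G i, with the junk value 1 if l is not in G i. *)
Definition component i l : G i :=
  if pselect (projT1 l = i) is left e then eq_rect _ (fun i => G i) (projT2 l) i e
  else 1%g.

Lemma componentE i (g : G i) : component i (letter g) = g.
Proof.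
rewrite /component; case: pselect => [e|/(_ erefl)] //=.
by rewrite (Prop_irrelevance e erefl).
Qed.

Lemma letterE l : l = letter (projT2 l).
Proof. by case: l. Qed.

Lemma component_type l i : letter_type l = i -> letter (component i l) = l.
Proof. by case: l => j g <-; rewrite -[existT _ j g]/(letter g) componentE. Qed.

Definition nontrivial l := (projT2 l != 1)%g.
Definition types_differ l m := letter_type l != letter_type m.
Definition reduced w := all nontrivial w && sorted types_differ w.

Definition hd_in i w : G i := if w is l :: _ then component i l else 1%g.
Definition tl_in i w := if w is l :: w' then if letter_type l == i then w' else w else
    [::].
Definition cons_in i (g : G i) w := if g == 1%g then w else letter g :: w.
(** Van der Waerden's trick: a reduced word is the same as an element of G i, possibly 1, followed
    by a reduced word that does not begin in G i, and G i acts by multiplication on the first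
    component. *)
Definition letter_act i (g : G i) w := cons_in (g * hd_in i w)%g (tl_in i w).

Definition headless i w := if w is l :: _ then letter_type l != i else true.

Lemma reduced_cons l w : reduced (l :: w) = [&& nontrivial l, headless (letter_type l)
    w & reduced w].
Proof.
rewrite /reduced /=; case: w => [|m w] /=; first by rewrite !andbT.
by rewrite /types_differ [letter_type l == _]eq_sym; case: nontrivial => //=;
  case: (letter_type m != letter_type l); rewrite ?andbF.
Qed.

Lemma component_neq i l : letter_type l != i -> component i l = 1%g.
Proof. by move=> /eqP li; rewrite /component; case: pselect. Qed.

Lemma hd_cons i (g : G i) w : headless i w -> hd_in i (cons_in g w) = g.
Proof.
rewrite /cons_in; case: eqP => [->|_ _] /=; last exact: componentE.
by case: w => //= l w; exact: component_neq.
Qed.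

Lemma tl_cons i (g : G i) w : headless i w -> tl_in i (cons_in g w) = w.
Proof.
rewrite /cons_in; case: eqP => [_|_ _] /=; last by rewrite eqxx.
by case: w => //= l w /negbTE ->.
Qed.

Lemma cons_hd_tl i w : reduced w -> cons_in (hd_in i w) (tl_in i w) = w.
Proof.
rewrite /cons_in; case: w => [|l w]; first by rewrite eqxx.
rewrite reduced_cons /= => /and3P[nl _ _].
have [li|li] := eqVneq (letter_type l) i; last by rewrite component_neq // eqxx.
by move: nl; rewrite -{1}(component_type li) /nontrivial /= => /negbTE ->;
  rewrite component_type.
Qed.

Lemma headless_tl i w : reduced w -> headless i (tl_in i w).
Proof.
case: w => //= l w; rewrite reduced_cons => /and3P[_ lw _].
by case: eqVneq => [<-|] //.
Qed.

Lemma reduced_tl i w : reduced w -> reduced (tl_in i w).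
Proof.
case: w => //= l w; case: ifP => // _.
by rewrite reduced_cons => /and3P[].
Qed.

Lemma reduced_cons_in i (g : G i) w : reduced w -> headless i w -> reduced (cons_in g
    w).
Proof.
move=> rw hw; rewrite /cons_in; case: eqP => [//|/eqP g1].
by rewrite reduced_cons; apply/and3P; split.
Qed.

Lemma reduced_letter_act i (g : G i) w : reduced w -> reduced (letter_act g w).
Proof. by move=> rw; rewrite reduced_cons_in ?reduced_tl ?headless_tl. Qed.

Lemma letter_act1 i w : reduced w -> letter_act (1%g : G i) w = w.
Proof. by move=> rw; rewrite /letter_act mul1g cons_hd_tl. Qed.

Lemma letter_actM i (g h : G i) w : reduced w -> letter_act g (letter_act h w) =
    letter_act (g * h)%g w.
Proof.
by move=> rw; rewrite /letter_act hd_cons ?tl_cons ?mulgA // headless_tl.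
Qed.

Definition word_act u w := foldr (fun l w => letter_act (projT2 l) w) w u.

Lemma reduced_word_act u w : reduced w -> reduced (word_act u w).
Proof. by elim: u => //= l u IHu rw; apply/reduced_letter_act/IHu. Qed.

Lemma word_act_cong u v : fp_cong u v -> forall w, reduced w -> word_act u w =
    word_act v w.
Proof.
elim=> {u v} // [u v _ IH w rw|u v z _ IH1 _ IH2 w rw|u u' v v' _ IH1 _ IH2 w rw|i w
    rw|i g h w rw].
- by rewrite IH.
- by rewrite IH1 // IH2.
- by rewrite /word_act !foldr_cat -!/(word_act _ _) IH2 // IH1 // reduced_word_act.
- exact: letter_act1.
- exact: letter_actM.
Qed.

Lemma word_act_reduced w : reduced w -> word_act w [::] = w.
Proof.
elim: w => //= l w IHw; rewrite reduced_cons => /and3P[nl lw rw].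
rewrite IHw // /letter_act.
have -> : hd_in (projT1 l) w = 1%g.
  by case: w lw {IHw rw} => //= m w; exact: component_neq.
have -> : tl_in (projT1 l) w = w.
  by case: w lw {IHw rw} => //= m w /negbTE ->.
by rewrite mulg1 /cons_in (negbTE nl) -letterE.
Qed.

Lemma fp_cong_cons l u v : fp_cong u v -> fp_cong (l :: u) (l :: v).
Proof. by move=> uv; rewrite -(cat1s l u) -(cat1s l v); apply: fp_cat => //;
  exact: fp_refl. Qed.

Lemma fp_cong_cons_in i (g : G i) w : fp_cong (letter g :: w) (cons_in g w).
Proof.
rewrite /cons_in; case: eqP => [->|_]; last exact: fp_refl.
rewrite -[letter _ :: w]cat1s -{2}[w]cat0s; apply: fp_cat; last exact: fp_refl.
exact: fp_unit.
Qed.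

Lemma fp_cong_letter_act i (g : G i) w : fp_cong (letter g :: w) (letter_act g w).
Proof.
apply: fp_trans (fp_cong_cons_in _ _).
case: w => [|l w] /=; first by rewrite mulg1; exact: fp_refl.
have [li|li] := eqVneq (letter_type l) i; last by rewrite component_neq // mulg1;
  exact: fp_refl.
rewrite -{1}(component_type li) -[_ :: _ :: w]/([:: letter g;
  letter _] ++ w) -[letter _ :: w]cat1s.
by apply: fp_cat; [exact: fp_mult|exact: fp_refl].
Qed.

Lemma fp_cong_word_act u : fp_cong u (word_act u [::]).
Proof.
elim: u => [|l u IHu] /=; first exact: fp_refl.
apply: fp_trans (fp_cong_letter_act _ _); rewrite -letterE; exact: fp_cong_cons.
Qed.

(** The action of x on the empty word. The choice of the representative does not affect it, since
    congruent words act alike on reduced words. *)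
Definition nf (x : freeprod G) : fp_word G := word_act (repr x) [::].

Lemma nf_class u : nf (fp_class u) = word_act u [::].
Proof. by apply: word_act_cong => //; apply/fp_classP; rewrite fp_classK. Qed.

Lemma nfK x : fp_class (nf x) = x.
Proof.
rewrite -[RHS]fp_classK; apply/fp_classP/fp_sym; exact: fp_cong_word_act.
Qed.

Lemma nf_reduced x : reduced (nf x).
Proof. exact: reduced_word_act. Qed.

Lemma nf_class_reduced u : reduced u -> nf (fp_class u) = u.
Proof. by move=> ru; rewrite nf_class word_act_reduced. Qed.

Lemma fp_invE u : ((fp_class u)^-1)%g = fp_class (inv_word u).
Proof.
apply: (mulIg (fp_class u)); rewrite mulVg [RHS]fp_mulE.
by apply/esym/fp_classP; exact: fp_catV.
Qed.

Lemma letter_type_inv l : letter_type (inv_letter l) = letter_type l.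
Proof. by []. Qed.

Lemma nontrivial_inv l : nontrivial (inv_letter l) = nontrivial l.
Proof. by rewrite /nontrivial /= invg_eq1. Qed.

Lemma types_differ_sym : symmetric types_differ.
Proof. by move=> l m; rewrite /types_differ eq_sym. Qed.

Lemma sorted_inv_word w : sorted types_differ (inv_word w) = sorted types_differ w.
Proof.
rewrite /inv_word rev_sorted sorted_map.
by apply: eq_sorted => l m; rewrite /relpre /= [RHS]types_differ_sym.
Qed.

Lemma nontrivial_inv_word w : all nontrivial (inv_word w) = all nontrivial w.
Proof.
by rewrite /inv_word all_rev all_map; apply: eq_all => l; exact: nontrivial_inv.
Qed.

Lemma inv_word_cons l w : inv_word (l :: w) = rcons (inv_word w) (inv_letter l).
Proof. by rewrite /inv_word map_cons rev_cons. Qed.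

Lemma reduced_inv_cat w v : reduced w -> reduced v ->
  (if w is l :: _ then headless (letter_type l) v else true) -> reduced (inv_word w ++
      v).
Proof.
case: w => [|l w] // /andP[wn ws] /andP[vn vs] lv.
rewrite /reduced all_cat nontrivial_inv_word wn vn inv_word_cons cat_rcons /=.
rewrite sorted_cat_cons -inv_word_cons sorted_inv_word ws /=.
case: v lv vs {vn} => //= m v lm ->; rewrite andbT.
by rewrite /types_differ letter_type_inv eq_sym.
Qed.

Lemma reduced_inv_merge w v l : reduced w -> reduced v -> nontrivial l ->
  headless (letter_type l) w -> headless (letter_type l) v -> reduced (inv_word w ++ l
      :: v).
Proof.
move=> rw rv nl lw lv; rewrite /reduced all_cat nontrivial_inv_word /= nl.
rewrite (andP rw).1 (andP rv).1 sorted_cat_cons.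
have -> : rcons (inv_word w) l = inv_word (inv_letter l :: w).
  by rewrite inv_word_cons /inv_letter /= invgK -letterE.
rewrite sorted_inv_word.
have /andP[_ ->] : reduced (inv_letter l :: w).
  by rewrite reduced_cons nontrivial_inv nl rw lw.
by have /andP[_] : reduced (l :: v) by rewrite reduced_cons nl rv lv.
Qed.

Definition merge_letters l m : Lt := letter ((projT2 l)^-1 * component (projT1 l) m)%g.

(** * Multiplicative functions on the free product as kernels on reduced words *)

Section Kernel.
Context {R : realType}.
Local Notation C := R[i].
Implicit Types (om : nat -> C) (phi : Lt -> C).

Definition fval om phi (x : freeprod G) : C := om (size (nf x)) * wprod phi (nf x).

(** The diagonal is 0 because equal first letters cancel; such a pair is left to the next level of
    the lift. *)
Definition merge_kernel phi l m : C :=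
  if (letter_type l == letter_type m) && (l != m) then phi (merge_letters l m) else 0.

Lemma wprod_inv phi w : wprod phi (inv_word w) = wprod (phi \o @inv_letter I G) w.
Proof.
rewrite /wprod /inv_word -[RHS](big_map (@inv_letter I G) xpredT phi).
by apply: perm_big; rewrite perm_rev.
Qed.

Lemma fval_reduced om phi w : reduced w ->
  fval om phi (fp_class w) = om (size w) * wprod phi w.
Proof. by move=> rw; rewrite /fval nf_class_reduced. Qed.

Lemma size_inv_word w : size (inv_word w) = size w.
Proof. by rewrite /inv_word size_rev size_map. Qed.

Lemma wprod_cat phi w v : wprod phi (w ++ v) = wprod phi w * wprod phi v.
Proof. by rewrite /wprod big_cat. Qed.

(** Only the level of the longest common prefix contributes, as [diverge] vanishes on equal first
    letters and [lift_kernel] on different ones. At that level a word is exhausted, or the next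
    letters have different types, or they are distinct of one type and merge into a single
    nontrivial letter. The word w enters inverted, so its letters are weighted by phi at their
    inverses. *)
Lemma fval_kernel n om phi w v : reduced w -> reduced v ->
  (size w <= n)%N -> (size v <= n)%N ->
  fval om phi (fp_class (inv_word w ++ v)) =
  lift_kernels n (diverge letter_type om (merge_kernel phi) (phi \o @inv_letter I G)
      phi) w v.
Proof.
have far u x : reduced u -> reduced x ->
    (if u is l :: _ then headless (letter_type l) x else true) ->
    fval om phi (fp_class (inv_word u ++ x)) =
      om (size u + size x)%N * (wprod (phi \o @inv_letter I G) u * wprod phi x).
  move=> ru rx ux; rewrite fval_reduced ?reduced_inv_cat //.
  by rewrite size_cat size_inv_word wprod_cat wprod_inv.
elim: n w v => [|n IHn] w v rw rv wn vn.
  case: w v wn vn rw rv => [|//] [|//] _ _ _ _.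
  by rewrite (far [::] [::]) //= /diverge /kerA /kerB /= mulr0 mul0r mulr0 add0r.
case: w v wn vn rw rv => [|l w] [|m v] wn vn rw rv; rewrite /= /lift_kernel /=.
- by rewrite (far [::] [::]) //= /diverge /kerA /kerB /= mulr0 mul0r mulr0 add0r addr0.
- by rewrite (far [::] (m :: v)) //= /diverge /kerA /kerB /= mulr0 mul0r mulr0 add0r
      addr0.
- by rewrite (far (l :: w) [::]) //= /diverge /kerA /kerB /= mulr0 mul0r mulr0 add0r
      addr0.
rewrite /diverge /kerA /kerB /= !(inj_eq Some_inj) /merge_kernel.
have [lm|lm] := eqVneq (letter_type l) (letter_type m); last first.
  rewrite (far (l :: w) (m :: v)) //=; last by rewrite eq_sym.
  have [lm'|_] := eqVneq l m; first by rewrite lm' eqxx in lm.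
  by rewrite mulr0 mul0r mulr0 add0r addr0.
have [e|lm'] /= := eqVneq l m.
  rewrite mulr0 mul0r !mulr0 !add0r -IHn //; first last.
  - by move: rv; rewrite reduced_cons => /and3P[].
  - by move: rw; rewrite reduced_cons => /and3P[].
  congr fval; rewrite -e inv_word_cons cat_rcons.
  apply/fp_classP; apply: fp_cat; first exact: fp_refl.
  rewrite -[v in X in fp_cong _ X]cat0s -[_ :: _]/(inv_word [:: l] ++ [:: l] ++ v) catA.
  by apply: fp_cat; [exact: fp_catV|exact: fp_refl].
rewrite mulr0 !addr0.
move: rw rv; rewrite !reduced_cons => /and3P[nl lw rw] /and3P[nm mv rv].
have -> : fp_class (inv_word (l :: w) ++ m :: v) = fp_class (inv_word w ++
    merge_letters l m :: v).
  apply/fp_classP; rewrite inv_word_cons cat_rcons; apply: fp_cat; first exact: fp_refl.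
  rewrite -(cat1s (merge_letters l m)) -[_ :: _ :: v]/([:: inv_letter l; m] ++ v).
  apply: fp_cat; last exact: fp_refl.
  by rewrite -{1}(component_type (esym lm)); exact: fp_mult.
have nlm : nontrivial (merge_letters l m).
  rewrite /nontrivial /merge_letters /=; apply: contra lm' => /eqP e; apply/eqP.
  have e' : component (projT1 l) m = projT2 l by apply: (mulgI (projT2 l)^-1%g);
    rewrite e mulVg.
  by rewrite [l]letterE -e'; apply: component_type.
rewrite fval_reduced ?reduced_inv_merge //;
  last by rewrite -[letter_type (merge_letters l m)]/(letter_type l) lm.
rewrite size_cat /= size_inv_word addnS wprod_cat wprod_inv.
by rewrite [wprod phi (_ :: v)]/wprod big_cons -!mulrA.
Qed.
End Kernel.
End NormalForm.

(** * The truncated free product kernel *)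

Section Gram.
Context {R : realType}.
Local Notation C := R[i].

(* Projecting the Gram vectors of u orthogonally to the unit vector at e. *)
Lemma gram_defect (X : eqType) (D : seq X) (e : X) (q : seq (X -> C)) :
  e \in D -> (forall x, x \in D -> \sum_(f <- q) nsq (f x) <= 1) ->
  let u x y := if x == y then 1 else \sum_(f <- q) f x * conjc (f y) in
  schur_bounded (fun x => x \in D) (fun x y => u x y - u x e * conjc (u y e))
    (fun x => 1 - nsq (u x e)) (fun x => 1 - nsq (u x e)).
Proof.
move=> eD q1 u.
(* A private coordinate for each point completes its vector to a unit vector without changing the
   inner products of distinct points; this accounts for the value 1 of u on the diagonal. *)
pose dg z x : C := if x == z then (Num.sqrt (1 - \sum_(f <- q) nsq (f z)))%:C%C else 0.
pose Q := q ++ [seq dg z | z <- undup D].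
have uE x y : x \in D -> y \in D -> u x y = \sum_(f <- Q) f x * conjc (f y).
  move=> xD yD; rewrite big_cat big_map (bigD1_seq x) ?mem_undup ?undup_uniq //=.
  rewrite [X in _ + (_ + X)]big1 => [|z zx]; last first.
    by rewrite /dg eq_sym (negbTE zx) mul0r.
  rewrite addr0 /u /dg eqxx [y == x]eq_sym; case: eqP => [<-|_]; last first.
    by rewrite conjc0 mulr0 addr0.
  rewrite mulcJ nsqR sqr_sqrtr ?subr_ge0 ?q1 //.
  under eq_bigr do rewrite mulcJ.
  by rewrite -rmorph_sum -rmorphD /= addrC subrK.
have uJ x y : x \in D -> y \in D -> conjc (u x y) = u y x.
  move=> xD yD; rewrite !uE // rmorph_sum; apply: eq_bigr => f _.
  by rewrite rmorphM /= conjcK mulrC.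
have uee : u e e = 1 by rewrite /u eqxx.
pose pr (f : X -> C) x := f x - u x e * f e.
have prE x y : x \in D -> y \in D ->
    u x y - u x e * conjc (u y e) = \sum_(f <- Q) pr f x * conjc (pr f y).
  move=> xD yD.
  transitivity (u x y - u x e * u e y - u x e * conjc (u y e) +
     u x e * conjc (u y e) * u e e).
    by rewrite uee uJ //; ring.
  transitivity (\sum_(f <- Q) f x * conjc (f y) -
      \sum_(f <- Q) u x e * (f e * conjc (f y)) -
      \sum_(f <- Q) conjc (u y e) * (f x * conjc (f e)) +
      \sum_(f <- Q) u x e * conjc (u y e) * (f e * conjc (f e))).
    congr (_ - _ - _ + _); rewrite -?mulr_sumr -?uE //.
    by rewrite mulrC.
  rewrite -!sumrB -big_split; apply: eq_bigr => f _ /=.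
  rewrite /pr rmorphB rmorphM /=; ring.
have prN x : x \in D -> \sum_(f <- Q) nsq (pr f x) = 1 - nsq (u x e).
  move=> xD; have /(congr1 (@complex.Re R)) := prE x x xD xD.
  rewrite mulcJ {1}/u eqxx Re_sum => H.
  rewrite -[RHS]/(complex.Re (1 - (nsq (u x e))%:C%C)) H.
  by apply: eq_bigr => f _; rewrite mulcJ.
exists [seq (pr f, pr f) | f <- Q].
split=> [x y xD yD|x xD|x xD]; rewrite big_map /= ?prN //.
exact: prE.
Qed.
End Gram.

(** * Direct sums of kernels over the factors *)

Section TypeSum.
Context {R : realType} {I : Type} (G : I -> groupType).
Local Notation C := R[i].
Local Notation Lt := (fp_letter G).

Lemma component_self (l : Lt) : component (projT1 l) l = projT2 l.
Proof. by case: l => j g; exact: componentE. Qed.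

(** Each of the finitely many types occurring in L gets its own block of coordinates, so the vectors
    of a letter have a single nonzero block and the bounds of different types do not add up. *)
Lemma schur_bounded_types (L : seq Lt) (D : forall i, seq (G i))
    (K : forall i, G i -> G i -> C) (a b : forall i, G i -> R) :
  (forall i l, l \in L -> component i l \in D i) ->
  (forall i, schur_bounded (fun g => g \in D i) (@K i) (@a i) (@b i)) ->
  schur_bounded (fun l => l \in L)
    (fun l m => if letter_type l == letter_type m
       then K (projT1 l) (projT2 l) (component (projT1 l) m) else 0)
    (fun l => a (projT1 l) (projT2 l)) (fun l => b (projT1 l) (projT2 l)).
Proof.
move=> DL HK.
have boolR (x : bool) : nsq (x%:R : C) = x%:R by case: x; rewrite ?nsq1 ?nsq0.
have Hi i := schur_boundedM (fun l : Lt => (letter_type l == i)%:R : C) (fun l =>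
    (letter_type l == i)%:R)
  (schur_bounded_pull (D := fun g => g \in D i) (DL i) (HK i)).
have tyL (l : Lt) : l \in L -> forall i, Some (letter_type l) = Some i -> i \in undup
    (map (@letter_type I G) L).
  by move=> lL _ [<-]; rewrite mem_undup map_f.
have lab (V : nmodType) (l : Lt) (v : V) : l \in L ->
    \sum_(i <- undup (map (@letter_type I G) L)) (if Some (letter_type l) == Some i
        then v else 0) = v.
  move=> lL; rewrite (@big_label _ _ (undup (map (@letter_type I G) L))) ?undup_uniq
      //; exact: tyL.
have labR (c : forall i, G i -> R) (l : Lt) : l \in L ->
    \sum_(i <- undup (map (@letter_type I G) L)) nsq ((letter_type l == i)%:R : C) * c
        i (component i l) =
    c (projT1 l) (projT2 l).
  move=> lL; rewrite -[RHS](lab _ l) //; apply: eq_bigr => i _.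
  rewrite boolR (inj_eq Some_inj); case: eqP => [<-|_]; last by rewrite mul0r.
  by rewrite mul1r /letter_type component_self.
apply: schur_boundedW (schur_bounded_sum (undup (map (@letter_type I G) L)) Hi) => //
    [l m lL mL|l lL|l lL].
- rewrite -[LHS](lab _ l) //; apply: eq_bigr => i _.
  rewrite (inj_eq Some_inj); case: eqP => [<-|_]; last by rewrite !mul0r.
  by rewrite mul1r eq_sym; case: eqP => _;
    rewrite ?mulr1 ?mulr0 // /letter_type component_self.
- by rewrite labR.
- by rewrite labR.
Qed.
End TypeSum.

(** * Schur bound for the truncated and damped product function *)

Section Assembly.
Context {R : realType} {I : Type} (G : I -> groupType).
Local Notation C := R[i].
Local Notation Lt := (fp_letter G).
Variables (f : forall i, G i -> C) (rho d : R).
Hypotheses (rho0 : 0 < rho) (rho1 : rho < 1) (d0 : 0 < d).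
Hypothesis fS : forall i (E : seq (G i)), schur_bounded (fun g => g \in E)
  (fun g h => f (g^-1 * h)%g) (fun=> 1) (fun=> 1).
Hypothesis f1 : forall i, 1 - d ^+ 2 / 2 <= complex.Re (f (1%g : G i)).

Definition letter_weight (l : Lt) : C := (rho ^+ 2)%:C%C * f (projT2 l).

Lemma freeprod_schur_bounded N (D : seq (freeprod G)) :
  schur_bounded (fun x => x \in D)
    (fun x y => fval (fun m => (m <= N)%N%:R) letter_weight (x^-1 * y)%g)
    (fun=> truncation_bound N rho d) (fun=> truncation_bound N rho d).
Proof.
pose L : seq Lt := flatten [seq nf x | x <- D].
pose n := \max_(x <- D) size (nf x).
have Dn x : x \in D -> (size (nf x) <= n)%N.
  by move=> xD; rewrite /n; exact: leq_bigmax_seq.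
have DL x : x \in D -> word_over L (nf x).
  move=> xD; apply/allP => l lx; apply/flattenP; exists (nf x) => //.
  by apply/mapP; exists x.
have Lnt l : l \in L -> nontrivial l.
  move=> /flattenP[_ /mapP[x _ ->]]; have /andP[/allP + _] := nf_reduced x; exact.
(* The unit is included because the weight of a letter g is a kernel value at (g, 1) or (1, g); it
   is also the default value of [component]. *)
pose Di i : seq (G i) := 1%g :: [seq component i l | l <- L].
have DL' i l : l \in L -> component i l \in Di i.
  by move=> lL; rewrite inE map_f ?orbT.
have LDi l : l \in L -> projT2 l \in Di (projT1 l).
  by move=> /(DL' (projT1 l)); rewrite component_self.
have eDi i : 1%g \in Di i by rewrite mem_head.
pose s i := sval (cid (fS (Di i))).
have sP i := svalP (cid (fS (Di i))); rewrite -/(s _) in sP.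
pose r : C := (rho ^+ 2)%:C%C.
have r20 : 0 <= rho ^+ 2 by exact: sqr_ge0.
have r21 : rho ^+ 2 <= 1 by rewrite expr_le1 // ltW.
pose P i (g h : G i) : C := \sum_(p <- s i) p.1 g * conjc (p.1 h).
pose K i (g h : G i) : C := f (g^-1 * h)%g.
have SK i : schur_bounded (fun g => g \in Di i) (@K i) (fun=> 1) (fun=> 1).
  exact: fS.
have SP i : schur_bounded (fun g => g \in Di i) (@P i) (fun=> 1) (fun=> 1).
  have [_ sa _] := sP i.
  by exists [seq (p.1, p.1) | p <- s i]; split=> *; rewrite big_map //= sa.
(* The difference is the inner product of xi_g with eta_h - xi_h. Since xi_h and eta_h have inner
   product f(1), |eta_h - xi_h|^2 <= 2 - 2 Re f(1) <= d^2; the bounds 1 and d^2 are balanced to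
   d. *)
have SKP i : schur_bounded (fun g => g \in Di i) (fun g h => K i g h - P i g h)
    (fun=> d) (fun=> d).
  have [Ks sa sb] := sP i.
  apply: (@schur_bounded_balance _ _ _ _ 1 (d ^+ 2)); rewrite ?mul1r //.
  exists [seq (p.1, fun h => p.2 h - p.1 h) | p <- s i].
  split=> [g h gD hD|g gD|h hD]; rewrite big_map /=; first 1 last.
  - exact: sa.
  - rewrite (eq_bigr _ (fun p _ => nsqB (p.2 h) (p.1 h))).
    rewrite sumrB big_split /= -mulr_sumr -Re_sum -Ks // mulVg.
    by have := sa _ hD; have := sb _ hD; have := f1 i; lra.
  - rewrite [K i g h]Ks // -sumrB; apply: eq_bigr => p _.
    by rewrite rmorphB mulrBr.
have NK i g h : g \in Di i -> h \in Di i -> Normc.normc (K i g h) <= 1.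
  by move=> gD hD; apply: (schur_bounded_normc _ _ _ _ (SK i)).
have NP i g h : g \in Di i -> h \in Di i -> Normc.normc (P i g h) <= 1.
  by move=> gD hD; apply: (schur_bounded_normc _ _ _ _ (SP i)).
have NKP i g h : g \in Di i -> h \in Di i -> Normc.normc (K i g h - P i g h) <= d.
  by move=> gD hD; apply: (schur_bounded_normc _ _ _ _ (SKP i)).
have nr (z : C) (x : R) : Normc.normc z <= x -> Normc.normc (r * z) <= rho ^+ 2 * x.
  move=> zx; rewrite Normc.normcM; apply: ler_pM; rewrite ?normc_ge0 //.
  by rewrite /= expr0n addr0 sqrtr_sqr ger0_norm.
have nrd (z : C) (x : R) : 0 <= x -> Normc.normc z <= x -> Normc.normc (r * z) <= x.
  by move=> x0 /nr /le_trans; apply; rewrite ler_piMl.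
have r1 : nsq r <= 1 by rewrite nsqR expr_le1.
pose tys (Q : forall i, G i -> G i -> C) (l m : Lt) : C :=
  if letter_type l == letter_type m then Q _ (projT2 l) (component (projT1 l) m) else 0.
(* Removing the diagonal doubles the bound; hence the constants 2 and 2 d required by
   [schur_bounded_words]. *)
have Stys Q (c : R) : 0 < c ->
    (forall i, schur_bounded (fun g => g \in Di i) (Q i) (fun=> c) (fun=> c)) ->
    schur_bounded (fun l => l \in L) (fun l m => if l == m then 0 else r * tys Q l m)
      (fun=> 2 * c) (fun=> 2 * c).
  move=> c0 HQ; have HT := schur_boundedM (fun=> r) (fun=> 1) (schur_bounded_types DL'
      HQ).
  have HD := schur_bounded_diag (ls := L) (h := id) (fun l => - (r * tys Q l l))
    (fun x xL => xL).
  have {}HD : schur_bounded (fun l => l \in L)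
      (fun l m => if l == m then - (r * tys Q l l) else 0) (fun=> c) (fun=> c).
    apply: (@schur_bounded_balance _ _ _ _ (c ^+ 2) 1); rewrite ?exprn_gt0 ?mulr1 //.
    apply: schur_boundedW HD => // l lL; rewrite nsqN -normc_sqr.
    rewrite ler_sqr ?nnegrE ?normc_ge0 ?(ltW c0) //; apply: nrd; first exact: ltW.
    rewrite /tys eqxx component_self.
    by apply: (schur_bounded_normc _ _ _ _ (HQ _)); rewrite ?LDi.
  apply: schur_boundedW (schur_boundedD HT HD) => // [l m lL mL|l _|l _].
  - by case: eqP => [<-|_]; rewrite mulr1 ?addr0 // subrr.
  - have := ler_wpM2r (ltW c0) r1; lra.
  - by rewrite nsq1; lra.
pose k2 l m : C := if l == m then 0 else r * tys P l m.
pose t2 (l : Lt) : C := r * P _ (projT2 l) 1%g.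
have kE l m : merge_kernel letter_weight l m = if l == m then 0 else r * tys K l m.
  rewrite /merge_kernel /tys; case: eqP => _; case: eqP => //= _; rewrite ?mulr0 //.
have main := @schur_bounded_words R Lt _ (@letter_type I G) L n N (merge_kernel
    letter_weight) k2
  (letter_weight \o @inv_letter I G) letter_weight t2 rho d rho0 rho1 d0.
have d20 : 0 < 2 * d by rewrite mulr_gt0.
have nfW x : x \in D -> word_over L (nf x) /\ (size (nf x) <= n)%N.
  by move=> xD; split; [exact: DL|exact: Dn].
suff H : schur_bounded (fun w => word_over L w /\ (size w <= n)%N)
    (lift_kernels n (diverge (@letter_type I G) (fun m => (m <= N)%N%:R) (merge_kernel
        letter_weight)
      (letter_weight \o @inv_letter I G) letter_weight))
    (fun=> truncation_bound N rho d) (fun=> truncation_bound N rho d).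
  apply: schur_bounded_eq (schur_bounded_pull nfW H) => x y xD yD.
  rewrite -fval_kernel ?nf_reduced ?Dn //.
  by rewrite -fp_mulE -fp_invE !nfK.
apply: main.
- have S1 := Stys K 1 ltr01 SK; rewrite (mulr1 2) in S1.
  by apply: schur_bounded_eq S1 => l m _ _; exact: kE.
- by have := Stys P 1 ltr01 SP; rewrite (mulr1 2).
- apply: schur_bounded_eq (Stys _ d d0 SKP) => l m _ _; rewrite kE /k2 /tys.
  by case: eqP => _; [rewrite subr0|case: eqP => _; ring].
- by move=> l m lm; rewrite /k2 /tys (negbTE lm) mulr0; exact: if_same.
(* Damping P by rho^2 and then resetting the diagonal to 1 preserves positive definiteness: the
   vectors are scaled by rho, and [gram_defect] supplies the missing norm. *)
- pose q i : seq (G i -> C) := [seq (fun g => rho%:C%C * p.1 g) | p <- s i].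
  have q1 i g : g \in Di i -> \sum_(v <- q i) nsq (v g) <= 1.
    move=> gD; rewrite big_map; under eq_bigr do rewrite nsqM nsqR.
    rewrite -mulr_sumr; have [_ /(_ _ gD) sa _] := sP i.
    by apply: le_trans (ler_wpM2l r20 sa) _; rewrite mulr1.
  have qE i g h : \sum_(v <- q i) v g * conjc (v h) = r * P i g h.
    rewrite big_map mulr_sumr; apply: eq_bigr => p _.
    by rewrite rmorphM /= conjc_real /r expr2 rmorphM /=; ring.
  have HT := schur_bounded_types DL' (fun i => gram_defect (eDi i) (q1 i)).
  apply: schur_boundedW HT => // [l m lL mL|l lL|l lL]; first 1 last.
  - by rewrite (negbTE (Lnt _ lL)) qE.
  - by rewrite (negbTE (Lnt _ lL)) qE.
  rewrite /defect; case: eqP => // e.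
  have mE := component_type (esym e); set h := component _ m in mE *.
  have h1 : h != 1%g by have := Lnt _ mL; rewrite -mE.
  have t2m : t2 m = r * P _ h 1%g by rewrite -{1}mE.
  have lmE : (projT2 l == h) = (l == m).
    apply/eqP/eqP => [lh|lm]; first by rewrite [l]letterE lh.
    by rewrite /h -lm component_self.
  rewrite lmE (negbTE (Lnt _ lL)) (negbTE h1) !qE t2m /k2 /tys.
  have -> : letter_type l == letter_type m by apply/eqP.
  rewrite -/h.
  by case: eqP => _; rewrite ?addr0 ?add0r.
(* The values of f at g^-1 and g are those of K at (g, 1) and (1, g), so the bounds for kernels
   apply. *)
- move=> l lL; rewrite -[rho ^+ 2]mulr1; split.
  + rewrite /= /letter_weight /= -[_^-1%g]mulg1; apply: nr.
    exact: NK (LDi _ lL) (eDi _).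
  + rewrite /letter_weight -[projT2 l]mul1g -invg1; apply: nr.
    exact: NK (eDi _) (LDi _ lL).
  + apply: nr; exact: NP (LDi _ lL) (eDi _).
- move=> l lL; split.
  + rewrite /= /letter_weight /= -[_^-1%g]mulg1 /t2 -mulrBr; apply: nrd;
      first exact: ltW.
    exact: NKP (LDi _ lL) (eDi _).
  + have -> : conjc (t2 l) = r * P _ 1%g (projT2 l).
      rewrite /t2 rmorphM /= conjc_real rmorph_sum; congr (_ * _).
      by apply: eq_bigr => p _; rewrite rmorphM /= conjcK mulrC.
    rewrite /letter_weight -mulrBr; apply: nrd; first exact: ltW.
    by have := NKP _ _ _ (eDi _) (LDi _ lL); rewrite /K invg1 mul1g.
Qed.
End Assembly.

(** * Finitely supported multipliers *)

Section Approximants.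
Context {R : realType} {G : groupType}.
Local Notation C := (R[i]^o).
Local Notation Cstar := (Cstar R G).

Lemma normr_normc (z : R[i]) : `|z| = (Normc.normc z)%:C%C.
Proof. by case: z. Qed.

Lemma approximating_net_near (A : Type) (le : A -> A -> Prop) (f : A -> G -> C)
    (E : seq G) (a0 : A) (e : R) : 0 < e -> approximating_net le f ->
  exists2 a, le a0 a & forall g, g \in E -> Normc.normc (f a g - 1) < e.
Proof.
move=> e0 [[_ lexx le_trans ledir] _ f1].
have near1 g : exists a, forall b, le a b -> Normc.normc (f b g - 1) < e.
  have eC0 : 0 < e%:C%C by rewrite ltcR.
  have [a Ha] := f1 g _ (nbhsx_ballx (1 : C) _ eC0).
  exists a => b ab; have := Ha b ab; rewrite /= -ball_normE /= normr_normc ltcR.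
  by rewrite -normcN opprB.
suff [a Ha] : exists a, forall b, le a b -> forall g, g \in E -> Normc.normc (f b g -
    1) < e.
  have [b [a0b ab]] := ledir a0 a; exists b => // g gE; exact: Ha.
elim: E => [|g E [a Ha]]; first by exists a0.
have [a' Ha'] := near1 g; have [b [ab a'b]] := ledir a a'.
exists b => c bc h; rewrite inE => /orP[/eqP ->|hE].
  by apply: Ha'; exact: le_trans a'b bc.
by apply: Ha => //; exact: le_trans ab bc.
Qed.

(** Two infima are unfolded: a net with limsup below 1 + e, then a tail of it with supremum below 1
    + e. The index is taken in this tail, far enough for convergence on E. *)
Lemma weakly_amenable_multiplier (E : seq G) (e : R) : 0 < e ->
  weakly_amenable_with_constant_1 R G ->
  exists (f : G -> C) (M : {linear Cstar -> Cstar}),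
    [/\ finite_set [set g | f g != 0]%classic, is_multiplier f M,
        (cb_norm M <= (1 + e)%:E)%E &
        forall g, g \in E -> Normc.normc (f g - 1) <= e].
Proof.
move=> e0 hG.
have lt1 : (ereal_inf (@wa_bounds R G) < (1 + e)%:E)%E.
  by rewrite -/(@haagerup_constant R G) hG lte_fin ltrDl.
have [L [A [le [f [M [fnet fM LE _]]]]] Le] := ereal_inf_lt lt1.
rewrite LE in Le; have [_ [a0 _ <-] a0e] := ereal_inf_lt Le.
have [a a0a fa] := approximating_net_near E a0 e0 fnet.
have [_ ffin _] := fnet.
exists (f a), (M a); split => //.
- apply: le_trans (ltW a0e); apply: ereal_sup_ubound; by exists a.
- by move=> g /fa /ltW.
Qed.

Lemma finite_set_seq (T : choiceType) (P : T -> bool) : finite_set [set x | P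
    x]%classic ->
  exists2 s : seq T, uniq s & forall x, P x -> x \in s.
Proof.
move=> /finite_seqP[s sE]; exists (undup s); first exact: undup_uniq.
move=> x Px; rewrite mem_undup.
by have : [set x | P x]%classic x by []; rewrite sE.
Qed.

Lemma weakly_amenable_schur (E : seq G) (e : R) : 0 < e ->
  weakly_amenable_with_constant_1 R G ->
  exists f : G -> R[i],
    [/\ exists A : seq G, forall g, f g != 0 -> g \in A,
        forall D : seq G, schur_bounded (fun g => g \in D)
          (fun g h => f (g^-1 * h)%g) (fun=> 1) (fun=> 1) &
        forall g, g \in E -> Normc.normc (f g - 1) <= e].
Proof.
move=> e0 hG; have e3 : 0 < e / 3 by rewrite divr_gt0.
have [f [M [ffin fM Mc fE]]] := weakly_amenable_multiplier E e3 hG.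
have [A _ fA] := finite_set_seq ffin.
(* One e/3 is the excess of the norm, the other the loss in the factorization. Division by c moves 1
   by at most 2e/3, which with the e/3 from f gives e. *)
pose c := 1 + e / 3 + e / 3; have c0 : 0 < c by rewrite /c; lra.
have c10 : 0 < 1 + e / 3 by lra.
have cC : c%:C%C != 0 by rewrite fmorph_eq0 gt_eqF.
exists (fun g => c^-1%:C%C * f g); split.
- exists A => g; rewrite mulf_eq0 negb_or => /andP[_]; exact: fA.
- move=> D; have H := multiplier_schur_bounded D c10 e3 fM Mc.
  (* Rescaling turns the bounds (c, c) into (1, c^2), and the factor 1/c put on the right vectors
     turns them into (1, 1). *)
  have {}H := schur_bounded_rescale (s := c^-1) _ H; rewrite invr_gt0 c0 in H.
  have {}H := schur_boundedM (fun=> 1) (fun=> c^-1%:C%C) (H isT).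
  apply: schur_boundedW H => // [g h _ _|g _|g _].
  + by rewrite mul1r mulrC.
  + by rewrite nsq1 mul1r mulVf // gt_eqF.
  + by rewrite nsqR invrK -/c expr2 mulrACA mulVf ?gt_eqF // mulr1.
- move=> g gE.
  have -> : c^-1%:C%C * f g - 1 = c^-1%:C%C * (f g - 1) + (1 - c)%:C%C * c^-1%:C%C.
    have -> : (1 - c)%:C%C = 1 - c%:C%C :> R[i] by rewrite rmorphB rmorph1.
    rewrite fmorphV; field; exact: cC.
  have nR (x : R) : Normc.normc x%:C%C = `|x| by rewrite /= expr0n addr0 sqrtr_sqr.
  apply: le_trans (le_normcD _ _) _; rewrite !Normc.normcM !nR.
  have cV : `|c^-1| <= 1.
    by rewrite ger0_norm ?invr_ge0 ?(ltW c0) // invf_le1 //; rewrite /c; lra.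
  have -> : `|1 - c| = e / 3 + e / 3.
    by rewrite distrC ger0_norm /c; lra.
  have := ler_pM (normr_ge0 _) (normc_ge0 _) cV (fE g gE).
  have : (e / 3 + e / 3) * `|c^-1| <= (e / 3 + e / 3) * 1.
    by rewrite ler_wpM2l //; lra.
  lra.
Qed.
End Approximants.

(** * Choice of the parameters *)

Section FreeProductApproximation.
Context {R : realType} {I : Type} (G : I -> groupType).
Local Notation C := R[i].
Local Notation Lt := (fp_letter G).
Hypothesis hG : forall i, weakly_amenable_with_constant_1 R (G i).

Lemma Re_le_normc (z : C) : complex.Re z <= Normc.normc z.
Proof.
case: z => a b /=; apply: le_trans (ler_norm a) _.
by rewrite -sqrtr_sqr ler_sqrt ?addr_ge0 ?sqr_ge0 // lerDl sqr_ge0.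
Qed.

Lemma exists_small_power (rho c e : R) (n : nat) : 0 <= rho -> rho < 1 -> 0 <= c -> 0
    < e ->
  exists2 N, (n <= N)%N & c * rho ^+ N <= e.
Proof.
move=> r0 r1 c0 e0.
have nr : `|rho| < 1 by rewrite ger0_norm.
have e1 : 0 < e / (c + 1) by rewrite divr_gt0 // ltr_wpDl.
have /cvgr0Pnorm_le H := cvg_expr nr; have [m _ {H}Hm] := H _ e1.
exists (maxn n m); first exact: leq_maxl.
have := Hm (maxn n m) (leq_maxr _ _); rewrite /= ger0_norm ?exprn_ge0 // => H.
apply: le_trans (ler_wpM2l c0 H) _; rewrite mulrA ler_pdivrMr ?ltr_wpDl //.
by rewrite mulrC ler_wpM2l ?lerDl // ltW.
Qed.

Fixpoint words_upto (L : seq Lt) n : seq (fp_word G) :=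
  if n is n'.+1 then [::] :: [seq l :: w | l <- L, w <- words_upto L n'] else [:: [::]].

Lemma mem_words_upto L n w : (size w <= n)%N -> all (mem L) w -> w \in words_upto L n.
Proof.
elim: n w => [|n IHn] [|l w] //= wn /andP[lL wL]; rewrite inE; apply/orP; right.
by apply/allpairsP; exists (l, w); split => //; exact: IHn.
Qed.

(** Only nontrivial letters occur in normal forms, so the support of psi matters on them alone. The
    trivial letters cannot be included: there is one for each index, and the weights used later do
    not vanish there. *)
Lemma fval_finite (om : nat -> C) (psi : Lt -> C) (L : seq Lt) N :
  (forall m, (N < m)%N -> om m = 0) -> (forall l, nontrivial l -> psi l != 0 -> l \in
      L) ->
  exists2 A : seq (freeprod G), uniq A & forall x, fval om psi x != 0 -> x \in A.
Proof.
move=> omN psiL; exists (undup [seq fp_class w | w <- words_upto L N]);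
  first exact: undup_uniq.
move=> x; rewrite mem_undup /fval mulf_eq0 negb_or => /andP[om0 psi0].
rewrite -(nfK x); apply: map_f; apply: mem_words_upto.
  by rewrite leqNgt; apply: contra om0 => /omN ->.
apply/allP => l lx; apply: psiL.
  by have /andP[/allP + _] := nf_reduced x; exact.
apply: contra psi0 => /eqP psil; rewrite /wprod (big_rem l) //= psil mul0r //.
Qed.

Lemma freeprod_multiplier (E : seq (freeprod G)) (e : R) : 0 < e -> e <= 1 ->
  exists (F : freeprod G -> R[i]^o) (M : {linear Cstar R (freeprod G) -> Cstar R
      (freeprod G)}),
    [/\ finite_set [set x | F x != 0]%classic, is_multiplier F M,
        (cb_norm M <= (1 + e)%:E)%E &
        forall x, x \in E -> Normc.normc (F x - 1) <= e].
Proof.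
move=> e0 e1.
pose L : seq Lt := flatten [seq nf x | x <- E].
pose n0 := \max_(x <- E) size (nf x).
have En x : x \in E -> (size (nf x) <= n0)%N.
  by move=> xE; rewrite /n0; exact: leq_bigmax_seq.
have EL x : x \in E -> word_over L (nf x).
  move=> xE; apply/allP => l lx; apply/flattenP; exists (nf x) => //.
  by apply/mapP; exists x.
(* Each letter may cost 4 eta: 1 - rho^2 <= 2 eta for the damping and e' <= 2 eta for f. Words of E
   have at most n0 letters. *)
pose eta := e / (4 * n0.+1%:R).
have eta0 : 0 < eta by rewrite divr_gt0 // mulr_gt0.
have eta4 : eta * 4 <= 1.
  rewrite /eta invfM mulrA mulrAC divfK //.
  by rewrite ler_pdivrMr // mul1r (le_trans e1) // ler1n.
have n0eta : n0%:R * (4 * eta) <= e.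
  have -> : 4 * eta = e / n0.+1%:R by rewrite /eta invfM mulrCA [4 * _]mulrA mulfV //
      mul1r.
  by rewrite mulrCA ler_piMr ?(ltW e0) // ler_pdivrMr // mul1r ler_nat.
pose rho := 1 - eta.
have rho0 : 0 < rho by rewrite /rho; lra.
have rho1 : rho < 1 by rewrite /rho; lra.
pose S := (1 + (1 - rho)^-1) ^+ 2.
have S0 : 0 <= 4 * S by rewrite mulr_ge0 ?sqr_ge0.
have e20 : 0 < e / 2 by rewrite divr_gt0.
(* The condition n0 <= N keeps the words of E below the cut, and [SN] makes the tail term at most
   e/2. *)
have [N n0N SN] := exists_small_power n0 (ltW rho0) rho1 S0 e20.
(* Makes the perturbation term of [truncation_bound] equal to e/2. *)
pose d := e / 2 / (N.+2%:R ^+ 2 * (10 * N.+1%:R)).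
have cN0 : 0 < N.+2%:R ^+ 2 * (10 * N.+1%:R) :> R by rewrite !mulr_gt0 ?exprn_gt0.
have d0 : 0 < d by rewrite divr_gt0.
have trunc : truncation_bound N rho d <= 1 + e.
  rewrite /truncation_bound -addrA lerD2l -/S mulrAC.
  have -> : N.+2%:R ^+ 2 * (10 * N.+1%:R * d) = e / 2.
    by rewrite mulrA mulrC divfK // gt_eqF.
  lra.
have trunc1 : 1 <= truncation_bound N rho d.
  rewrite /truncation_bound -addrA lerDl addr_ge0 //.
    apply: mulr_ge0 (sqr_ge0 _); apply: mulr_ge0 => //; exact/exprn_ge0/ltW.
  by rewrite mulr_ge0 ?sqr_ge0 // mulr_ge0 // ltW.
(* The first argument serves the condition on Re f(1) in [freeprod_schur_bounded], the second the
   error per letter. *)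
pose e' := Num.min (d ^+ 2 / 2) (2 * eta).
have sq0 : 0 < d ^+ 2 / 2 by rewrite divr_gt0 // exprn_gt0.
have e'0 : 0 < e' by rewrite lt_min sq0 mulr_gt0.
have Hf i : exists f : G i -> C,
    [/\ exists A : seq (G i), forall g, g != 1%g -> f g != 0 ->
          i \in [seq (letter_type l : {classic I}) | l <- L] /\ g \in A,
        forall D : seq (G i), schur_bounded (fun g => g \in D)
          (fun g h => f (g^-1 * h)%g) (fun=> 1) (fun=> 1),
        1 - d ^+ 2 / 2 <= complex.Re (f 1%g) &
        forall l, l \in L -> letter_type l = i -> Normc.normc (f (component i l) - 1)
            <= e'].
  have [iL|iL] := boolP (i \in [seq (letter_type l : {classic I}) | l <- L]);
    last first.
    (* For factors that E does not meet, the indicator of the unit is used: its kernel is the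
       identity, and it vanishes on nontrivial letters, so the product stays finitely supported for
       an infinite family. *)
    exists (fun g => (g == 1%g)%:R); split.
    - by exists [::] => g /negbTE ->; rewrite eqxx.
    - move=> D; have H := schur_bounded_diag (ls := D) (h := id) (fun=> 1 : C)
        (fun (x : G i) (xD : x \in D) => xD).
      apply: schur_boundedW H => // [g h _ _|g _]; last by rewrite nsq1.
      rewrite -(inj_eq (mulgI g) (g^-1 * h)%g) mulVKg mulg1 eq_sym; by case: eqP.
    - by rewrite eqxx /= lerBlDr lerDl ltW.
    - by move=> l lL li; case/negP: iL; apply/mapP; exists l.
  have [f [[A fA] fS f1]] := weakly_amenable_schur
    (1%g :: [seq component i l | l <- L]) e'0 (hG i).
  exists f; split => //.
  - by exists A => g _ /fA.
  - have f11 := f1 _ (mem_head _ _).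
    have := Re_le_normc (- (f 1%g - 1)); rewrite normcN.
    have -> : complex.Re (- (f 1%g - 1)) = 1 - complex.Re (f 1%g).
      by case: (f 1%g) => a b /=; ring.
    have : e' <= d ^+ 2 / 2 by rewrite /e' ge_min lexx.
    lra.
  - by move=> l lL _; apply: f1; rewrite inE map_f ?orbT.
pose f i := sval (cid (Hf i)).
have fP i := svalP (cid (Hf i)); rewrite -/(f _) in fP.
have fS i (D : seq (G i)) : schur_bounded (fun g => g \in D)
  (fun g h => f i (g^-1 * h)%g) (fun=> 1) (fun=> 1) by have [_ + _ _] := fP i; exact.
have f1 i : 1 - d ^+ 2 / 2 <= complex.Re (f i 1%g) by have [] := fP i.
pose om m : C := (m <= N)%N%:R.
pose F : freeprod G -> R[i]^o := fval om (letter_weight f rho).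
have Fbd D := freeprod_schur_bounded rho0 rho1 d0 fS f1 N D.
have [B fB] : exists B : forall i, seq (G i), forall i g, g != 1%g -> f i g != 0 ->
    i \in [seq (letter_type l : {classic I}) | l <- L] /\ g \in B i.
  have HB i : exists A : seq (G i), forall g, g != 1%g -> f i g != 0 ->
    i \in [seq (letter_type l : {classic I}) | l <- L] /\ g \in A by have [] := fP i.
  by exists (fun i => sval (cid (HB i))) => i; exact: svalP (cid (HB i)).
pose Lf : seq Lt := flatten [seq [seq letter g | g <- B (projT1 l)] | l : Lt <- L].
have [A uA FA] : exists2 A : seq (freeprod G), uniq A & forall x, F x != 0 -> x \in A.
  apply: (@fval_finite om _ Lf N) => [m|l nl].
    by rewrite /om ltnNge => /negbTE ->.
  rewrite /letter_weight mulf_eq0 negb_or => /andP[_ fl].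
  have [lty lB] := fB _ _ nl fl.
  have /mapP[m mL lm] : letter_type l \in [seq letter_type l | l <- L] by exact: lty.
  rewrite /Lf; apply/flatten_mapP; exists m => //.
  have Bc i : i = projT1 l -> component i l \in B i by move=> ->;
    rewrite component_self.
  apply/mapP; exists (component (projT1 m) l); first exact/Bc/esym.
  by rewrite component_type.
have Ffin : finite_set [set x | F x != 0]%classic.
  by apply: (@sub_finite_set _ _ [set` A]%classic) (finite_seq A) => x /=; exact: FA.
have [M FM] := is_multiplier_exists Ffin.
exists F, M; split => //.
  have e10 : 0 <= 1 + e by lra.
  apply: (schur_bounded_multiplier e10 uA FA FM) => D.
  have t0 : 0 < truncation_bound N rho d by apply: lt_le_trans trunc1.
  have H : schur_bounded (fun g => g \in D) (fun x y => F (x^-1 * y)%g)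
    (fun=> 1 + e) (fun=> 1 + e) by exact: schur_boundedW (Fbd D).
  have e1V : 0 < (1 + e)^-1 by rewrite invr_gt0; lra.
  (* Converts the symmetric bounds into the pair 1 and (1 + e)^2 expected by
     [schur_bounded_multiplier]. *)
  have := schur_bounded_rescale e1V H; rewrite invrK mulVf ?expr2 //.
  by rewrite gt_eqF //; lra.
move=> x xE; rewrite /F /fval /om (leq_trans (En _ xE) n0N) mul1r.
have w1 : wprod (fun=> 1 : C) (nf x) = 1 by rewrite /wprod big1.
have r20 : 0 <= rho ^+ 2 by exact: sqr_ge0.
have r21 : rho ^+ 2 <= 1 by rewrite expr_le1 // ltW.
have NR (y : R) : Normc.normc y%:C%C = `|y| by rewrite /= expr0n addr0 sqrtr_sqr.
have NC (z : C) (c : R) : Normc.normc z <= c -> 0 <= c -> Normc.normc ((rho ^+ 2)%:C%C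
    * z) <= c.
  move=> zc c0; rewrite Normc.normcM NR ger0_norm // -[leRHS]mul1r.
  by apply: ler_pM => //; exact: normc_ge0.
rewrite -{1}w1.
apply: le_trans (@normc_wprod_diff _ _ L _ _ (4 * eta) _ _ _ _ (EL _ xE)) _.
- move=> l lL; apply: NC => //.
  have H : Normc.normc (f _ (1^-1 * projT2 l)%g) <= 1.
    apply: (schur_bounded_normc _ _ _ _ (fS (projT1 l) [:: 1%g; projT2 l])) => //.
      by rewrite mem_head.
    by rewrite !inE eqxx orbT.
  by rewrite invg1 mul1g in H.
- by move=> l _; rewrite Normc.normc1.
- move=> l lL; have [_ _ _ /(_ _ lL erefl)] := fP (letter_type l).
  rewrite component_self => fl.
  have e'eta : e' <= 2 * eta by rewrite /e' ge_min lexx orbT.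
  have -> : letter_weight f rho l - 1 = (rho ^+ 2)%:C%C * (f _ (projT2 l) - 1) - (1 -
      rho ^+ 2)%:C%C.
    by rewrite /letter_weight rmorphB rmorph1; ring.
  apply: le_trans (le_normcD _ _) _; rewrite normcN NR ger0_norm ?subr_ge0 //.
  have := NC _ _ (le_trans fl e'eta) (mulr_ge0 (ler0n _ _) (ltW eta0)).
  have : 1 - rho ^+ 2 <= 2 * eta.
    by rewrite /rho; have := sqr_ge0 eta; nra.
  lra.
- apply: le_trans n0eta; apply: ler_wpM2r; first by rewrite mulr_ge0 // ltW.
  by rewrite ler_nat En.
Qed.
End FreeProductApproximation.

(** * The Haagerup constant *)

Local Open Scope classical_set_scope.
Local Open Scope ring_scope.

Section HaagerupConstant.
Context {R : realType} {G : groupType}.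
Local Notation C := (R[i]^o).
Local Notation Cstar := (Cstar R G).

Lemma multiplier_value_le (f : G -> C) (M : {linear Cstar -> Cstar}) (c : R) :
  0 < c -> is_multiplier f M -> (cb_norm M <= c%:E)%E -> Normc.normc (f 1%g) <= c.
Proof.
move=> c0 fM Mc; apply/ler_addgt0Pr => e e0.
have H : Normc.normc (f (1^-1 * 1)%g) <= c + e.
  by apply: (schur_bounded_normc _ _ _ _
    (multiplier_schur_bounded [:: 1%g] c0 e0 fM Mc)); rewrite ?mem_head.
by rewrite invg1 mul1g in H.
Qed.

(** The completely bounded norm dominates |f(1)|, which tends to 1 along any approximating net. *)
Lemma haagerup_constant_ge1 : (1 <= @haagerup_constant R G)%E.
Proof.
apply: le_ereal_inf_tmp => _ [A [le [f [M [fnet fM -> _]]]]].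
apply: le_ereal_inf_tmp => _ [a0 _ <-].
rewrite leNgt; apply/negP => s1.
have [c [c0 c1 sc]] : exists c : R, [/\ 0 < c, c < 1 &
    (ereal_sup [set cb_norm (M b) | b in [set b | le a0 b]] <= c%:E)%E].
  case: (ereal_sup _) s1 => [s||] //; last by exists 2^-1; split; rewrite ?leNye //;
    lra.
  rewrite lte_fin => s1; exists (Num.max s 2^-1).
  by rewrite lt_max gt_max lee_fin le_max lexx s1; split=> //; [apply/orP; right|]; lra.
have e0 : 0 < (1 - c) / 2 by rewrite divr_gt0 // subr_gt0.
have [b a0b /(_ 1%g (mem_head _ _)) fb] := approximating_net_near [:: 1%g] a0 e0 fnet.
have Mb : (cb_norm (M b) <= c%:E)%E.
  by apply: le_trans sc; apply: ereal_sup_ubound; exists b.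
have := multiplier_value_le c0 (fM b) Mb.
have := le_normcD (- (f b 1%g - 1)) (f b 1%g).
rewrite normcN opprB subrK Normc.normc1.
lra.
Qed.

(** The net is indexed by pairs of a finite list and an integer n, with tolerance 1/(n+1) for both
    the norm and the values, so that increasing either component gives convergence and limsup at
    most 1. *)
Lemma haagerup_constant_le1
  (H : forall (E : seq G) (e : R), 0 < e -> e <= 1 ->
    exists (f : G -> C) (M : {linear Cstar -> Cstar}),
      [/\ finite_set [set g | f g != 0], is_multiplier f M,
          (cb_norm M <= (1 + e)%:E)%E &
          forall g, g \in E -> Normc.normc (f g - 1) <= e]) :
  (@haagerup_constant R G <= 1)%E.
Proof.
pose A := (seq G * nat)%type.
have HA (a : A) : exists fM : (G -> C) * {linear Cstar -> Cstar},
    [/\ finite_set [set g | fM.1 g != 0], is_multiplier fM.1 fM.2,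
        (cb_norm fM.2 <= (1 + a.2.+1%:R^-1)%:E)%E &
        forall g, g \in a.1 -> Normc.normc (fM.1 g - 1) <= a.2.+1%:R^-1].
  have [||f [M fMP]] := H a.1 (a.2.+1%:R^-1); last by exists (f, M).
    by rewrite invr_gt0.
  by rewrite invf_le1 // ler1n.
pose fM a := sval (cid (HA a)).
have fMP a := svalP (cid (HA a)); rewrite -/(fM _) in fMP.
pose le (a b : A) := {subset a.1 <= b.1} /\ (a.2 <= b.2)%N.
have dec (m n : nat) : (m <= n)%N -> n.+1%:R^-1 <= m.+1%:R^-1 :> R.
  by move=> mn; rewrite lef_pV2 ?posrE // ler_nat.
have small (e : R) : 0 < e -> exists n : nat, n.+1%:R^-1 < e.
  move=> e0; have [n _ /(_ n (leqnn n))] := near_infty_natSinv_lt (PosNum e0).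
  by exists n.
have ledir : directed le.
  split.
  - by split; exact: ([::], 0%N).
  - by move=> a; split.
  - move=> a b c [ab ab'] [bc bc']; split; last exact: leq_trans ab' bc'.
    by move=> g /ab /bc.
  - move=> a b; exists (a.1 ++ b.1, maxn a.2 b.2).
    split; split; rewrite /= ?leq_maxl ?leq_maxr // => g gE;
      rewrite mem_cat gE ?orbT //.
have fnet : approximating_net le (fun a => (fM a).1).
  split => // [a|g V]; first by have [] := fMP a.
  rewrite -nbhs_ballE => -[e /= e0 eV].
  have eE : e = (complex.Re e)%:C%C by rewrite RRe_real // ger0_real // ltW.
  have er0 : 0 < complex.Re e by rewrite -ltcR -eE.
  have [n ne] := small _ er0.
  exists ([:: g], n) => -[E m] [gE nm]; apply: eV => /=.
  have [_ _ _ /(_ g (gE _ (mem_head _ _))) fg] := fMP (E, m).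
  rewrite -ball_normE /= eE normr_normc ltcR -normcN opprB.
  exact: le_lt_trans (le_trans fg (dec _ _ nm)) ne.
have L1 : (net_limsup le (fun a => cb_norm (fM a).2) <= 1)%E.
  apply/lee_addgt0Pr => e e0; have [n ne] := small e e0.
  apply: (@le_trans _ _ (ereal_sup [set cb_norm (fM b).2 | b in [set b | le ([::], n)
      b]])).
    by apply: ereal_inf_lbound; exists ([::], n).
  apply: ge_ereal_sup => _ [b [_ /= nb] <-].
  have [_ _ Mb _] := fMP b; apply: le_trans Mb _.
  by rewrite -EFinD lee_fin lerD2l (le_trans (dec _ _ nb)) // ltW.
apply: (le_trans _ L1); apply: ereal_inf_lbound.
exists A, le, (fun a => (fM a).1), (fun a => (fM a).2); split => //.
- by move=> a; have [] := fMP a.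
- by apply: le_lt_trans L1 _; rewrite ltry.
Qed.
End HaagerupConstant.

Theorem theorem4p13 (R : realType) (I : Type) (G : I -> groupType)
  (hG : forall i : I, weakly_amenable_with_constant_1 R (G i)) :
  weakly_amenable_with_constant_1 R (freeprod G).
Proof.
apply/eqP; rewrite eq_le haagerup_constant_ge1 andbT.
by apply: haagerup_constant_le1 => E e e0 e1; exact: freeprod_multiplier.
Qed.
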